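(* Let $r\ge1$ and let $J\in\hat{\mathcal{B}}_1^r(\mathbb{R}^2)$ be closed and supported in a bounded open set $U\subset\mathbb{C}\simeq\mathbb{R}^2$ such that $\mathrm{Ind}_J(w)=0$ for all $w\in\mathbb{C}\setminus U$. Suppose there exists $K\in\hat{\mathcal{B}}_2^{r-1}(\mathbb{R}^2)$ with finite mass such that $\partial K=J$. If $f$ is holomorphic on $U$ and $z\in U\setminus\mathrm{supp}(J)$, then $$f(z)\,\mathrm{Ind}_J(z)=\frac1{2\pi i}\int_J\frac{f(w)}{w-z}\,dw .$$
   Context: Differential chains. $\mathcal{P}_k(\mathbb{R}^n)$ is the real vector space of finitely supported sections of $\Lambda^kT\mathbb{R}^n$ (pointed $k$-chains), written as formal sums $A=\sum_i(p_i;\alpha_i)$ with $\alpha_i\in\Lambda^kT_{p_i}\mathbb{R}^n$. The mass of a $k$-vector is $\|\alpha\|=\inf\{\sum|\alpha_i|:\alpha=\sum\alpha_i,\ \alpha_i\text{ simple}\}$, with $|\alpha_i|$ the Euclidean $k$-volume. Put $\Delta_u(p;\alpha)=(p+u;\alpha)-(p;\alpha)$ (extended linearly), and for $U'=\{u_1,\dots,u_j\}$ (repetitions allowed) $\Delta_{U'}^j=\Delta_{u_1}\circ\cdots\circ\Delta_{u_j}$, $\Delta^0=\mathrm{Id}$, and $|\Delta_{U'}^j(p;\alpha)|_j=\|u_1\|\cdots\|u_j\|\,\|\alpha\|$. For an integer $r\ge0$, $$\|A\|_{B^r}=\inf\Big\{\sum_{i=1}^N|\Delta_{U_i}^{j_i}(p_i;\alpha_i)|_{j_i}:A=\sum_{i=1}^N\Delta_{U_i}^{j_i}(p_i;\alpha_i),\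 0\le j_i\le r\Big\}.$$ $\hat{\mathcal{B}}_k^r(\mathbb{R}^n)$ is the completion of $\mathcal{P}_k(\mathbb{R}^n)$ in this norm; its elements are (differential) $k$-chains of order $r$. Lower-order chains are regarded as higher-order chains via the canonical maps $\hat{\mathcal B}_k^r\to\hat{\mathcal B}_k^s$, $r\le s$, extending the identity. Mass. The mass of a chain $K$ is $\inf\{\liminf_i\|A_i\|_{B^0}:A_i\to K\}$, the infimum over all sequences of pointed chains $A_i$ converging to $K$. Forms and integral. $\mathcal{B}_k^r(\mathbb{R}^n)$ is the space of bounded $k$-forms $\omega$ with $\sup\{|\omega(\Delta_{U'}^j(p;\alpha))|:|\Delta_{U'}^j(p;\alpha)|_j=1,\ 0\le j\le r\}<\infty$, where $\omega(\sum(p_i;\alpha_i))=\sum\omega_{p_i}(\alpha_i)$ (for $r\ge1$: forms of class $C^{r-1}$ with bounded derivatives up to order $r-1$ and Lipschitz derivatives of order $r-1$). Each $\omega\in\mathcal{B}_k^r(\mathbb{R}^n)$ extends to a continuous functional on $\hat{\mathcal{B}}_k^r(\mathbb{R}^n)$; the Harrison integral is $\int_J\omega:=\omega(J)$, extended complex-linearly to complex-valued forms. Support. A closed set $X\subseteq\mathbb{R}^n$ supports $J$ if for every nonempty open $W\supseteq X$ there are $A_i\in\mathcal{P}_k(\mathbb{R}^n)$ supported at points of $W$ with $A_i\to J$ in $\hat{\mathcal B}_k^r(\mathbb{R}^n)$. $\mathrm{supp}(J)$ is the intersection of all closed sets supporting $J$, and $J$ is supported in a set $Z$ if $\mathrm{supp}(J)\subseteq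 Z$. Boundary. $J\in\hat{\mathcal{B}}_1^r(\mathbb{R}^2)$ is closed if $\partial J=0$, i.e. $\int_Jdg=0$ for all $g\in\mathcal{B}_0^{r+1}(\mathbb{R}^2)$. For a $2$-chain $K\in\hat{\mathcal{B}}_2^{r-1}(\mathbb{R}^2)$, $\partial K=J$ means $\int_Kd\omega=\int_J\omega$ for all $\omega\in\mathcal{B}_1^{r+1}(\mathbb{R}^2)$. Integral of a locally defined form. If $J\in\hat{\mathcal{B}}_1^r(\mathbb{R}^2)$ has compact support contained in an open set $V$ and $g:V\to\mathbb{C}$ is smooth, then $\int_Jg(w)\,dw:=\int_J\chi g\,dw$ with $dw=dx+i\,dy$, where $\chi$ is any smooth function with compact support in $V$ equal to $1$ on a neighborhood of $\mathrm{supp}(J)$; the value does not depend on $\chi$. Winding number. For $z\notin\mathrm{supp}(J)$, $\mathrm{Ind}_J(z):=\frac1{2\pi i}\int_J\frac{dw}{w-z}$, where the integrand is understood as multiplied by a smooth function vanishing near $z$ and equal to $1$ outside a small disc about $z$ whose closure is disjoint from $\mathrm{supp}(J)$ (the value is independent of this choice). *)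

(* Defs.v *)
From HB Require Import structures.
From mathcomp Require Import all_boot all_order all_algebra generic_quotient ring_quotient.
From mathcomp Require Import all_classical all_reals all_analysis.
From mathcomp Require Import complex.

Set Implicit Arguments.
Unset Strict Implicit.
Unset Printing Implicit Defensive.

Import Order.TTheory GRing.Theory Num.Theory.
Import numFieldNormedType.Exports.

Local Open Scope classical_set_scope.
Local Open Scope ring_scope.

(* MathComp-Analysis norms 'rV[R]_n with the sup norm, which induces the right
   topology but not the Euclidean length. *)
Definition enorm (R : realType) (n : nat) (u : 'rV[R]_n) : R :=
  Num.sqrt (\sum_i u 0 i ^+ 2).

(* The k-subsets of {0, ..., n-1}: S = {i_1 < ... < i_k} indexes the basis
   k-vector e_{i_1} /\ ... /\ e_{i_k} and the dual basis k-covector. *)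
Definition kidx (n k : nat) := {S : {set 'I_n} | #|S| == k}.

Definition kvec (R : realType) (n k : nat) := {ffun kidx n k -> R}.

HB.instance Definition _ (R : realType) n k :=
  GRing.Lmodule.copy (kvec R n k) {ffun kidx n k -> R}.

(* enum_val enumerates S in increasing order. *)
Definition kidx_nth (n k : nat) (S : kidx n k) (j : 'I_k) : 'I_n :=
  enum_val (cast_ord (esym (eqP (valP S))) j).

(* Exterior product of the rows of M. *)
Definition wedge (R : realType) (n k : nat) (M : 'M[R]_(k, n)) : kvec R n k :=
  [ffun S => \det (colsub (kidx_nth S) M)].

(* The scalar is only needed for k = 0. *)
Definition simple_kvec (R : realType) (n k : nat) (a : kvec R n k) : Prop :=
  exists (c : R) (M : 'M[R]_(k, n)), a = c *: wedge M.

(* On a simple k-vector this is the Euclidean k-volume: by Cauchy-Binet,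
   the sum of the squares of the maximal minors of M is det (M M^T). *)
Definition kvol (R : realType) (n k : nat) (a : kvec R n k) : R :=
  Num.sqrt (\sum_S a S ^+ 2).

Definition kmass (R : realType) (n k : nat) (a : kvec R n k) : R :=
  inf [set \sum_(b <- s) kvol b | s in
        [set s : seq (kvec R n k) |
          (forall b, b \in s -> simple_kvec b) /\ a = \sum_(b <- s) b]].

Section PointedChains.
Variables (R : realType) (n k : nat).

Definition fin_supp : {pred 'rV[R]_n -> kvec R n k} :=
  fun A => `[< finite_set [set p | A p != 0] >].

Fact fin_supp_zmod_closed : zmod_closed fin_supp.
Proof.
split.
  apply/asboolP; rewrite (_ : mkset _ = set0) //.
  by apply/seteqP; split=> p //=; rewrite eqxx.
move=> A B /asboolP fA /asboolP fB; apply/asboolP.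
apply: (@sub_finite_set _ _ ([set p | A p != 0] `|` [set p | B p != 0])).
  move=> p /=; have [A0|] := eqVneq (A p) 0; last by left.
  have [B0|] := eqVneq (B p) 0; last by right.
  by rewrite -[(A - B) p]/(A p - B p) A0 B0 subrr eqxx.
by rewrite finite_setU.
Qed.
HB.instance Definition _ :=
  GRing.isZmodClosed.Build ('rV[R]_n -> kvec R n k) fin_supp fin_supp_zmod_closed.

Record pchain := PChain {
  pchain_val :> 'rV[R]_n -> kvec R n k;
  _ : pchain_val \in fin_supp }.

HB.instance Definition _ := [isSub for pchain_val].
HB.instance Definition _ := [Choice of pchain by <:].
HB.instance Definition _ := [SubChoice_isSubZmodule of pchain by <:].

Fact ptchain_subproof (p : 'rV[R]_n) (a : kvec R n k) :
  (fun q => if q == p then a else 0) \in fin_supp.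
Proof.
apply/asboolP; apply: (@sub_finite_set _ _ [set p]); last exact: finite_set1.
by move=> q /=; have [->|_] := eqVneq q p; rewrite ?eqxx.
Qed.

(* (p; a) *)
Definition ptchain (p : 'rV[R]_n) (a : kvec R n k) : pchain :=
  PChain (ptchain_subproof p a).

Fact Delta_subproof (u : 'rV[R]_n) (A : pchain) :
  (fun q => A (q - u) - A q) \in fin_supp.
Proof.
have /asboolP fA : pchain_val A \in fin_supp := valP A.
apply/asboolP.
apply: (@sub_finite_set _ _
  ((fun q => q + u) @` [set p | A p != 0] `|` [set p | A p != 0])).
  move=> q /=; have [A0|An0] := eqVneq (A (q - u)) 0.
    by rewrite A0 sub0r oppr_eq0; right.
  by left; exists (q - u); rewrite ?subrK.
by rewrite finite_setU; split=> //; apply: finite_image.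
Qed.

(* The linear extension of (p; a) |-> (p + u; a) - (p; a): the translate of
   the section A by u has value A (q - u) at q. *)
Definition Delta (u : 'rV[R]_n) (A : pchain) : pchain :=
  PChain (Delta_subproof u A).

Definition Deltas (U : seq 'rV[R]_n) (A : pchain) : pchain := foldr Delta A U.

Definition dnorm (U : seq 'rV[R]_n) (a : kvec R n k) : R :=
  (\prod_(u <- U) enorm u) * kmass a.

(* A triple (U, p, a) encodes Delta_U^j (p; a) with j = size U. *)
Definition dcell := (seq 'rV[R]_n * 'rV[R]_n * kvec R n k)%type.

Definition dcell_chain (c : dcell) : pchain := Deltas c.1.1 (ptchain c.1.2 c.2).

Definition dcell_norm (c : dcell) : R := dnorm c.1.1 c.2.

Definition Bcosts (r : nat) (A : pchain) : set R :=
  [set \sum_(c <- s) dcell_norm c | s in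
    [set s : seq dcell | (forall c, c \in s -> (size c.1.1 <= r)%N) /\
                         A = \sum_(c <- s) dcell_chain c]].

Definition Bnorm (r : nat) (A : pchain) : R := inf (Bcosts r A).

Lemma pchainP (A B : pchain) : (forall p, A p = B p) -> A = B.
Proof. by move=> AB; apply/val_inj/funext. Qed.

Lemma pchainDE (A B : pchain) p : (A + B) p = A p + B p. Proof. by []. Qed.

Lemma pchainNE (A : pchain) p : (- A) p = - A p. Proof. by []. Qed.

Lemma pchain_sumE I (s : seq I) (F : I -> pchain) p :
  (\sum_(i <- s) F i) p = \sum_(i <- s) F i p.
Proof.
elim: s => [|i s IHs]; first by rewrite !big_nil.
by rewrite !big_cons pchainDE IHs.
Qed.

Lemma DeltaN u A : Delta u (- A) = - Delta u A.
Proof.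
apply: pchainP => p; rewrite pchainNE.
by rewrite -[LHS]/(- A (p - u) - - A p) -[in RHS]/(A (p - u) - A p) opprD.
Qed.

Lemma DeltasN U A : Deltas U (- A) = - Deltas U A.
Proof. by elim: U => //= u U ->; rewrite DeltaN. Qed.

Lemma ptchainN p a : ptchain p (- a) = - ptchain p a.
Proof.
by apply: pchainP => q; rewrite pchainNE /=; case: eqP => // _; rewrite oppr0.
Qed.

Lemma kvolN (a : kvec R n k) : kvol (- a) = kvol a.
Proof.
by rewrite /kvol; congr Num.sqrt; apply: eq_bigr => S _; rewrite ffunE sqrrN.
Qed.

Lemma kmass_ge0 (a : kvec R n k) : 0 <= kmass a.
Proof.
rewrite /kmass; set E := (X in inf X).
have [->|/set0P E0] := eqVneq E set0; first by rewrite inf0.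
apply: lb_le_inf => // _ [s _ <-].
by apply: sumr_ge0 => b _; apply: sqrtr_ge0.
Qed.

Lemma kmassN (a : kvec R n k) : kmass (- a) = kmass a.
Proof.
suff sub (b : kvec R n k) : [set \sum_(c <- s) kvol c | s in
        [set s : seq (kvec R n k) |
          (forall c, c \in s -> simple_kvec c) /\ b = \sum_(c <- s) c]] `<=`
    [set \sum_(c <- s) kvol c | s in
        [set s : seq (kvec R n k) |
          (forall c, c \in s -> simple_kvec c) /\ - b = \sum_(c <- s) c]].
  rewrite /kmass; congr inf; apply/seteqP; split; last exact: sub.
  by move=> x /sub; rewrite opprK.
move=> _ [s [ss bE] <-]; exists (map -%R s).
  split; last by rewrite big_map sumrN -bE.
  move=> _ /mapP[c /ss [l [M ->]] ->]; exists (- l), M.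
  by rewrite scaleNr.
by rewrite big_map; apply: eq_bigr => c _; rewrite kvolN.
Qed.

Lemma dcell_norm_ge0 c : 0 <= dcell_norm c.
Proof.
apply: mulr_ge0; last exact: kmass_ge0.
by apply: prodr_ge0 => u _; apply: sqrtr_ge0.
Qed.

Lemma Bcosts_lb0 r A : lbound (Bcosts r A) 0.
Proof. by move=> _ [s _ <-]; apply: sumr_ge0 => c _; exact: dcell_norm_ge0. Qed.

Lemma Bcosts_neq0 r A : Bcosts r A !=set0.
Proof.
have /asboolP /finite_seqP[X XE] : pchain_val A \in fin_supp := valP A.
pose s := [seq (([::] : seq 'rV[R]_n), p, A p) | p <- undup X].
exists (\sum_(c <- s) dcell_norm c); exists s => //; split.
  by move=> _ /mapP[p _ ->].
apply: pchainP => q; rewrite pchain_sumE big_map /=.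
have [A0|An0] := eqVneq (A q) 0.
  by rewrite big1 // => p _ /=; have [<-|//] := eqVneq q p.
have qX : q \in undup X.
  by rewrite mem_undup; have : [set` X] q by rewrite -XE.
rewrite (bigD1_seq q) ?undup_uniq //= eqxx big1 ?addr0 // => p.
by rewrite eq_sym => /negbTE ->.
Qed.

Lemma Bcosts_has_lbound r A : has_lbound (Bcosts r A).
Proof. by exists 0; exact: Bcosts_lb0. Qed.

Lemma Bnorm_ge0 r A : 0 <= Bnorm r A.
Proof. by apply: lb_le_inf; [exact: Bcosts_neq0|exact: Bcosts_lb0]. Qed.

Lemma Bnorm0 r : Bnorm r 0 = 0.
Proof.
apply/eqP; rewrite eq_le Bnorm_ge0 andbT; apply: ge_inf.
  exact: Bcosts_has_lbound.
by exists [::]; [split=> //|]; rewrite ?big_nil.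
Qed.

Lemma BcostsN r A x : Bcosts r A x -> Bcosts r (- A) x.
Proof.
move=> [s [ss AE] <-]; exists [seq (c.1, - c.2) | c <- s].
  split; first by move=> _ /mapP[c /ss ? ->].
  rewrite AE big_map -sumrN; apply: eq_bigr => c _.
  by rewrite /dcell_chain /= ptchainN DeltasN.
by rewrite big_map; apply: eq_bigr => c _; rewrite /dcell_norm /dnorm /= kmassN.
Qed.

Lemma BnormN r A : Bnorm r (- A) = Bnorm r A.
Proof.
rewrite /Bnorm; congr inf; apply/seteqP; split=> x; last exact: BcostsN.
by move/BcostsN; rewrite opprK.
Qed.

Lemma BnormD r A B : Bnorm r (A + B) <= Bnorm r A + Bnorm r B.
Proof.
rewrite -lerBlDl; apply: lb_le_inf; first exact: Bcosts_neq0.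
move=> y cy; rewrite lerBlDl -lerBlDr; apply: lb_le_inf; first exact: Bcosts_neq0.
move=> x cx; rewrite lerBlDr; apply: ge_inf; first exact: Bcosts_has_lbound.
case: cx cy => s [ss ->] <- [t [tt ->] <-]; exists (s ++ t).
  split; last by rewrite big_cat.
  by move=> c; rewrite mem_cat => /orP[/ss|/tt].
by rewrite big_cat.
Qed.

Lemma BnormB r A B : Bnorm r (A - B) <= Bnorm r A + Bnorm r B.
Proof. by rewrite -[Bnorm r B]BnormN BnormD. Qed.

End PointedChains.

(* The completion of the pointed chains in the B^r norm: Cauchy sequences
   modulo null sequences. Only the additive structure is set up. *)
Section Completion.
Variables (R : realType) (n k r : nat).
Local Notation P := (pchain R n k).

Definition Bcauchy : {pred nat -> P} := fun A =>
  `[< forall e : R, 0 < e -> exists N, forall i j, (N <= i)%N -> (N <= j)%N ->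
        Bnorm r (A i - A j) < e >].

Fact Bcauchy_zmod_closed : zmod_closed Bcauchy.
Proof.
split.
  by apply/asboolP => e e0; exists 0%N => i j _ _; rewrite subrr Bnorm0.
move=> A B /asboolP cA /asboolP cB; apply/asboolP => e e0.
have e20 : 0 < e / 2 by rewrite divr_gt0.
have [N HN] := cA _ e20; have [M HM] := cB _ e20.
exists (maxn N M) => i j; rewrite !geq_max => /andP[Ni Mi] /andP[Nj Mj].
rewrite -[(A - B) i]/(A i - B i) -[(A - B) j]/(A j - B j).
rewrite opprB [B j - _]addrC addrACA [- B i + _]addrC [e]splitr; apply: (le_lt_trans (BnormD _ _ _)); apply: ltrD.
  exact: HN.
exact: HM.
Qed.
HB.instance Definition _ :=
  GRing.isZmodClosed.Build (nat -> P) Bcauchy Bcauchy_zmod_closed.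

Record cauchy_seq := CauchySeq {
  cauchy_val :> nat -> P;
  _ : cauchy_val \in Bcauchy }.

HB.instance Definition _ := [isSub for cauchy_val].
HB.instance Definition _ := [Choice of cauchy_seq by <:].
HB.instance Definition _ := [SubChoice_isSubZmodule of cauchy_seq by <:].

Definition Bnull : {pred cauchy_seq} := fun A =>
  `[< Bnorm r (A i) @[i --> \oo] --> (0 : R) >].

Fact Bnull_zmod_closed : zmod_closed Bnull.
Proof.
split.
  apply/asboolP; rewrite (_ : (fun i => _) = cst 0); first exact: cvg_cst.
  by apply/funext => i; rewrite -[X in Bnorm r X]/(0 : P) Bnorm0.
move=> A B /asboolP cA /asboolP cB; apply/asboolP.
apply: (@squeeze_cvgr _ _ _ _ (cst 0) (fun i => Bnorm r (A i) + Bnorm r (B i))).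
- by near=> i; rewrite Bnorm_ge0 BnormB.
- exact: cvg_cst.
- by rewrite -[X in _ --> X]addr0; apply: cvgD.
Unshelve. all: by end_near.
Qed.
HB.instance Definition _ :=
  GRing.isZmodClosed.Build cauchy_seq Bnull Bnull_zmod_closed.

Definition dchain := Quotient.quot Bnull.
HB.instance Definition _ := GRing.Zmodule.on dchain.

Definition chain_seq (J : dchain) : nat -> P := repr J.

Fact const_cauchy (A : P) : (fun=> A) \in Bcauchy.
Proof.
by apply/asboolP => e e0; exists 0%N => i j _ _; rewrite subrr Bnorm0.
Qed.

Definition chain_of (A : P) : dchain :=
  (\pi_dchain (CauchySeq (const_cauchy A)))%qT.

Definition chain_norm (J : dchain) : R := limn (fun i => Bnorm r (chain_seq J i)).

Definition chain_cvg (A : nat -> P) (J : dchain) : Prop :=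
  chain_norm (chain_of (A i) - J) @[i --> \oo] --> (0 : R).

Definition chain_mass (J : dchain) : \bar R :=
  ereal_inf [set limn_einf (fun i => (Bnorm 0 (A i))%:E) |
              A in [set A : nat -> P | chain_cvg A J]].

Definition supports (X : set 'rV[R]_n) (J : dchain) : Prop :=
  forall W : set 'rV[R]_n, open W -> W !=set0 -> X `<=` W ->
    exists A : nat -> P,
      (forall i p, A i p != 0 -> W p) /\ chain_cvg A J.

Definition chain_supp (J : dchain) : set 'rV[R]_n :=
  \bigcap_(X in [set X | closed X /\ supports X J]) X.

End Completion.

Section Forms.
Variables (R : realType) (n : nat).

(* w p S is the coefficient of w at p on the basis k-covector indexed by S. *)
Definition dform (k : nat) := 'rV[R]_n -> {ffun kidx n k -> R}.

Definition cform (k : nat) := 'rV[R]_n -> {ffun kidx n k -> R[i]}.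

Definition form_eval k (w : dform k) (A : pchain R n k) : R :=
  \sum_(p \in [set: 'rV[R]_n]) \sum_S w p S * A p S.

(* The class B_k^r of forms; j = 0 is the boundedness of w. *)
Definition Bform k (r : nat) (w : dform k) : Prop :=
  exists M : R, forall (U : seq 'rV[R]_n) (p : 'rV[R]_n) (a : kvec R n k),
    (size U <= r)%N -> dnorm U a = 1 ->
    `|form_eval w (Deltas U (ptchain p a))| <= M.

(* The value at J of the continuous extension of w. *)
Definition chain_int k r (J : dchain R n k r) (w : dform k) : R :=
  limn (fun i => form_eval w (chain_seq J i)).

Definition chain_cint k r (J : dchain R n k r) (w : cform k) : R[i] :=
  (chain_int J (fun p => [ffun S => complex.Re (w p S)]) +i*
   chain_int J (fun p => [ffun S => complex.Im (w p S)]))%C.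

Definition ebase (i : 'I_n) : 'rV[R]_n := delta_mx 0 i.

Definition pderive (i : 'I_n) (h : 'rV[R]_n -> R) : 'rV[R]_n -> R :=
  fun p => 'D_(ebase i) h p.

Definition form_coef k (w : dform k) (S : {set 'I_n}) (p : 'rV[R]_n) : R :=
  if insub S is Some T then w p T else 0.

(* Exterior derivative: dx_i /\ dx_{S \ i} = (-1)^#{j in S, j < i} dx_S. *)
Definition ext_d k (w : dform k) : dform k.+1 := fun p => [ffun S : kidx n k.+1 =>
  \sum_(i in val S) (-1) ^+ #|[set j : 'I_n in val S | (j < i)%N]%SET| *
    pderive i (form_coef w (val S :\ i)) p].

Definition closed_chain r (J : dchain R n 1 r) : Prop :=
  forall g : dform 0, Bform r.+1 g -> chain_int J (ext_d g) = 0.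

Definition is_boundary k s r (K : dchain R n k.+1 s) (J : dchain R n k r) : Prop :=
  forall w : dform k, Bform r.+1 w -> chain_int K (ext_d w) = chain_int J w.

Fixpoint of_class_C (m : nat) (h : 'rV[R]_n -> R) : Prop :=
  continuous h /\
  if m is m'.+1 then
    forall i, (forall p, derivable h p (ebase i)) /\ of_class_C m' (pderive i h)
  else True.

Definition smooth (h : 'rV[R]_n -> R) : Prop := forall m, of_class_C m h.

End Forms.

Section Planar.
Variable R : realType.

(* The identification of R^2 with C. *)
Definition toC (p : 'rV[R]_2) : R[i] := (p 0 0 +i* p 0 1)%C.

(* g dw, where dw = dx + i dy *)
Definition dw_form (g : 'rV[R]_2 -> R[i]) : cform R 2 1 := fun p =>
  [ffun S : kidx 2 1 => g p * \sum_(i in val S) toC (ebase R i)].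

Definition cutoff (X V : set 'rV[R]_2) (chi : 'rV[R]_2 -> R) : Prop :=
  [/\ smooth chi,
      compact (closure [set p | chi p != 0]),
      closure [set p | chi p != 0] `<=` V &
      exists W, [/\ open W, X `<=` W & forall p, W p -> chi p = 1]].

(* int_J g dw for g defined on a neighborhood V of supp J: the integral
   of chi g dw for a chosen cutoff chi, on which it does not depend. The values
   of g outside V are irrelevant. *)
Definition local_integral r (J : dchain R 2 1 r) (V : set 'rV[R]_2)
    (g : 'rV[R]_2 -> R[i]) : R[i] :=
  xget 0 [set I | exists2 chi, cutoff (chain_supp J) V chi &
    I = chain_cint J (dw_form (fun p => (chi p)%:C%C * g p))].

Definition pole_cutoff (X : set 'rV[R]_2) (z : 'rV[R]_2)
    (eta : 'rV[R]_2 -> R) : Prop :=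
  [/\ smooth eta, \forall p \near z, eta p = 0 &
      exists e : R, [/\ 0 < e, [set p | enorm (p - z) <= e] `&` X = set0 &
                       forall p, e <= enorm (p - z) -> eta p = 1]].

Definition twopii : R[i] := (0 +i* (2 * pi))%C.

Definition Ind r (J : dchain R 2 1 r) (z : 'rV[R]_2) : R[i] :=
  twopii^-1 * xget 0 [set I | exists2 eta, pole_cutoff (chain_supp J) z eta &
    I = chain_cint J (dw_form (fun p => (eta p)%:C%C / (toC p - toC z)))].

Definition holomorphic (f : R[i] -> R[i]) (D : set R[i]) : Prop :=
  forall w, D w -> derivable (f : R[i]^o -> R[i]^o) w 1.

End Planar.

(* Main.v *)
(* Let H be the union of supp J with the points off supp J of nonzero winding
   number. For a closed J the winding number is locally constant off supp J, so
   H is compact, and H is contained in U. Given a cutoff chi, a grid of small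
   squares yields a cycle G of segments in U, off H, {z} and supp chi, such that
   2 pi i f(w) is the integral over G of f(s)/(s - w) ds for w in H, {z} and
   supp chi. Substituting this in the integral of chi f(w)/(w - z) dw over J and
   exchanging the integrals leaves, for s on G, the integral over J of
   1/((s - w)(w - z)) = (1/(w - z) - 1/(w - s)) / (s - z), which equals
   2 pi i Ind_J(z)/(s - z) since Ind_J(s) = 0; the integral over G then gives
   back f(z). *)
From mathcomp Require Import all_boot all_order all_algebra generic_quotient.
From mathcomp Require Import all_classical all_reals all_analysis.
From mathcomp Require Import complex ring lra.
Require Import Defs.

Set Implicit Arguments.
Unset Strict Implicit.
Unset Printing Implicit Defensive.

Import Order.TTheory GRing.Theory Num.Theory.
Import numFieldNormedType.Exports ComplexField.Normc.

Local Open Scope classical_set_scope.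
Local Open Scope ring_scope.

(** * Iterated differences *)

(** A chain is only a limit in the B^r norm, so every fact about J has to come from bounds on
    iterated differences of integrands. This has three consequences. The kernel 1/(w - s) is
    unbounded, so it is replaced by a smooth [std_kern] that agrees with it off a disc about s; this
    is a translate of one fixed function, which makes its bounds uniform in s. The replacement is
    harmless because an integral over J depends only on the form near supp J; that needs an
    argument, since the support is an intersection of supporting sets and is not known to support J
    itself. Lastly, the exchange of integrals is a finite computation for a pointed chain, and it
    passes to J because one approximating pointed chain serves at once all integrands with a common
    bound. The support of chi belongs to the set enclosed by the grid cycle because the substituted
    formula has to be an identity between functions on the whole plane before it is integrated over
    J. *)

Section EuclideanNorm.
Variables (R : realType) (n : nat).
Implicit Types u v : 'rV[R]_n.

Lemma enorm_ge0 u : 0 <= enorm u. Proof. exact: sqrtr_ge0. Qed.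

Lemma sqr_enorm u : enorm u ^+ 2 = \sum_i u 0 i ^+ 2.
Proof. by rewrite sqr_sqrtr // sumr_ge0 // => i _; exact: sqr_ge0. Qed.

Lemma coord_le_enorm u i : `|u 0 i| <= enorm u.
Proof.
rewrite -(@ler_pXn2r _ 2) ?nnegrE ?enorm_ge0 // sqr_enorm real_normK ?num_real //.
by rewrite (bigD1 i) //= lerDl sumr_ge0 // => j _; exact: sqr_ge0.
Qed.

Lemma enorm_eq0 u : enorm u = 0 -> u = 0.
Proof.
move=> u0; apply/rowP => i; rewrite mxE; apply/eqP.
by rewrite -normr_le0 -u0 coord_le_enorm.
Qed.

Lemma enormZ (t : R) u : enorm (t *: u) = `|t| * enorm u.
Proof.
rewrite /enorm -sqrtr_sqr -sqrtrM ?sqr_ge0 //; congr Num.sqrt.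
by rewrite mulr_sumr; apply: eq_bigr => i _; rewrite mxE exprMn.
Qed.

Lemma enorm0 : enorm (0 : 'rV[R]_n) = 0.
Proof. by rewrite -(scale0r 0) enormZ normr0 mul0r. Qed.

Lemma enormN u : enorm (- u) = enorm u.
Proof. by rewrite -scaleN1r enormZ normrN1 mul1r. Qed.

End EuclideanNorm.

Section Differences.
Variables (R : realType) (n : nat).
Local Notation V := 'rV[R]_n.
Implicit Types (h : V -> R) (U : seq V) (u p : V) (M : R).

Definition fdiff u h : V -> R := fun p => h (p + u) - h p.

(** Dual to [Deltas]: a form evaluated on an iterated difference of a pointed vector is the same
    iterated difference of its coefficients. *)
Fixpoint fdiffs U h : V -> R := if U is u :: U' then fdiffs U' (fdiff u h) else h.

(** The coefficientwise counterpart of [Bform], homogeneous in the vectors and with an explicit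
    constant, so that it can be shared by a family of functions. *)
Definition Bd (m : nat) M h := forall U p, (size U <= m)%N ->
  `|fdiffs U h p| <= M * \prod_(u <- U) enorm u.

Lemma prod_enorm_ge0 U : 0 <= \prod_(u <- U) enorm u.
Proof. by apply: prodr_ge0 => u _; exact: enorm_ge0. Qed.

Lemma fdiffC u v h : fdiff u (fdiff v h) = fdiff v (fdiff u h).
Proof. by apply/funext => p; rewrite /fdiff (addrAC p u v); ring. Qed.

Lemma fdiffs_fdiff U u h : fdiffs U (fdiff u h) = fdiff u (fdiffs U h).
Proof. by elim: U h => //= v U IH h; rewrite fdiffC IH. Qed.

Lemma fdiffsD U h1 h2 p :
  fdiffs U (fun q => h1 q + h2 q) p = fdiffs U h1 p + fdiffs U h2 p.
Proof.
elim: U h1 h2 => //= u U IH h1 h2; rewrite -IH; congr fdiffs.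
by apply/funext => q; rewrite /fdiff; ring.
Qed.

Lemma fdiffsZ U (c : R) h p : fdiffs U (fun q => c * h q) p = c * fdiffs U h p.
Proof.
elim: U h => //= u U IH h; rewrite -IH; congr fdiffs.
by apply/funext => q; rewrite /fdiff; ring.
Qed.

Lemma fdiffs_shift U h (a : V) p :
  fdiffs U (fun q => h (q + a)) p = fdiffs U h (p + a).
Proof.
elim: U h => //= u U IH h; rewrite -IH; congr fdiffs.
by apply/funext => q; rewrite /fdiff (addrAC q).
Qed.

Lemma fdiffs_scale U h (t : R) p :
  fdiffs U (fun q => h (t *: q)) p = fdiffs (map ( *:%R t) U) h (t *: p).
Proof.
elim: U h => //= u U IH h; rewrite -IH; congr fdiffs.
by apply/funext => q; rewrite /fdiff scalerDr.
Qed.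

Lemma Bd_ge0 m M h : Bd m M h -> 0 <= M.
Proof.
by move=> /(_ [::] 0 isT); rewrite big_nil mulr1; apply: le_trans.
Qed.

Lemma Bd_sup m M h p : Bd m M h -> `|h p| <= M.
Proof. by move=> /(_ [::] p isT); rewrite big_nil mulr1. Qed.

Lemma Bd_le m m' M M' h : (m' <= m)%N -> M <= M' -> Bd m M h -> Bd m' M' h.
Proof.
move=> mm MM B U p sU; apply: le_trans (B U p (leq_trans sU mm)) _.
by rewrite ler_wpM2r // prod_enorm_ge0.
Qed.

Lemma Bd_fdiff m M h u : Bd m.+1 M h -> Bd m (M * enorm u) (fdiff u h).
Proof.
move=> B U p sU; have := B (u :: U) p sU; rewrite big_cons /=.
by rewrite mulrA.
Qed.

Lemma BdD m M1 M2 h1 h2 : Bd m M1 h1 -> Bd m M2 h2 ->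
  Bd m (M1 + M2) (fun p => h1 p + h2 p).
Proof.
move=> B1 B2 U p sU; rewrite fdiffsD mulrDl.
by apply: le_trans (ler_normD _ _) (lerD (B1 _ _ sU) (B2 _ _ sU)).
Qed.

Lemma BdZ m M h (c : R) : Bd m M h -> Bd m (`|c| * M) (fun p => c * h p).
Proof.
by move=> B U p sU; rewrite fdiffsZ normrM -mulrA ler_wpM2l // B.
Qed.

Lemma BdN m M h : Bd m M h -> Bd m M (fun p => - h p).
Proof.
move=> B; have := BdZ (-1) B; rewrite normrN1 mul1r.
by under eq_fun do rewrite mulN1r.
Qed.

Lemma Bd_cst m (c : R) : Bd m `|c| (fun=> c).
Proof.
have D0 U p : fdiffs U (fun=> 0) p = 0 :> R.
  elim: U => //= u U IH; rewrite (_ : fdiff u _ = fun=> 0) //.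
  by apply/funext => q; rewrite /fdiff subrr.
move=> [|u U] p _ /=; first by rewrite big_nil mulr1.
rewrite (_ : fdiff u _ = fun=> 0) ?D0; last first.
  by apply/funext => q; rewrite /fdiff subrr.
by rewrite normr0 mulr_ge0 // prod_enorm_ge0.
Qed.

Lemma Bd_shift m M h (a : V) : Bd m M h -> Bd m M (fun p => h (p + a)).
Proof. by move=> B U p sU; rewrite fdiffs_shift B. Qed.

(** Contracting the argument contracts every difference vector. This supplies arbitrarily wide
    cutoffs with one common bound. *)
Lemma Bd_scale m M h (t : R) : `|t| <= 1 -> Bd m M h ->
  Bd m M (fun p => h (t *: p)).
Proof.
move=> t1 B U p sU; rewrite fdiffs_scale.
apply: le_trans (B _ _ _) _; first by rewrite size_map.
rewrite ler_wpM2l ?(Bd_ge0 B) // big_map; elim: U {sU} => [|u U IH].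
  by rewrite !big_nil.
rewrite !big_cons enormZ; apply: ler_pM IH; rewrite ?mulr_ge0 ?enorm_ge0 //.
  by apply: prodr_ge0 => v _; exact: enorm_ge0.
by rewrite -[leRHS]mul1r ler_wpM2r ?enorm_ge0.
Qed.

(** Discrete Leibniz rule: each difference of a product splits into two terms, whence the factor 2
    per order. *)
Lemma BdM m M1 M2 h1 h2 : Bd m M1 h1 -> Bd m M2 h2 ->
  Bd m (2 ^+ m * M1 * M2) (fun p => h1 p * h2 p).
Proof.
(* The induction closes when the order is exactly k; smaller orders follow since 2 ^+ size U is at
   most 2 ^+ m. *)
suff key k N1 N2 g1 g2 : Bd k N1 g1 -> Bd k N2 g2 -> forall U p, size U = k ->
    `|fdiffs U (fun p => g1 p * g2 p) p| <= 2 ^+ k * N1 * N2 * \prod_(u <- U) enorm u.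
  move=> B1 B2 U p sU.
  apply: le_trans (key (size U) _ _ _ _ (Bd_le sU (lexx _) B1)
    (Bd_le sU (lexx _) B2) U p erefl) _.
  rewrite ler_wpM2r ?prod_enorm_ge0 // ler_wpM2r ?(Bd_ge0 B2) //.
  by rewrite ler_wpM2r ?(Bd_ge0 B1) // ler_weXn2l // ler1n.
elim: k N1 N2 g1 g2 => [|k IH] N1 N2 g1 g2 B1 B2 U p.
  move=> /size0nil -> /=; rewrite big_nil mulr1 expr0 mul1r normrM.
  by apply: ler_pM; rewrite // ?(Bd_sup _ B1) ?(Bd_sup _ B2).
case: U => //= u U [sU].
have -> : fdiff u (fun p => g1 p * g2 p) =
    fun q => fdiff u g1 q * g2 (q + u) + g1 q * fdiff u g2 q.
  by apply/funext => q; rewrite /fdiff; ring.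
rewrite fdiffsD big_cons.
apply: le_trans (ler_normD _ _) _.
have I1 := IH _ _ _ _ (Bd_fdiff u B1)
  (Bd_le (leqnSn k) (lexx _) (Bd_shift u B2)) U p sU.
have I2 := IH _ _ _ _ (Bd_le (leqnSn k) (lexx _) B1) (Bd_fdiff u B2) U p sU.
apply: le_trans (lerD I1 I2) _; rewrite exprS.
by rewrite le_eqVlt; apply/orP; left; apply/eqP; ring.
Qed.

End Differences.

(** * Difference bounds and partial derivatives *)

Section PartialDerivatives.
Variables (R : realType) (n : nat).
Local Notation V := 'rV[R]_n.
Implicit Types (h g : V -> R) (U : seq V) (u p : V) (M : R) (i : 'I_n).

Lemma is_derive_line h p i (t : R) : derivable h (p + t *: ebase R i) (ebase R i) ->
  is_derive t 1 (fun s : R => h (p + s *: ebase R i))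
    (pderive i h (p + t *: ebase R i)).
Proof.
set q := p + _ => dh.
have E : (fun s : R => s^-1 *: (((fun s : R => h (p + s *: ebase R i)) \o shift t)
    (s *: 1) - h (p + t *: ebase R i))) =
  (fun s : R => s^-1 *: ((h \o shift q) (s *: ebase R i) - h q)).
  apply/funext => s /=; congr (_ *: (h _ - _)).
  by rewrite /q [s *: 1]mulr1 scalerDl addrCA.
by split; rewrite /derivable /pderive /derive /= E.
Qed.

Lemma line_lipschitz h p i (t M : R) :
  (forall q, derivable h q (ebase R i)) -> (forall q, `|pderive i h q| <= M) ->
  `|h (p + t *: ebase R i) - h p| <= `|t| * M.
Proof.
move=> dh hM; pose g s := h (p + s *: ebase R i).
have dg (s : R) : is_derive s 1 g (pderive i h (p + s *: ebase R i)).
  exact: is_derive_line.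
have cg (a b : R) : {within `[a, b], continuous g}.
  by apply: derivable_within_continuous => s _; case: (dg s).
have -> : h p = g 0 by rewrite /g scale0r addr0.
rewrite -/(g t); have [t0|/ltW t0] := leP 0 t.
  have [c _ ->] := MVT_segment t0 (fun s _ => dg s) (cg _ _).
  by rewrite subr0 normrM mulrC ler_wpM2l.
have [c _ E] := MVT_segment t0 (fun s _ => dg s) (cg _ _).
by rewrite distrC E sub0r normrM normrN mulrC ler_wpM2l.
Qed.

(** The increment u is made one coordinate at a time, so the mean value theorem along coordinate
    lines suffices and no total derivative is involved. *)
Lemma coord_lipschitz h p u M :
  (forall i q, derivable h q (ebase R i)) -> (forall i q, `|pderive i h q| <= M) ->
  `|fdiff u h p| <= (\sum_i `|u 0 i|) * M.
Proof.
move=> dh hM; rewrite /fdiff [X in p + X](row_sum_delta u).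
elim: (index_enum _) p => [|i s IH] p; first by rewrite !big_nil addr0 subrr normr0 mul0r.
rewrite !big_cons addrA -(subrKA (h (p + u 0 i *: ebase R i))) mulrDl [leRHS]addrC.
apply: le_trans (ler_normD _ _) (lerD (IH _) _).
exact: line_lipschitz.
Qed.

Lemma derivable_fdiff h p u i : (forall q, derivable h q (ebase R i)) ->
  derivable (fdiff u h) p (ebase R i).
Proof.
move=> dh; have du : derivable (fun p => h (p + u)) p (ebase R i).
  have := dh (p + u); rewrite /derivable.
  by under eq_fun do rewrite /= addrA.
exact: derivableB du (dh p).
Qed.

Lemma pderive_fdiff h p u i : (forall q, derivable h q (ebase R i)) ->
  pderive i (fdiff u h) p = fdiff u (pderive i h) p.
Proof.
move=> dh; have du : derivable (fun p => h (p + u)) p (ebase R i).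
  have := dh (p + u); rewrite /derivable.
  by under eq_fun do rewrite /= addrA.
rewrite /pderive; apply: etrans (deriveB du (dh p)) _; congr (_ - _).
rewrite /derive (_ : (fun s : R => _) =
  fun s : R => s^-1 *: ((h \o shift (p + u)) (s *: ebase R i) - h (p + u))) //.
by apply/funext => s /=; rewrite addrA.
Qed.

Lemma derivable_fdiffs h p U i : (forall q, derivable h q (ebase R i)) ->
  derivable (fdiffs U h) p (ebase R i).
Proof.
by elim: U h => //= u U IH h dh; apply: IH => q; exact: derivable_fdiff.
Qed.

Lemma pderive_fdiffs h p U i : (forall q, derivable h q (ebase R i)) ->
  pderive i (fdiffs U h) p = fdiffs U (pderive i h) p.
Proof.
elim: U h => //= u U IH h dh.
rewrite IH; last by move=> q; exact: derivable_fdiff.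
by congr fdiffs; apply/funext => q; exact: pderive_fdiff.
Qed.

(** One difference is estimated by the mean value theorem and the others commute with the partial
    derivatives. [M'] covers the order 0; the factor n bounds the sum of the coordinates of u by its
    Euclidean length. The absolute value of M is taken because for n = 0 nothing forces M to be
    nonnegative. *)
Lemma Bd_of_pderive m M M' h : (forall i p, derivable h p (ebase R i)) ->
  (forall p, `|h p| <= M') -> (forall i, Bd m M (pderive i h)) ->
  Bd m.+1 (M' + n%:R * `|M|) h.
Proof.
move=> dh hM dM [|u U] p sU.
  by rewrite big_nil mulr1 /= (le_trans (hM p)) // lerDl mulr_ge0.
rewrite big_cons /= fdiffs_fdiff.
have dU i q : derivable (fdiffs U h) q (ebase R i) by exact: derivable_fdiffs.
have bU i q : `|pderive i (fdiffs U h) q| <= `|M| * \prod_(u <- U) enorm u.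
  rewrite pderive_fdiffs //; apply: le_trans (dM i U q sU) _.
  by rewrite ler_wpM2r ?prod_enorm_ge0 // ler_norm.
apply: le_trans (coord_lipschitz p u dU bU) _.
apply: (@le_trans _ _ (n%:R * enorm u * (`|M| * \prod_(u <- U) enorm u))).
  rewrite ler_wpM2r ?mulr_ge0 ?prod_enorm_ge0 //.
  apply: le_trans (ler_sum _ (fun i _ => coord_le_enorm u i)) _.
  by rewrite sumr_const card_ord mulr_natl.
have -> (a b c d : R) : a * b * (c * d) = a * c * (b * d) by ring.
apply: ler_wpM2r; first by rewrite mulr_ge0 ?enorm_ge0 ?prod_enorm_ge0.
by rewrite lerDr (le_trans _ (hM 0)).
Qed.

(** The extra difference along [t *: ebase R i] has weight |t|, which cancels against the difference
    quotient; the bound then passes to the limit. *)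
Lemma pderive_Bd m M h i : (forall p, derivable h p (ebase R i)) ->
  Bd m.+1 M h -> Bd m M (pderive i h).
Proof.
move=> dh B U p sU; rewrite -pderive_fdiffs //.
have dU : derivable (fdiffs U h) p (ebase R i) by exact: derivable_fdiffs.
rewrite /pderive /derive -lim_norm //.
have e1 : enorm (ebase R i) = 1.
  rewrite /enorm (bigD1 i) //= mxE !eqxx expr1n big1 ?addr0 ?sqrtr1 // => j.
  by rewrite mxE eqxx => /negbTE ->; rewrite expr0n.
apply: limr_le; first exact: is_cvg_norm.
near=> t.
have t0 : t != 0 by near: t; exact: nbhs_dnbhs_neq.
have := B (t *: ebase R i :: U) p; rewrite /= big_cons enormZ e1 mulr1.
move=> /(_ sU); rewrite fdiffs_fdiff /fdiff [_ *: _ + p]addrC => Bt.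
rewrite normrM normfV ler_pdivrMl ?normr_gt0 //.
by apply: le_trans Bt _; rewrite mulrCA.
Unshelve. all: by end_near. Qed.

End PartialDerivatives.

(** * Smooth functions *)

Section SmoothFunctions.
Variables (R : realType) (n : nat).
Local Notation V := 'rV[R]_n.
Implicit Types (h g : V -> R) (p : V) (i : 'I_n) (m : nat).

(** Turns a partial derivative into a derivative in one real variable, where the chain rule is
    available. *)
Lemma is_derive_lineP h p i (d : R) :
  is_derive p (ebase R i) h d <->
  is_derive (0 : R) 1 (fun s : R => h (p + s *: ebase R i)) d.
Proof.
have E : (fun s : R => s^-1 *: (((fun s : R => h (p + s *: ebase R i)) \o shift 0)
    (s *: 1) - h (p + 0 *: ebase R i))) =
  (fun s : R => s^-1 *: ((h \o shift p) (s *: ebase R i) - h p)).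
  apply/funext => s /=; rewrite scale0r !addr0; congr (_ *: (h _ - _)).
  by rewrite [s *: 1]mulr1 addrC.
by split=> -[]; rewrite /derivable /derive => D <-; split; move: D;
  rewrite /derivable /derive /= E.
Qed.

Lemma of_class_C_continuous m h : of_class_C m h -> continuous h.
Proof. by case: m => [|m] []. Qed.

Lemma of_class_C_S m h : of_class_C m.+1 h -> of_class_C m h.
Proof.
elim: m h => [|m IH] h [ch dh]; split=> // i.
by have [dhi /IH chi] := dh i.
Qed.

Lemma of_class_C_cst m (c : R) : of_class_C m (fun _ : V => c).
Proof.
elim: m c => [|m IH] c; split=> //; try exact: cst_continuous.
move=> i; split; first by move=> p; exact: derivable_cst.
rewrite (_ : pderive i _ = fun=> 0) //.
by apply/funext => p; rewrite /pderive derive_cst.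
Qed.

Lemma of_class_C_coord m (j : 'I_n) : of_class_C m (fun p : V => p 0 j).
Proof.
have D i (p : V) : is_derive p (ebase R i) (fun p : V => p 0 j) (i == j)%:R.
  apply/is_derive_lineP.
  have -> : (fun s : R => (p + s *: ebase R i) 0 j) =
      cst (p 0 j) + (i == j)%:R \*: (@id R).
    by apply/funext => s; rewrite !mxE eqxx eq_sym mulrC.
  by apply: is_derive_eq; rewrite add0r [_ *: 1]mulr1.
case: m => [|m]; split=> //; try exact: coord_continuous.
move=> i; split; first by move=> p; case: (D i p).
rewrite (_ : pderive i _ = fun=> (i == j)%:R); first exact: of_class_C_cst.
by apply/funext => p; case: (D i p).
Qed.

Lemma of_class_CD m h g : of_class_C m h -> of_class_C m g ->
  of_class_C m (fun p => h p + g p).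
Proof.
elim: m h g => [|m IH] h g [ch dh] [cg dg]; split=> //.
- by move=> p; apply: continuousD; [exact: ch|exact: cg].
- by move=> p; apply: continuousD; [exact: ch|exact: cg].
move=> i; have [dhi chi] := dh i; have [dgi cgi] := dg i; split.
  by move=> p; apply: (@derivableD _ _ _ h g).
rewrite (_ : pderive i _ = fun p => pderive i h p + pderive i g p); first exact: IH.
by apply/funext => p; exact: (@deriveD _ _ _ h g).
Qed.

Lemma of_class_CM m h g : of_class_C m h -> of_class_C m g ->
  of_class_C m (fun p => h p * g p).
Proof.
elim: m h g => [|m IH] h g Ch Cg; move: (Ch) (Cg) => [ch dh] [cg dg]; split=> //.
- by move=> p; apply: continuousM; [exact: ch|exact: cg].
- by move=> p; apply: continuousM; [exact: ch|exact: cg].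
move=> i; have [dhi chi] := dh i; have [dgi cgi] := dg i; split.
  by move=> p; exact: derivableM (dhi p) (dgi p).
rewrite (_ : pderive i _ = fun p => h p * pderive i g p + g p * pderive i h p).
  apply: of_class_CD; apply: IH => //; exact: of_class_C_S.
by apply/funext => p; exact: deriveM (dhi p) (dgi p).
Qed.

Lemma of_class_CN m h : of_class_C m h -> of_class_C m (fun p => - h p).
Proof.
move=> Ch; have := of_class_CM (of_class_C_cst m (-1)) Ch.
by under eq_fun do rewrite mulN1r.
Qed.

Lemma of_class_CB m h g : of_class_C m h -> of_class_C m g ->
  of_class_C m (fun p => h p - g p).
Proof. by move=> Ch /of_class_CN; exact: of_class_CD. Qed.

Lemma of_class_C_sum m I (s : seq I) (F : I -> V -> R) :
  (forall k, of_class_C m (F k)) -> of_class_C m (fun p => \sum_(k <- s) F k p).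
Proof.
move=> CF; elim: s => [|k s IH].
  by under eq_fun do rewrite big_nil; exact: of_class_C_cst.
by under eq_fun do rewrite big_cons; exact: of_class_CD.
Qed.

Lemma of_class_CV m h : (forall p, h p != 0) -> of_class_C m h ->
  of_class_C m (fun p => (h p)^-1).
Proof.
move=> h0; elim: m => [|m IH] Ch; move: (Ch) => [ch dh]; split=> //.
- by move=> p; exact: cvgV (h0 p) (ch p).
- by move=> p; exact: cvgV (h0 p) (ch p).
move=> i; have [dhi chi] := dh i; split.
  by move=> p; exact: derivableV (h0 p) (dhi p).
rewrite (_ : pderive i _ =
    fun p => (- ((h p)^-1 * (h p)^-1)) * pderive i h p); last first.
  apply/funext => p; apply: etrans (deriveV (h0 p) (dhi p)) _.
  by rewrite expr2 invfM.
have CV := IH (of_class_C_S Ch).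
exact: of_class_CM (of_class_CN (of_class_CM CV CV)) chi.
Qed.

End SmoothFunctions.

Section Flat.
Variable R : realType.
Implicit Types (x : R) (k : nat).

(** The factor x^-k makes the family closed under differentiation: derivatives are combinations of
    [flat k.+2] and [flat k.+1]. Smoothness can therefore be shown by induction for all k at
    once. *)
Definition flat k x : R := if 0 < x then x^-1 ^+ k * expR (- x^-1) else 0.

Lemma flat_ge0 k x : 0 <= flat k x.
Proof.
by rewrite /flat; case: ifP => // /ltW x0; rewrite mulr_ge0 ?exprn_ge0 ?invr_ge0 ?expR_ge0.
Qed.

Lemma flat_gt0 k x : (0 < flat k x) = (0 < x).
Proof.
rewrite /flat; case: ifP => [x0|]; last by rewrite ltxx.
by rewrite mulr_gt0 ?expR_gt0 // exprn_gt0 ?invr_gt0.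
Qed.

Lemma flat_le0 k x : x <= 0 -> flat k x = 0.
Proof. by rewrite /flat ltNge => ->. Qed.

(** With y = 1/x, the exponential series gives e^y >= y^(k+2)/(k+2)!. A quadratic bound is what
    forces the derivative at 0 to vanish. *)
Lemma flat_quadratic k x : flat k x <= (k.+2)`!%:R * x ^+ 2.
Proof.
rewrite /flat; case: ifP => [x0|_]; last by rewrite mulr_ge0 ?sqr_ge0.
have y0 : 0 < x^-1 by rewrite invr_gt0.
have f0 : 0 < (k.+2)`!%:R :> R by rewrite ltr0n fact_gt0.
have := expR_ge1Dxn k.+1 (ltW y0); set y := x^-1 in y0 *.
move/(le_trans _) => /(_ (y ^+ k.+2 / k.+2`!%:R)).
rewrite lerDr ler01 => /(_ isT) yE.
rewrite expRN ler_pdivrMr ?expR_gt0 //.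
have -> : y ^+ k = (k.+2)`!%:R * x ^+ 2 * (y ^+ k.+2 / k.+2`!%:R).
  rewrite -addn2 exprD /y.
  have x0' : x != 0 by rewrite gt_eqF.
  by field; rewrite x0' gt_eqF.
by rewrite ler_wpM2l // mulr_ge0 ?sqr_ge0 // ltW.
Qed.

Lemma is_derive_flat k x :
  is_derive x 1 (flat k) (flat k.+2 x - k%:R * flat k.+1 x).
Proof.
have [x0|x0|<-] := ltrgtP 0 x.
- apply: (@near_eq_is_derive _ _ _
    (fun x => x^-1 ^+ k * expR (- x^-1))).
    near=> y; rewrite /flat ifT //.
    by near: y; exact: lt_nbhsr.
  rewrite /flat x0.
  have DV : is_derive x 1 (fun y : R => y^-1) (- x ^- 2).
    have := @is_deriveV _ (@id R) x 1 1 (lt0r_neq0 x0) (is_derive_id _ _).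
    by rewrite [_ *: 1]mulr1.
  have DE : is_derive x 1 (fun y : R => expR (- y^-1)) (expR (- x^-1) * x ^- 2).
    apply: is_derive1_comp; rewrite -[X in is_derive _ _ _ X]opprK.
    exact: is_deriveN.
  have DX := @is_deriveX _ _ (fun y : R => y^-1) k x 1 _ DV.
  rewrite (_ : (fun x : R => x^-1 ^+ k * expR (- x^-1)) =
    (fun y => y^-1) ^+ k * (fun y => expR (- y^-1))); last first.
    by apply/funext => y; rewrite [RHS]/GRing.mul /= exprfctE.
  apply: is_derive_eq (is_deriveM DX DE) _.
  rewrite /GRing.scale /= !fctE -exprVn; case: k {DX} => [|k].
    by rewrite /= !expr0 !mul0r mulr0 subr0 addr0 mul1r mulrC.
  by rewrite /= !exprS expr0; ring.
- apply: (@near_eq_is_derive _ _ _ (fun _ => 0)).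
    near=> y; rewrite flat_le0 // ltW //.
    by near: y; exact: lt_nbhsl.
  rewrite !flat_le0 ?(ltW x0) // mulr0 subr0; exact: is_derive_cst.
rewrite !flat_le0 // mulr0 subr0.
suff D : (fun h : R => h^-1 *: ((flat k \o shift 0) (h *: 1) - flat k 0)) @ 0^' --> (0 : R).
  by split; [apply/cvg_ex; exists 0|exact: cvg_lim D].
apply/cvgr0Pnorm_lt => e e0.
have f0 : 0 < (k.+2)`!%:R :> R by rewrite ltr0n fact_gt0.
near=> h.
have h0 : h != 0 by near: h; exact: nbhs_dnbhs_neq.
rewrite /= addr0 [h *: 1]mulr1 [flat k 0]flat_le0 // subr0 normrM normfV.
rewrite ltr_pdivrMl ?normr_gt0 // ger0_norm ?flat_ge0 //.
apply: le_lt_trans (flat_quadratic k h) _.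
rewrite -real_normK ?num_real // expr2 mulrCA ltr_pM2l ?normr_gt0 //.
rewrite mulrC -ltr_pdivlMr //.
near: h; apply: nbhs_dnbhs; exists (e / k.+2`!%:R); first by rewrite /= divr_gt0.
by move=> h /=; rewrite sub0r normrN.
Unshelve. all: by end_near. Qed.

Lemma of_class_C_flat n m k (h : 'rV[R]_n -> R) : of_class_C m h ->
  of_class_C m (flat k \o h).
Proof.
have cf j : continuous (flat j).
  move=> x; apply/differentiable_continuous/derivable1_diffP.
  by case: (is_derive_flat j x).
elim: m k h => [|m IH] k h Ch; move: (Ch) => [ch dh]; split=> //.
- by move=> p; exact: continuous_comp (ch p) (cf k (h p)).
- by move=> p; exact: continuous_comp (ch p) (cf k (h p)).
move=> i; have [dhi chi] := dh i.
have D (p : 'rV[R]_n) : is_derive p (ebase R i) (flat k \o h)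
    ((flat k.+2 (h p) - k%:R * flat k.+1 (h p)) * pderive i h p).
  apply/is_derive_lineP; apply: (@is_derive1_comp _ (flat k)).
    by rewrite scale0r addr0; exact: is_derive_flat.
  by apply/is_derive_lineP; split.
split; first by move=> p; case: (D p).
rewrite (_ : pderive i _ = fun p =>
  (flat k.+2 (h p) - k%:R * flat k.+1 (h p)) * pderive i h p); last first.
  by apply/funext => p; case: (D p).
have Ch' := of_class_C_S Ch.
apply: of_class_CM => //; apply: of_class_CB; first exact: (IH k.+2 h).
by apply: of_class_CM; [exact: of_class_C_cst|exact: (IH k.+1 h)].
Qed.

End Flat.

(** * Bump functions, and bounds for smooth functions of bounded support *)

Section Bump.
Variables (R : realType) (n : nat).
Local Notation V := 'rV[R]_n.
Implicit Types (h : V -> R) (p q a : V).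

Lemma smooth_sqr_dist a : smooth (fun p => enorm (p - a) ^+ 2).
Proof.
move=> m; under eq_fun do rewrite sqr_enorm.
apply: of_class_C_sum => i; under eq_fun do rewrite expr2 !mxE.
have C : of_class_C m (fun p : V => p 0 i - a 0 i).
  exact: of_class_CB (of_class_C_coord _ m i) (of_class_C_cst _ m _).
exact: of_class_CM.
Qed.

Lemma enorm_continuous a : continuous (fun p => enorm (p - a)).
Proof.
move=> p; have -> : (fun p => enorm (p - a)) = Num.sqrt \o (fun p => enorm (p - a) ^+ 2).
  by apply/funext => q; rewrite /= sqrtr_sqr ger0_norm ?enorm_ge0.
apply: continuous_comp; last exact: sqrt_continuous.
exact: (of_class_C_continuous (smooth_sqr_dist a 0)).
Qed.

Lemma enorm_lt_open a e : open [set p | enorm (p - a) < e].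
Proof.
apply: (@open_comp _ _ (fun p => enorm (p - a)) [set x | x < e]); last exact: open_lt.
by move=> p _; exact: enorm_continuous.
Qed.

Lemma enorm_gt_open a e : open [set p | e < enorm (p - a)].
Proof.
apply: (@open_comp _ _ (fun p => enorm (p - a)) [set x | e < x]); last exact: open_gt.
by move=> p _; exact: enorm_continuous.
Qed.

(** The topology comes from the sup norm: a coordinate is at most the Euclidean length, and
    Euclidean balls are open. *)
Lemma nbhs_enormP a (A : set V) :
  nbhs a A <-> exists2 e, 0 < e & forall p, enorm (p - a) < e -> A p.
Proof.
split=> [/nbhs_ballP[e /= e0 eA]|[e e0 eA]].
  exists e => // p pe; apply: eA; split=> // i j; rewrite ord1.
  rewrite /ball /= distrC; apply: le_lt_trans _ pe.
  by have := coord_le_enorm (p - a) j; rewrite !mxE.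
apply: filterS eA _; apply: (open_nbhs_nbhs _ (A := [set p | _])).
split; first exact: enorm_lt_open.
by rewrite /= subrr enorm0.
Qed.

Lemma enorm_le_compact (e : R) : compact [set p : V | enorm p <= e].
Proof.
apply: bounded_closed_compact.
  exists e; split; first exact: num_real.
  move=> x ex p /= pe; rewrite [`|p|]mx_normrE; apply: bigmax_le => [|[i j] _].
    exact: le_trans (enorm_ge0 p) (le_trans pe (ltW ex)).
  by rewrite ord1; apply: le_trans (coord_le_enorm p j) (le_trans pe (ltW ex)).
rewrite -openC (_ : ~` _ = [set p | e < enorm (p - 0)]); first exact: enorm_gt_open.
by apply/seteqP; split=> p /=; rewrite subr0 ltNge => /negP.
Qed.

(** Equal to 1 up to distance e from a and to 0 from distance 2e on. Squared distances are used
    because they are polynomial in the coordinates, hence smooth also at a. *)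
Definition bump a (e : R) p : R :=
  flat 0 (4 * e ^+ 2 - enorm (p - a) ^+ 2) /
  (flat 0 (4 * e ^+ 2 - enorm (p - a) ^+ 2) + flat 0 (enorm (p - a) ^+ 2 - e ^+ 2)).

Section BumpFacts.
Variables (a : V) (e : R).
Hypothesis e0 : 0 < e.

Let den_gt0 p :
  0 < flat 0 (4 * e ^+ 2 - enorm (p - a) ^+ 2) + flat 0 (enorm (p - a) ^+ 2 - e ^+ 2).
Proof.
have [|H] := ltP 0 (4 * e ^+ 2 - enorm (p - a) ^+ 2).
  by move=> H; apply: ltr_pwDl; rewrite ?flat_gt0 ?flat_ge0.
apply: ltr_wpDl; rewrite ?flat_ge0 // flat_gt0 subr_gt0.
by have := exprn_gt0 2 e0; lra.
Qed.

Lemma bump_smooth : smooth (bump a e).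
Proof.
move=> m; have S := smooth_sqr_dist a m.
have S1 : of_class_C m (flat 0 \o (fun p => 4 * e ^+ 2 - enorm (p - a) ^+ 2)).
  exact/of_class_C_flat/(of_class_CB (of_class_C_cst _ m _)).
have S2 : of_class_C m (flat 0 \o (fun p => enorm (p - a) ^+ 2 - e ^+ 2)).
  exact/of_class_C_flat/(of_class_CB S (of_class_C_cst _ m _)).
apply: of_class_CM => //; apply: of_class_CV; last exact: of_class_CD.
by move=> p; rewrite gt_eqF // den_gt0.
Qed.

Lemma bump_ge0 p : 0 <= bump a e p.
Proof. by rewrite mulr_ge0 ?flat_ge0 // invr_ge0 ltW. Qed.

Lemma bump1 p : enorm (p - a) <= e -> bump a e p = 1.
Proof.
move=> pe; have := den_gt0 p; rewrite /bump.
rewrite [flat 0 (_ - e ^+ 2)]flat_le0 ?addr0; last first.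
  by rewrite subr_le0 ler_pXn2r ?nnegrE ?enorm_ge0 ?(ltW e0).
by move=> d0; rewrite divff // gt_eqF.
Qed.

Lemma bump0 p : 2 * e <= enorm (p - a) -> bump a e p = 0.
Proof.
move=> pe; rewrite /bump [flat 0 (4 * _ - _)]flat_le0 ?mul0r //.
have -> : 4 * e ^+ 2 = (2 * e) ^+ 2 by ring.
by rewrite subr_le0 ler_pXn2r // nnegrE ?enorm_ge0 // mulr_ge0 // ltW.
Qed.

End BumpFacts.

(** Compactness bounds the function itself; its partial derivatives again have bounded support, so
    the order is raised by [Bd_of_pderive]. *)
Lemma smooth_bounded_support_Bd m h : of_class_C m h ->
  (exists B, forall p, B < enorm p -> h p = 0) -> exists M, Bd m M h.
Proof.
elim: m h => [|m IH] h Ch [B hB].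
  have [M hM] : exists M, forall p, `|h p| <= M.
    have [M [_ HM]] := compact_bounded (continuous_compact
      (continuous_subspaceT (of_class_C_continuous Ch)) (@enorm_le_compact B)).
    exists (Num.max (M + 1) 0) => p; rewrite le_max.
    have [pB|/hB ->] := leP (enorm p) B; last by rewrite normr0 lexx orbT.
    by rewrite (HM (M + 1)) ?ltrDl //; exists p.
  by exists M => -[|//] p _; rewrite big_nil mulr1.
have [M0 HM0] := IH h (of_class_C_S Ch) (ex_intro _ B hB).
have [ch dh] := Ch.
have [M HM] : exists M, forall i, Bd m M (pderive i h).
  have /choice[M HM] i : exists M, Bd m M (pderive i h).
    have [dhi chi] := dh i; apply: IH chi _; exists B => p Bp.
    have -> : pderive i h p = 'D_(ebase R i) (cst 0) p.
      apply: near_eq_derive; apply: filterS (fun p => hB p) _.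
      have := enorm_gt_open (a := 0) (e := B); under eq_set do rewrite subr0.
      by move=> o; exact: open_nbhs_nbhs.
    by rewrite derive_cst.
  exists (\sum_i `|M i|) => i; apply: Bd_le (leqnn m) _ (HM i).
  by rewrite (bigD1 i) //= (le_trans (ler_norm _)) // lerDl sumr_ge0.
exists (M0 + n%:R * `|M|); apply: Bd_of_pderive => // [i p|p].
  by case: (dh i).
exact: Bd_sup HM0.
Qed.

Lemma enorm_far a (d : R) : exists B, forall p, B < enorm p -> d < enorm (p - a).
Proof.
(* Chosen for |p|^2 <= 2|p - a|^2 + 2|a|^2; the summand 1 ensures |p| <= |p|^2. *)
exists (1 + 2 * d ^+ 2 + 2 * enorm a ^+ 2) => p Bp.
have par : enorm p ^+ 2 <= 2 * enorm (p - a) ^+ 2 + 2 * enorm a ^+ 2.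
  rewrite !sqr_enorm !mulr_sumr -big_split; apply: ler_sum => i _ /=; rewrite !mxE.
  by rewrite -subr_ge0; have := sqr_ge0 (p 0 i - 2 * a 0 i); congr (0 <= _); ring.
have p1 : 1 <= enorm p.
  by apply: le_trans (ltW Bp); rewrite -addrA lerDl addr_ge0 // mulr_ge0 ?sqr_ge0.
have pp : enorm p <= enorm p ^+ 2 by rewrite expr2 ler_peMl // (le_trans ler01).
have dd : d ^+ 2 < enorm (p - a) ^+ 2 by lra.
have [d0|d0] := ltP d 0; first by rewrite (lt_le_trans d0) // enorm_ge0.
by rewrite -(@ltr_pXn2r _ 2) // nnegrE enorm_ge0.
Qed.

Lemma bounded_support_far h a d : (forall p, d < enorm (p - a) -> h p = 0) ->
  exists B, forall p, B < enorm p -> h p = 0.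
Proof. by move=> hd; have [B HB] := enorm_far a d; exists B => p /HB /hd. Qed.

Lemma bump_Bd m a e : 0 < e -> exists M, Bd m M (bump a e).
Proof.
move=> e0; apply: smooth_bounded_support_Bd; first exact: bump_smooth.
by apply: (@bounded_support_far _ a (2 * e)) => p pe; rewrite bump0 // ltW.
Qed.

End Bump.

(** * The Cauchy kernel *)

Section PlaneKernel.
Variable R : realType.
Local Notation V := 'rV[R]_2.
Local Notation C := R[i].
Implicit Types (g h : V -> C) (p q z : V) (m : nat) (M : R).

Lemma sum_ord2 (A : nmodType) (F : 'I_2 -> A) : \sum_i F i = F 0 + F 1.
Proof. by rewrite big_ord_recl big_ord1; congr (_ + F _); exact: val_inj. Qed.

Lemma complexP (x y : C) : complex.Re x = complex.Re y ->
  complex.Im x = complex.Im y -> x = y.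
Proof. by move=> rE iE; apply/eqP; rewrite eq_complex rE iE !eqxx. Qed.

Lemma ReM (x y : C) : complex.Re (x * y) =
  complex.Re x * complex.Re y - complex.Im x * complex.Im y.
Proof. by case: x; case: y. Qed.

Lemma ImM (x y : C) : complex.Im (x * y) =
  complex.Re x * complex.Im y + complex.Im x * complex.Re y.
Proof. by case: x => a b; case: y => c d /=; rewrite addrC [b * c]mulrC. Qed.

Lemma ReD (x y : C) : complex.Re (x + y) = complex.Re x + complex.Re y.
Proof. by case: x; case: y. Qed.

Lemma ImD (x y : C) : complex.Im (x + y) = complex.Im x + complex.Im y.
Proof. by case: x; case: y. Qed.

Lemma ReN (x : C) : complex.Re (- x) = - complex.Re x.
Proof. by case: x. Qed.

Lemma ImN (x : C) : complex.Im (- x) = - complex.Im x.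
Proof. by case: x. Qed.

Lemma normc_ge0 (x : C) : 0 <= normc x.
Proof. by case: x => a b; exact: sqrtr_ge0. Qed.

Lemma Re_le_normc (x : C) : `|complex.Re x| <= normc x.
Proof.
case: x => a b /=; rewrite -sqrtr_sqr ler_wsqrtr //.
by rewrite lerDl sqr_ge0.
Qed.

Lemma Im_le_normc (x : C) : `|complex.Im x| <= normc x.
Proof.
case: x => a b /=; rewrite -sqrtr_sqr ler_wsqrtr //.
by rewrite lerDr sqr_ge0.
Qed.

Lemma normc_le (x : C) : normc x <= `|complex.Re x| + `|complex.Im x|.
Proof.
case: x => a b /=; rewrite -(@ler_pXn2r _ 2) ?nnegrE ?sqrtr_ge0 ?addr_ge0 //.
rewrite sqr_sqrtr ?addr_ge0 ?sqr_ge0 // sqrrD !real_normK ?num_real //.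
by rewrite -addrA [X in _ <= _ + X]addrC addrA lerDl mulrn_wge0 // mulr_ge0.
Qed.

Lemma normcD (x y : C) : normc (x + y) <= normc x + normc y.
Proof. exact: (@le_normcD R x y). Qed.

Lemma normcNE (x : C) : normc (- x) = normc x.
Proof. exact: (@normcN R x). Qed.

Lemma toCB p q : toC p - toC q = toC (p - q).
Proof. by apply: complexP; rewrite !(ReD, ReN, ImD, ImN) /= !mxE. Qed.

Lemma normc_toC p : normc (toC p) = enorm p.
Proof. by rewrite /enorm sum_ord2. Qed.

Lemma enorm_toC p q : enorm (p - q) = normc (toC p - toC q).
Proof. by rewrite toCB normc_toC. Qed.

Lemma toC_inj : injective (@toC R).
Proof.
move=> p q pq; apply/eqP; rewrite -subr_eq0; apply/eqP/enorm_eq0.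
by rewrite enorm_toC pq subrr normc0.
Qed.

Lemma enorm_triangle p q z : enorm (p - z) <= enorm (p - q) + enorm (q - z).
Proof. by rewrite !enorm_toC -(subrKA (toC q)) normcD. Qed.

Lemma enorm_distC p q : enorm (p - q) = enorm (q - p).
Proof. by rewrite -enormN opprB. Qed.

Definition cBd m M g := Bd m M (@complex.Re R \o g) /\ Bd m M (@complex.Im R \o g).

Lemma cBd_ge0 m M g : cBd m M g -> 0 <= M.
Proof. by case=> /Bd_ge0. Qed.

Lemma cBd_le m m' M M' g : (m' <= m)%N -> M <= M' -> cBd m M g -> cBd m' M' g.
Proof. by move=> mm MM [Br Bi]; split; [move: Br|move: Bi]; exact: Bd_le. Qed.

Lemma cBdD m M1 M2 g h : cBd m M1 g -> cBd m M2 h ->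
  cBd m (M1 + M2) (fun p => g p + h p).
Proof.
move=> [gr gi] [hr hi]; split.
  by rewrite (_ : _ \o _ = fun p => complex.Re (g p) + complex.Re (h p));
    [exact: BdD|apply/funext => p; rewrite /= ReD].
by rewrite (_ : _ \o _ = fun p => complex.Im (g p) + complex.Im (h p));
  [exact: BdD|apply/funext => p; rewrite /= ImD].
Qed.

(** The real and the imaginary part of a product each consist of two real products; this is the
    additional factor 2. *)
Lemma cBdM m M1 M2 g h : cBd m M1 g -> cBd m M2 h ->
  cBd m (2 ^+ m.+1 * M1 * M2) (fun p => g p * h p).
Proof.
move=> [gr gi] [hr hi].
have -> : 2 ^+ m.+1 * M1 * M2 = 2 ^+ m * M1 * M2 + 2 ^+ m * M1 * M2.
  by rewrite exprS; ring.
split.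
  rewrite (_ : _ \o _ = fun p => complex.Re (g p) * complex.Re (h p) +
    - (complex.Im (g p) * complex.Im (h p))); last by apply/funext => p; rewrite /= ReM.
  exact: BdD (BdM gr hr) (BdN (BdM gi hi)).
rewrite (_ : _ \o _ = fun p => complex.Re (g p) * complex.Im (h p) +
  complex.Im (g p) * complex.Re (h p)); last by apply/funext => p; rewrite /= ImM.
exact: BdD (BdM gr hi) (BdM gi hr).
Qed.

Lemma cBd_cst m (c : C) : cBd m (normc c) (fun=> c).
Proof.
split.
  exact: Bd_le (leqnn m) (Re_le_normc c) (Bd_cst (complex.Re c)).
exact: Bd_le (leqnn m) (Im_le_normc c) (Bd_cst (complex.Im c)).
Qed.

Lemma cBdZ m M (c : C) g : cBd m M g ->
  cBd m (2 ^+ m.+1 * normc c * M) (fun p => c * g p).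
Proof. exact/cBdM/cBd_cst. Qed.

Lemma cBdN m M g : cBd m M g -> cBd m M (fun p => - g p).
Proof.
move=> [gr gi]; split.
  by rewrite (_ : _ \o _ = fun p => - complex.Re (g p));
    [exact: BdN|apply/funext => p; rewrite /= ReN].
by rewrite (_ : _ \o _ = fun p => - complex.Im (g p));
  [exact: BdN|apply/funext => p; rewrite /= ImN].
Qed.

Lemma cBd_shift m M g a : cBd m M g -> cBd m M (fun p => g (p + a)).
Proof.
move=> [gr gi].
by split; [exact: (Bd_shift a gr)|exact: (Bd_shift a gi)].
Qed.

Lemma cBd_real m M (h : V -> R) : Bd m M h -> cBd m M (fun p => (h p)%:C%C).
Proof.
move=> B; split; first exact: B.
have M0 : `|0 : R| <= M by rewrite normr0 (Bd_ge0 B).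
exact: Bd_le (leqnn m) M0 (Bd_cst 0).
Qed.

Section Kernel.
Variables (eta : V -> R) (z : V) (c e : R).
Hypotheses (c0 : 0 < c) (eta_smooth : smooth eta)
  (eta0 : forall p, enorm (p - z) < c -> eta p = 0)
  (eta1 : forall p, e <= enorm (p - z) -> eta p = 1).

Definition kern : V -> C := fun p => (eta p)%:C%C / (toC p - toC z).

Let X p := p 0 0 - z 0 0.
Let Y p := p 0 1 - z 0 1.
Let D p := X p ^+ 2 + Y p ^+ 2.

Let D_enorm p : D p = enorm (p - z) ^+ 2.
Proof. by rewrite sqr_enorm sum_ord2 !mxE. Qed.

Lemma Re_kern p : complex.Re (kern p) = eta p * (X p * (D p)^-1).
Proof. by rewrite /kern ReM /= mul0r subr0. Qed.

Lemma Im_kern p : complex.Im (kern p) = - (eta p * (Y p * (D p)^-1)).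
Proof. by rewrite /kern ImM /= mul0r addr0 mulrN. Qed.

Let D_gt0 p : p != z -> 0 < D p.
Proof.
move=> pz; rewrite D_enorm exprn_gt0 // lt_def enorm_ge0 andbT.
by apply: contra pz => /eqP/enorm_eq0/eqP; rewrite subr_eq0.
Qed.

Let isdX p i : is_derive p (ebase R i) X (i == 0)%:R.
Proof.
apply/is_derive_lineP.
have -> : (fun s : R => X (p + s *: ebase R i)) =
    cst (X p) + (i == 0)%:R \*: (@id R).
  by apply/funext => s; rewrite /X !mxE eqxx eq_sym /= addrAC mulrC.
by apply: is_derive_eq; rewrite add0r [_ *: 1]mulr1.
Qed.

Let isdY p i : is_derive p (ebase R i) Y (i == 1)%:R.
Proof.
apply/is_derive_lineP.
have -> : (fun s : R => Y (p + s *: ebase R i)) =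
    cst (Y p) + (i == 1)%:R \*: (@id R).
  by apply/funext => s; rewrite /Y !mxE eqxx eq_sym /= addrAC mulrC.
by apply: is_derive_eq; rewrite add0r [_ *: 1]mulr1.
Qed.

Let isdDV p i : p != z -> is_derive p (ebase R i) (fun q => (D q)^-1)
  (- (D p) ^- 2 * (2 * (X p * (i == 0)%:R + Y p * (i == 1)%:R))).
Proof.
move=> pz; have Dp : D p != 0 by rewrite gt_eqF // D_gt0.
have isdD : is_derive p (ebase R i) D (2 * (X p * (i == 0)%:R + Y p * (i == 1)%:R)).
  rewrite (_ : D = X * X + Y * Y); last first.
    by apply/funext => q; rewrite /D !expr2.
  apply: is_derive_eq (is_deriveD (is_deriveM (isdX p i) (isdX p i))
    (is_deriveM (isdY p i) (isdY p i))) _.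
  by rewrite /GRing.scale /=; ring.
case: isdD => dD D_E; split; first exact: derivableV.
by apply: etrans (deriveV Dp dD) _; rewrite D_E.
Qed.

(** Beyond radius e the kernel is 1/(w - z), with complex derivative -K^2; its partial derivatives
    are thus -K^2 in the first direction and -iK^2 in the second. *)
Lemma kern_pderive p i : e < enorm (p - z) -> p != z ->
  let K := kern p in
  pderive i (@complex.Re R \o kern) p =
    (if i == 0 then - complex.Re (K * K) else complex.Im (K * K)) /\
  pderive i (@complex.Im R \o kern) p =
    (if i == 0 then - complex.Im (K * K) else - complex.Re (K * K)).
Proof.
move=> pe pz K; have Dp : D p != 0 by rewrite gt_eqF // D_gt0.
have nearE : \forall q \near p, eta q = 1.
  apply: filterS (fun q (h : e < enorm (q - z)) => eta1 (ltW h)) _.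
  by apply: open_nbhs_nbhs; split=> //; exact: enorm_gt_open.
have i01 : (i == 1) = ~~ (i == 0) by case: i => -[|[|[]]].
have XD := is_deriveM (isdX p i) (isdDV i pz).
have YD := is_deriveN (is_deriveM (isdY p i) (isdDV i pz)).
rewrite ReM ImM /K Re_kern Im_kern eta1 ?ltW //; split.
  apply: (@etrans _ _ ('D_(ebase R i) (X * (fun q => (D q)^-1)) p)).
    apply: near_eq_derive; near=> q; rewrite [LHS]Re_kern (near nearE q) ?mul1r //.
  case: XD => _ ->; rewrite /GRing.scale /= i01; case: (i == 0) => /=.
    by rewrite /D; field.
  by rewrite /D; field.
apply: (@etrans _ _ ('D_(ebase R i) (- (Y * (fun q => (D q)^-1))) p)).
  apply: near_eq_derive; near=> q; rewrite [LHS]Im_kern (near nearE q) ?mul1r //.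
case: YD => _ ->; rewrite /GRing.scale /= i01; case: (i == 0) => /=.
  by rewrite /D; field.
by rewrite /D; field.
Unshelve. all: by end_near. Qed.

Lemma kern_smooth : smooth (@complex.Re R \o kern) /\ smooth (@complex.Im R \o kern).
Proof.
(* Adding b to the squared distance D removes the zero of the denominator at z. The kernel is
   unchanged because eta vanishes wherever b does not. *)
pose b := bump z (c / 2).
have c20 : 0 < c / 2 by rewrite divr_gt0.
have DE p : eta p * (D p)^-1 = eta p * (D p + b p)^-1.
  have [/eta0 ->|pc] := ltP (enorm (p - z)) c; first by rewrite !mul0r.
  by rewrite /b bump0 ?addr0 // mulrC divfK.
have Db p : D p + b p != 0.
  have [->|/D_gt0 D0] := eqVneq p z; last by rewrite gt_eqF // ltr_pwDl // bump_ge0.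
  rewrite /b bump1 //; last by rewrite subrr enorm0 ltW.
  by rewrite /D /X /Y !subrr expr0n !add0r oner_eq0.
have coordC m (j : 'I_2) : of_class_C m (fun p : V => p 0 j - z 0 j).
  exact: of_class_CB (of_class_C_coord _ m j) (of_class_C_cst _ m _).
have DC m : of_class_C m (fun p => (D p + b p)^-1).
  apply: of_class_CV => //; apply: of_class_CD; last exact: bump_smooth.
  rewrite (_ : D = fun p => X p * X p + Y p * Y p); last first.
    by apply/funext => p; rewrite /D !expr2.
  exact: of_class_CD (of_class_CM (coordC m 0) (coordC m 0))
    (of_class_CM (coordC m 1) (coordC m 1)).
split=> m.
  rewrite (_ : _ \o _ = fun p => eta p * (D p + b p)^-1 * X p); last first.
    by apply/funext => p; rewrite [LHS]Re_kern mulrCA mulrC DE.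
  exact: of_class_CM (of_class_CM (eta_smooth m) (DC m)) (coordC m 0).
rewrite (_ : _ \o _ = fun p => - (eta p * (D p + b p)^-1 * Y p)); last first.
  by apply/funext => p; rewrite [LHS]Im_kern mulrCA mulrC DE.
apply: of_class_CN.
exact: of_class_CM (of_class_CM (eta_smooth m) (DC m)) (coordC m 1).
Qed.

(** Compactness handles a disc about z. Taking its radius E at least 1 makes the modulus of 1/(w -
    z) at most 1 outside. *)
Lemma kern_bounded : exists M, cBd 0 M kern.
Proof.
have [kR kI] := kern_smooth; pose E := Num.max e 1.
have E1 : 1 <= E by rewrite le_max lexx orbT.
have E0 : 0 < E by rewrite (lt_le_trans ltr01).
have bound (h : V -> R) : smooth h ->
    (forall p, E < enorm (p - z) -> `|h p| <= 1) -> exists M, forall p, `|h p| <= M.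
  move=> hs h1; have [|M HM] := @smooth_bounded_support_Bd _ _ 0
      (fun p => h p * bump z E p) (of_class_CM (hs 0) (bump_smooth z E0 0)).
    apply: (@bounded_support_far _ _ _ z (2 * E)) => p pE.
    by rewrite bump0 ?mulr0 // ltW.
  exists (Num.max M 1) => p; rewrite le_max.
  have [pE|/h1 ->] := leP (enorm (p - z)) E; last by rewrite orbT.
  by have := Bd_sup p HM; rewrite bump1 // mulr1 => ->.
have k1 p : E < enorm (p - z) -> normc (kern p) <= 1.
  move=> pE; rewrite /kern eta1; last first.
    by rewrite ltW // (le_lt_trans _ pE) // le_max lexx.
  rewrite normcM normcV -enorm_toC normc1 mul1r invf_le1.
    by rewrite (le_trans E1) // ltW.
  by rewrite (lt_trans E0).
have [M1 HM1] := bound _ kR (fun p pE => le_trans (Re_le_normc _) (k1 p pE)).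
have [M2 HM2] := bound _ kI (fun p pE => le_trans (Im_le_normc _) (k1 p pE)).
exists (Num.max M1 M2); split=> -[|//] p _; rewrite big_nil mulr1 le_max.
  by rewrite HM1.
by rewrite HM2 orbT.
Qed.

(* The kernel is 1/w far away, so d kern = - kern^2 dw up to a smooth form of
   bounded support, and bounds of order m on kern give bounds of order m.+1. *)
Lemma kern_cBd m : exists M, cBd m M kern.
Proof.
have [kR kI] := kern_smooth; have [M0 [k0R k0I]] := kern_bounded.
pose E := Num.max e 1.
have E0 : 0 < E by rewrite (lt_le_trans ltr01) // le_max lexx orbT.
have far p : E < enorm (p - z) -> e < enorm (p - z) /\ p != z.
  move=> pE; split; first by rewrite (le_lt_trans _ pE) // le_max lexx.
  by apply: contraTN pE => /eqP ->; rewrite subrr enorm0 -leNgt ltW.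
elim: m => [|m [M IH]]; first by exists M0.
have [kkR kkI] := cBdM IH IH; set N := _ * M in kkR kkI.
(* Shared by the real and the imaginary part: F i is the part of -K^2 or -iK^2 that equals the
   partial derivative far from z, and the discrepancy has bounded support. *)
have step (h : V -> R) (F : 'I_2 -> V -> R) : smooth h ->
    (forall p, `|h p| <= M0) -> (forall i, Bd m N (F i)) ->
    (forall i p, E < enorm (p - z) -> pderive i h p = F i p) ->
    (forall i, smooth (F i)) -> exists M', Bd m.+1 M' h.
  move=> hs h0 BF hF Fs.
  have /choice[N' HN'] i : exists M', Bd m M' (fun p => pderive i h p - F i p).
    have [_ /(_ i)[_ hi]] := hs m.+1.
    apply: smooth_bounded_support_Bd (of_class_CB hi (Fs i m)) _.
    by apply: (@bounded_support_far _ _ _ z E) => p /hF ->; rewrite subrr.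
  exists (M0 + 2%:R * `| \sum_i (`|N' i| + `|N|) |); apply: Bd_of_pderive => //.
    by move=> i p; have [_ /(_ i)[]] := hs 1.
  move=> i; have := BdD (HN' i) (BF i); under eq_fun do rewrite subrK.
  apply: Bd_le => //; rewrite (bigD1 i) //=.
  apply: (@le_trans _ _ (`|N' i| + `|N|)); first by rewrite lerD ?ler_norm.
  by rewrite lerDl sumr_ge0 // => j _; rewrite addr_ge0.
have kkRs : smooth (fun p => complex.Re (kern p * kern p)).
  move=> k; under eq_fun do rewrite ReM.
  by apply: of_class_CB; apply: of_class_CM; [exact: kR|exact: kR|exact: kI|exact: kI].
have kkIs : smooth (fun p => complex.Im (kern p * kern p)).
  move=> k; under eq_fun do rewrite ImM.
  by apply: of_class_CD; apply: of_class_CM; [exact: kR|exact: kI|exact: kI|exact: kR].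
have [M1 HM1] : exists M', Bd m.+1 M' (@complex.Re R \o kern).
  apply: (@step _ (fun i p => if i == 0 then - complex.Re (kern p * kern p)
     else complex.Im (kern p * kern p))) => //.
  - by move=> p; exact: Bd_sup k0R.
  - by move=> i; case: (i == 0); [exact: BdN|].
  - by move=> i p /far[pe pz]; have [-> _] := kern_pderive i pe pz.
  - by move=> i; case: (i == 0) => // k; exact: of_class_CN.
have [M2 HM2] : exists M', Bd m.+1 M' (@complex.Im R \o kern).
  apply: (@step _ (fun i p => if i == 0 then - complex.Im (kern p * kern p)
     else - complex.Re (kern p * kern p))) => //.
  - by move=> p; exact: Bd_sup k0I.
  - by move=> i; case: (i == 0); exact: BdN.
  - by move=> i p /far[pe pz]; have [_ ->] := kern_pderive i pe pz.
  - by move=> i; case: (i == 0) => // k; exact: of_class_CN.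
exists (Num.max M1 M2); split.
  by apply: Bd_le HM1 => //; rewrite le_max lexx.
by apply: Bd_le HM2 => //; rewrite le_max lexx orbT.
Qed.

End Kernel.

End PlaneKernel.

(** * Integration over chains *)

Section FormEvaluation.
Variables (R : realType) (n k : nat).
Local Notation V := 'rV[R]_n.
Local Notation P := (pchain R n k).
Implicit Types (w : dform R n k) (A B : P) (p u : V) (a : kvec R n k) (U : seq V).

Lemma pchain_suppP A : {X : seq V | uniq X & forall p, A p != 0 -> p \in X}.
Proof.
apply: cid2; have /asboolP /finite_seqP[X XE] : pchain_val A \in @fin_supp R n k := valP A.
exists (undup X); rewrite ?undup_uniq // => p Ap; rewrite mem_undup.
by have : [set` X] p by rewrite -XE.
Qed.

(** Any list containing the support is allowed, so that several chains can be summed over one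
    list. *)
Lemma form_eval_seq w A (X : seq V) : uniq X -> (forall p, A p != 0 -> p \in X) ->
  form_eval w A = \sum_(p <- X) \sum_S w p S * A p S.
Proof.
move=> uX AX; rewrite fsbig_seq //; apply/esym/fsbig_widen => // p [_ /= pX].
rewrite (_ : A p = 0).
  by rewrite big1 // => S _; rewrite ffunE mulr0.
by apply/eqP; apply: contrapT => /negP/AX.
Qed.

Lemma form_evalD w A B : form_eval w (A + B) = form_eval w A + form_eval w B.
Proof.
have [X uX AX] := pchain_suppP A; have [Y uY BY] := pchain_suppP B.
pose Z := undup (X ++ Y).
have uZ : uniq Z by exact: undup_uniq.
have AZ p : A p != 0 -> p \in Z by move/AX; rewrite mem_undup mem_cat => ->.
have BZ p : B p != 0 -> p \in Z by move/BY; rewrite mem_undup mem_cat orbC => ->.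
have ABZ p : (A + B) p != 0 -> p \in Z.
  move=> AB0; have [A0|/AZ //] := eqVneq (A p) 0.
  by apply: BZ; apply: contraNN AB0 => /eqP B0; rewrite pchainDE A0 B0 addr0.
rewrite !(form_eval_seq w uZ) // -big_split; apply: eq_bigr => p _.
by rewrite -[RHS]big_split; apply: eq_bigr => S _; rewrite pchainDE ffunE mulrDr.
Qed.

Lemma form_evalN w A : form_eval w (- A) = - form_eval w A.
Proof.
have [X uX AX] := pchain_suppP A.
have NX p : (- A) p != 0 -> p \in X by rewrite pchainNE oppr_eq0; exact: AX.
rewrite !(form_eval_seq w uX) // -sumrN; apply: eq_bigr => p _.
by rewrite -sumrN; apply: eq_bigr => S _; rewrite pchainNE ffunE mulrN.
Qed.

Lemma form_evalB w A B : form_eval w (A - B) = form_eval w A - form_eval w B.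
Proof. by rewrite form_evalD form_evalN. Qed.

Lemma form_eval0 w : form_eval w 0 = 0.
Proof. by rewrite -(subrr 0) form_evalB subrr. Qed.

Lemma form_eval_sum w I (s : seq I) (F : I -> P) :
  form_eval w (\sum_(i <- s) F i) = \sum_(i <- s) form_eval w (F i).
Proof.
elim: s => [|i s IH]; first by rewrite !big_nil form_eval0.
by rewrite !big_cons form_evalD IH.
Qed.

Lemma form_eval_ptchain w p a : form_eval w (ptchain p a) = \sum_S w p S * a S.
Proof.
rewrite (@form_eval_seq _ _ [:: p]) // => [|q]; first by rewrite big_seq1 /= eqxx.
by rewrite /= inE; case: (q == p) => //; rewrite eqxx.
Qed.

Lemma form_eval_lin (c : R) w1 w2 A :
  form_eval (fun p => [ffun S => w1 p S + c * w2 p S]) A =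
  form_eval w1 A + c * form_eval w2 A.
Proof.
have [X uX AX] := pchain_suppP A; rewrite !(form_eval_seq _ uX) // mulr_sumr -big_split.
apply: eq_bigr => p _ /=; rewrite mulr_sumr -big_split; apply: eq_bigr => S _ /=.
by rewrite ffunE mulrDl mulrA.
Qed.

Lemma form_eval_eq w1 w2 A : (forall p, A p != 0 -> w1 p = w2 p) ->
  form_eval w1 A = form_eval w2 A.
Proof.
move=> ww; have [X uX AX] := pchain_suppP A; rewrite !(form_eval_seq _ uX) //.
apply: eq_bigr => p _; have [->|/ww -> //] := eqVneq (A p) 0.
by apply: eq_bigr => S _; rewrite ffunE !mulr0.
Qed.

Lemma Delta_ptchain u p a : Delta u (ptchain p a) = ptchain (p + u) a - ptchain p a.
Proof.
apply: pchainP => q; rewrite pchainDE pchainNE /=.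
by rewrite subr_eq.
Qed.

Lemma DeltaD u A B : Delta u (A + B) = Delta u A + Delta u B.
Proof.
apply: pchainP => q; rewrite [RHS]pchainDE.
rewrite -[LHS]/((A (q - u) + B (q - u)) - (A q + B q)).
by rewrite -[RHS]/((A (q - u) - A q) + (B (q - u) - B q)) opprD addrACA.
Qed.

Lemma Delta0 u : Delta u (0 : P) = 0.
Proof. by apply: pchainP => q; rewrite -[LHS]/(0 - 0 : kvec R n k) subrr. Qed.

Lemma Delta_sum u I (s : seq I) (F : I -> P) :
  Delta u (\sum_(i <- s) F i) = \sum_(i <- s) Delta u (F i).
Proof.
elim: s => [|i s IH]; first by rewrite !big_nil Delta0.
by rewrite !big_cons DeltaD IH.
Qed.

Lemma pchain_decomp A : {X : seq V | A = \sum_(p <- X) ptchain p (A p)}.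
Proof.
have [X uX AX] := pchain_suppP A; exists X; apply: pchainP => q.
rewrite pchain_sumE; have [A0|An0] := eqVneq (A q) 0.
  by rewrite big1 // => p _ /=; have [<-|//] := eqVneq q p.
rewrite (bigD1_seq q) ?AX //= eqxx big1 ?addr0 // => p.
by rewrite eq_sym => /negbTE ->.
Qed.

Lemma form_eval_Delta w u A :
  form_eval w (Delta u A) = form_eval (fun p => [ffun S => w (p + u) S - w p S]) A.
Proof.
have [X ->] := pchain_decomp A; rewrite Delta_sum !form_eval_sum.
apply: eq_bigr => p _; rewrite Delta_ptchain form_evalB !form_eval_ptchain.
by rewrite -sumrB; apply: eq_bigr => S _; rewrite ffunE mulrBl.
Qed.

(** Differences move from the chain to the form; this is where bounds on coefficients meet the B^r
    norm. *)
Lemma form_eval_Deltas w U p a :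
  form_eval w (Deltas U (ptchain p a)) = \sum_S fdiffs U (fun q => w q S) p * a S.
Proof.
elim: U w => [|u U IH] w; first exact: form_eval_ptchain.
rewrite /= form_eval_Delta IH; apply: eq_bigr => S _; congr (fdiffs U _ p * _).
by apply/funext => q; rewrite ffunE.
Qed.

(** A homogeneous version of [Bform] with the constant exposed. It also speaks about cells of norm
    0, which cannot be normalised and do occur in decompositions. *)
Definition Bform_le (r : nat) (M : R) w := forall U p a, (size U <= r)%N ->
  `|form_eval w (Deltas U (ptchain p a))| <= M * dnorm U a.

Lemma Bform_leP r M w : Bform_le r M w -> Bform r w.
Proof. by move=> wM; exists M => U p a sU a1; rewrite -[M]mulr1 -a1; exact: wM. Qed.

Lemma Bform_le_eval r M w A : Bform_le r M w -> `|form_eval w A| <= M * Bnorm r A.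
Proof.
move=> wM; have cost x : Bcosts r A x -> `|form_eval w A| <= M * x.
  move=> [s [ss ->] <-]; rewrite form_eval_sum mulr_sumr.
  apply: le_trans (ler_norm_sum _ _ _) _; rewrite !big_seq.
  by apply: ler_sum => c cs; apply: wM; exact: ss.
(* For M <= 0 one cannot divide by M, but then replacing a cost by the smaller infimum only
   increases the right-hand side. *)
have [M0|M0] := ltP 0 M.
  rewrite -ler_pdivrMl //; apply: lb_le_inf; first exact: Bcosts_neq0.
  by move=> x /cost; rewrite ler_pdivrMl.
have [x cx] := Bcosts_neq0 r A.
have x0 : 0 <= x by exact: Bcosts_lb0 cx.
have N0 : Bnorm r A <= x by apply: ge_inf => //; exact: Bcosts_has_lbound.
apply: le_trans (cost x cx) _; exact: ler_wnM2l.
Qed.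

(* kmass is an infimum over decompositions into simple k-vectors; it has the
   junk value 0 on a k-vector without such a decomposition. *)
Hypothesis simple : forall a : kvec R n k, simple_kvec a.

(** In any decomposition into simple vectors, each summand has its coordinate bounded by its
    volume. *)
Lemma kmass_coord a S : `|a S| <= kmass a.
Proof.
apply: lb_le_inf.
  exists (\sum_(b <- [:: a]) kvol b); exists [:: a] => //; split.
    by move=> b; rewrite inE => /eqP ->.
  by rewrite big_cons big_nil addr0.
move=> _ [s [_ aE] <-]; rewrite aE.
have -> : (\sum_(b <- s) b) S = \sum_(b <- s) b S.
  by elim: s {aE} => [|b s IH]; rewrite ?big_nil ?big_cons ffunE // IH.
apply: le_trans (ler_norm_sum _ _ _) _; apply: ler_sum => b _.
rewrite /kvol -sqrtr_sqr ler_wsqrtr // (bigD1 S) //= lerDl.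
by rewrite sumr_ge0 // => T _; exact: sqr_ge0.
Qed.

Lemma coef_Bform_le r M w : (forall S, Bd r M (fun p => w p S)) ->
  Bform_le r (#|{: kidx n k}|%:R * M) w.
Proof.
move=> wB U p a sU; rewrite form_eval_Deltas.
apply: le_trans (ler_norm_sum _ _ _) _.
apply: (@le_trans _ _ (\sum_(S : kidx n k) M * dnorm U a)).
  apply: ler_sum => S _; rewrite normrM /dnorm mulrA ler_pM ?kmass_coord //.
  exact: wB.
by rewrite sumr_const -mulrA mulr_natl.
Qed.

End FormEvaluation.

Lemma simple_kvec0 (R : realType) n (a : kvec R n 0) : simple_kvec a.
Proof.
pose S0 : kidx n 0 := exist _ finset.set0 (introT eqP (cards0 _)).
exists (a S0), 0; apply/ffunP => S; rewrite !ffunE det_mx00 [_ *: _]mulr1.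
congr (a _); apply: val_inj => /=; apply/eqP; rewrite -cards_eq0; exact: (valP S).
Qed.

Lemma kidx1P n (S : kidx n 1) : {i | val S = [set i]%SET}.
Proof. by apply: cid; have /cards1P := valP S. Qed.

Definition sidx n (i : 'I_n) : kidx n 1 := exist _ [set i]%SET (introT eqP (cards1 i)).

Lemma simple_kvec1 (R : realType) n (a : kvec R n 1) : simple_kvec a.
Proof.
exists 1, (\row_i a (sidx i)); apply/ffunP => S; rewrite scale1r ffunE.
rewrite det_mx11 !mxE; congr (a _); apply: val_inj => /=.
have [i Si] := kidx1P S; rewrite Si; congr [set _]%SET; apply/esym/finset.set1P.
by rewrite -Si /kidx_nth; exact: enum_valP.
Qed.

Lemma seq_cvgP (R : realType) (u : nat -> R) (v : R) : u i @[i --> \oo] --> v <->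
  forall e : R, 0 < e -> exists N, forall i, (N <= i)%N -> `|u i - v| < e.
Proof.
split=> [uv e e0|H].
  have /cvgrPdistC_lt /(_ e e0)[N _ HN] := uv; exists N => i Ni; exact: HN.
apply/cvgrPdistC_lt => e e0; have [N HN] := H e e0.
by exists N => // i /HN.
Qed.

Lemma cauchy_cvg_seq (R : realType) (u : nat -> R) :
  (forall e : R, 0 < e -> exists N, forall i j, (N <= i)%N -> (N <= j)%N ->
    `|u i - u j| < e) -> cvg (u @ \oo).
Proof.
move=> H; apply/cauchy_cvgP/cauchy_exP => e e0; have [N HN] := H e e0.
by exists (u N); exists N => // i /= Ni; apply: HN.
Qed.

Section ChainIntegral.
Variables (R : realType) (n k r : nat).
Local Notation P := (pchain R n k).
Variable J : dchain R n k r.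
Implicit Types (w : dform R n k) (A B : P) (M e : R).

Lemma cauchy_seqP (A : cauchy_seq R n k r) e : 0 < e ->
  exists N, forall i j, (N <= i)%N -> (N <= j)%N -> Bnorm r (A i - A j) < e.
Proof. by move=> e0; have /asboolP /(_ e e0) := valP A. Qed.

Lemma chain_seq_cauchy e : 0 < e -> exists N, forall i j,
  (N <= i)%N -> (N <= j)%N -> Bnorm r (chain_seq J i - chain_seq J j) < e.
Proof. exact: cauchy_seqP. Qed.

Lemma Bform_le_evalB M w A B : Bform_le r M w ->
  `|form_eval w A - form_eval w B| <= M * Bnorm r (A - B).
Proof. by move=> wM; rewrite -form_evalB; exact: Bform_le_eval. Qed.

Lemma is_cvg_form_eval M w : Bform_le r M w ->
  cvg ((fun i => form_eval w (chain_seq J i)) @ \oo).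
Proof.
move=> wM; apply: cauchy_cvg_seq => e e0.
have M0 : 0 < `|M| + 1 by rewrite ltr_wpDl.
have [N HN] := chain_seq_cauchy (divr_gt0 e0 M0); exists N => i j Ni Nj.
apply: le_lt_trans (Bform_le_evalB _ _ wM) _.
have := HN i j Ni Nj; rewrite ltr_pdivlMr // => H.
apply: le_lt_trans H; rewrite mulrC ler_wpM2l ?Bnorm_ge0 //.
by rewrite (le_trans (ler_norm _)) // lerDl.
Qed.

Lemma form_eval_cvg M w : Bform_le r M w ->
  form_eval w (chain_seq J i) @[i --> \oo] --> chain_int J w.
Proof. exact: is_cvg_form_eval. Qed.

Lemma chain_intE w v :
  form_eval w (chain_seq J i) @[i --> \oo] --> v -> chain_int J w = v.
Proof. exact: cvg_lim. Qed.

(** The index N does not depend on the form. This uniformity is what later permits cutting off at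
    infinity and exchanging integrals. *)
Lemma chain_int_unif e : 0 < e -> exists N, forall i, (N <= i)%N ->
  forall w M, Bform_le r M w ->
  `|form_eval w (chain_seq J i) - chain_int J w| <= `|M| * e.
Proof.
move=> e0; have [N HN] := chain_seq_cauchy e0; exists N => i Ni w M wM.
apply/ler_addgt0Pr => d d0.
have /seq_cvgP /(_ d d0)[N' HN'] := form_eval_cvg wM.
pose j := maxn N N'; rewrite -(subrKA (form_eval w (chain_seq J j))).
apply: le_trans (ler_normD _ _) (lerD _ _); last first.
  by rewrite ltW // HN' // leq_maxr.
apply: le_trans (Bform_le_evalB _ _ wM) _.
apply: le_trans (ler_wpM2r (Bnorm_ge0 _ _) (ler_norm M)) _.
by rewrite ler_wpM2l // ltW // HN // leq_maxl.
Qed.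

Lemma chain_int_bound : exists C, forall w M, Bform_le r M w ->
  `|chain_int J w| <= `|M| * C.
Proof.
have [N HN] := chain_int_unif (@ltr01 R).
exists (1 + Bnorm r (chain_seq J N)) => w M wM.
rewrite -[chain_int J w](subrK (form_eval w (chain_seq J N))) mulrDr.
apply: le_trans (ler_normD _ _) (lerD _ _).
  by rewrite distrC; exact: HN.
apply: le_trans (Bform_le_eval _ wM) _.
by rewrite ler_wpM2r ?Bnorm_ge0 // ler_norm.
Qed.

Lemma chain_int_lin w1 w2 (c M1 M2 : R) : Bform_le r M1 w1 -> Bform_le r M2 w2 ->
  chain_int J (fun p => [ffun S => w1 p S + c * w2 p S]) =
  chain_int J w1 + c * chain_int J w2.
Proof.
move=> /form_eval_cvg w1M /form_eval_cvg w2M; apply: chain_intE.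
under eq_fun do rewrite form_eval_lin.
by apply: cvgD => //; apply: cvgM => //; exact: cvg_cst.
Qed.

Lemma cvg_Bnorm (A : cauchy_seq R n k r) : cvg (Bnorm r (A i) @[i --> \oo]).
Proof.
apply: cauchy_cvg_seq => e e0; have [N HN] := cauchy_seqP A e0.
exists N => i j Ni Nj; have sub B B' : Bnorm r B - Bnorm r B' <= Bnorm r (B - B').
  by rewrite lerBlDr -{1}[B](subrK B') BnormD.
rewrite ltr_norml ltrNl opprB.
by rewrite !(le_lt_trans (sub _ _)) // HN.
Qed.

(** The representative chosen for the class of [chain_of r A - J] need not be the termwise
    difference of representatives; the two differ by a null sequence D. *)
Lemma chain_of_subE (A : P) : exists2 D : cauchy_seq R n k r,
  Bnorm r (D j) @[j --> \oo] --> (0 : R) &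
  forall j, A - chain_seq J j = chain_seq (chain_of r A - J) j - D j.
Proof.
pose X := chain_of r A - J; pose cA := CauchySeq (const_cauchy r A).
exists (repr X - (cA - repr J)).
  suff : repr X - (cA - repr J) \in @Bnull R n k r by move/asboolP.
  rewrite Quotient.idealrBE [X in _ == X] raddfB reprK.
  by rewrite /X -{1}[J]reprK; exact/eqP.
move=> j; rewrite -[(repr X - _) j]/(repr X j - (A - repr J j)).
by rewrite opprB [RHS]addrC subrK.
Qed.

Lemma chain_cvg_int (A : nat -> P) w M : Bform_le r M w -> chain_cvg A J ->
  form_eval w (A i) @[i --> \oo] --> chain_int J w.
Proof.
move=> wM AJ.
(* Both terms are compared with a late term j of the sequence of J, at which the null sequence, the
   norm and the integral are all close to their limits. *)
have bound i : `|form_eval w (A i) - chain_int J w| <=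
    `|M| * chain_norm (chain_of r (A i) - J).
  apply/ler_addgt0Pr => d d0; have d2 : 0 < d / 2 by rewrite divr_gt0.
  have M0 : 0 < `|M| + 1 by rewrite ltr_wpDl.
  have dM : 0 < d / 4 / (`|M| + 1) by rewrite !divr_gt0.
  have [D /seq_cvgP /(_ _ dM)[N1 HN1] DE] := chain_of_subE (A i).
  have /seq_cvgP /(_ _ dM)[N2 HN2] := @cvg_Bnorm (repr (chain_of r (A i) - J)).
  have /seq_cvgP /(_ _ d2)[N3 HN3] := form_eval_cvg wM.
  pose j := maxn N1 (maxn N2 N3).
  have jN1 : (N1 <= j)%N by rewrite leq_maxl.
  have jN2 : (N2 <= j)%N by rewrite /j maxnCA leq_maxl.
  have jN3 : (N3 <= j)%N by rewrite /j maxnA leq_maxr.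
  rewrite -(subrKA (form_eval w (chain_seq J j))).
  apply: le_trans (ler_normD _ _) _.
  have := HN1 j jN1; rewrite subr0 ger0_norm ?Bnorm_ge0 // => H1.
  have := HN2 j jN2; rewrite -/(chain_norm _) => H2; have H3 := HN3 j jN3.
  have := Bform_le_evalB (A i) (chain_seq J j) wM; rewrite DE => H.
  have H4 := BnormB r (chain_seq (chain_of r (A i) - J) j) (D j).
  have : Bnorm r (chain_seq (chain_of r (A i) - J) j - D j) <=
      chain_norm (chain_of r (A i) - J) + d / 2 / (`|M| + 1).
    apply: le_trans H4 _; move: H2; rewrite ltr_norml => /andP[_].
    by rewrite /chain_seq; move: H1; set a := _ / _ / _; rewrite (_ : d / 2 / _ = a + a);
      [lra|rewrite /a; field; rewrite gt_eqF].
  move=> H5; rewrite [d]splitr addrA; apply: lerD (ltW H3).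
  apply: le_trans H _; apply: (@le_trans _ _ (`|M| * (chain_norm (chain_of r (A i) - J) + d / 2 / (`|M| + 1)))).
    by apply: le_trans (ler_wpM2r (Bnorm_ge0 _ _) (ler_norm M)) (ler_wpM2l _ H5).
  rewrite mulrDr lerD2l mulrA ler_pdivrMr // mulrC ler_wpM2l ?ltW //.
  by rewrite ltrDl.
apply/seq_cvgP => e e0; have M0 : 0 < `|M| + 1 by rewrite ltr_wpDl.
have /seq_cvgP /(_ _ (divr_gt0 e0 M0))[N HN] := AJ; exists N => i /HN.
rewrite subr0 ltr_pdivlMr // => H; apply: le_lt_trans (bound i) _.
apply: le_lt_trans H; rewrite mulrC; apply: (@le_trans _ _ (`|chain_norm (chain_of r (A i) - J)| * `|M|)).
  by rewrite ler_wpM2r // ler_norm.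
by rewrite ler_wpM2l // lerDl.
Qed.

End ChainIntegral.

Lemma enorm_cover (R : realType) n (K : set 'rV[R]_n) (d : 'rV[R]_n -> R) :
  compact K -> (forall a, K a -> 0 < d a) ->
  exists s : seq 'rV[R]_n, (forall a, a \in s -> K a) /\
    forall p, K p -> exists2 a, a \in s & enorm (p - a) < d a.
Proof.
rewrite compact_cover => cK d0.
have [|p Kp|D DK KD] := cK _ K (fun a => [set p | enorm (p - a) < d a]).
- by move=> a _; exact: enorm_lt_open.
- by exists p => //=; rewrite subrr enorm0 d0.
exists (finmap.enum_fset D); split=> [a /DK|p /KD[a aD pa]]; last by exists a.
by rewrite inE.
Qed.

(** * Integrals depend only on the form near the support *)

Section Locality.
Variables (R : realType) (n k r : nat).
Hypothesis simple : forall a : kvec R n k, simple_kvec a.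
Variable J : dchain R n k r.
Local Notation V := 'rV[R]_n.
Implicit Types (w : dform R n k) (h : V -> R) (M : R).

Definition fBd M w := forall S, Bd r M (fun p => w p S).

Definition fscale h w : dform R n k := fun p => [ffun S => h p * w p S].

Lemma fBd_Bform_le M w : fBd M w -> Bform_le r (#|{: kidx n k}|%:R * M) w.
Proof. exact: coef_Bform_le. Qed.

Lemma fBd_scale M N h w : Bd r N h -> fBd M w -> fBd (2 ^+ r * N * M) (fscale h w).
Proof.
move=> hN wM S; rewrite (_ : (fun p => _) = fun p => h p * w p S).
  exact: BdM.
by apply/funext => p; rewrite ffunE.
Qed.

Lemma chain_int0 w : (forall p, w p = 0) -> chain_int J w = 0.
Proof.
move=> w0; apply: chain_intE; rewrite (_ : (fun i => _) = cst 0); first exact: cvg_cst.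
apply/funext => i; rewrite (@form_eval_eq _ _ _ _ (fun=> 0)) => [|p _]; last exact: w0.
have [X uX AX] := pchain_suppP (chain_seq J i); rewrite (form_eval_seq _ uX AX).
by rewrite big1 // => p _; rewrite big1 // => S _; rewrite ffunE mul0r.
Qed.

Lemma chain_int_split M N h w : Bd r N h -> fBd M w ->
  chain_int J w = chain_int J (fscale h w) + chain_int J (fscale (fun p => 1 - h p) w).
Proof.
move=> hN wM; have B1 := fBd_Bform_le (fBd_scale hN wM).
have B2 := fBd_Bform_le (fBd_scale (BdD (Bd_cst 1) (BdN hN)) wM).
rewrite -[X in _ + X]mul1r -(chain_int_lin J 1 B1 B2); congr chain_int.
by apply/funext => p; apply/ffunP => S; rewrite !ffunE; ring.
Qed.

(** J is a limit of pointed chains lying outside the ball, and w vanishes on each of them. A point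
    outside the ball is required because [supports] quantifies over nonempty open sets. *)
Lemma chain_int_ball M w (X : set V) a d : fBd M w ->
  supports X J -> 0 < d -> (forall p, X p -> d < enorm (p - a)) ->
  (exists p, d < enorm (p - a)) ->
  (forall p, d < enorm (p - a) -> w p = 0) -> chain_int J w = 0.
Proof.
move=> wM XJ d0 Xd [q qd] w0.
have [||A [AW AJ]] := XJ [set p | d < enorm (p - a)] (@enorm_gt_open _ _ _ _).
- by exists q.
- by move=> p /Xd.
have := chain_cvg_int (fBd_Bform_le wM) AJ.
rewrite (_ : (fun i => _) = cst 0) => [H|]; first by apply: cvg_unique H (cvg_cst _); exact: norm_hausdorff.
apply/funext => i; rewrite (@form_eval_eq _ _ _ _ (fun=> 0)) => [|p /AW/w0 //].
have [Y uY AY] := pchain_suppP (A i); rewrite (form_eval_seq _ uY AY).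
by rewrite big1 // => p _; rewrite big1 // => S _; rewrite ffunE mul0r.
Qed.

Hypothesis n0 : (0 < n)%N.

Lemma enorm_unbounded (a : V) d : exists p, d < enorm (p - a).
Proof.
pose i := Ordinal n0; exists (a + (`|d| + 1) *: ebase R i).
rewrite addrAC subrr add0r; apply: lt_le_trans (coord_le_enorm _ i).
rewrite !mxE !eqxx mulr1; apply: lt_le_trans (ler_norm _).
by apply: le_lt_trans (ler_norm d) _; rewrite ltrDl.
Qed.

(** The support is an intersection of supporting sets and is not itself known to support J, so each
    point off it only comes with a supporting set of its own. *)
Lemma chain_supp_avoid a : ~ chain_supp J a -> exists X d, [/\ supports X J, 0 < d &
  forall p, X p -> d < enorm (p - a)].
Proof.
move=> /existsNP[X /not_implyP[[cX XJ] Xa]]; exists X.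
have : nbhs a (~` X) by apply: open_nbhs_nbhs; split=> //; exact: closed_openC.
move=> /nbhs_enormP[e e0 He]; exists (e / 2); split=> //; first by rewrite divr_gt0.
move=> p Xp; rewrite ltNge; apply/negP => pe; apply: (He p) => //.
by apply: le_lt_trans pe _; rewrite ltr_pdivrMr // mulr_natr mulr2n ltrDl.
Qed.

(** The compact set where w may be nonzero is covered by finitely many balls, each missing some
    supporting set. Multiplying w by 1 minus the bump of a ball does not change the integral, and
    after all balls nothing of w is left. *)
Lemma chain_int_compact M w (W : set V) B : fBd M w -> open W ->
  chain_supp J `<=` W -> (forall p, W p -> w p = 0) ->
  (forall p, B < enorm p -> w p = 0) -> chain_int J w = 0.
Proof.
move=> wM oW JW w0 wB; pose K := [set p : V | enorm p <= B] `&` ~` W.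
have cK : compact K.
  apply: (subclosed_compact _ (@enorm_le_compact R n B)) => //; last by move=> p [].
  apply: closedI; last exact: open_closedC.
  by apply: compact_closed; [exact: norm_hausdorff|exact: enorm_le_compact].
(* The factor 2 is there because the bump of radius d a is only known to vanish from distance 2 d a
   on. *)
have /choice[d Hd] (a : V) : exists d, K a -> exists X, [/\ supports X J, 0 < d &
    forall p, X p -> 2 * d < enorm (p - a)].
  have [Ka|nKa] := pselect (K a); last by exists 0.
  have [|X [d [XJ d0 Xd]]] := @chain_supp_avoid a; first by case: Ka => _ /(contra_not _); apply; exact: JW.
  exists (d / 2) => _; exists X; split=> //; first by rewrite divr_gt0.
  by move=> p /Xd; rewrite mulrC divfK.
have [s [sK Ks]] := enorm_cover cK (fun a Ka => let: ex_intro X (And3 _ d0 _) := Hd a Ka in d0).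
have wK p : ~ K p -> w p = 0.
  move=> /not_andP[/negP|/contrapT /w0 //]; first by rewrite -ltNge => /wB.
pose h (s : seq V) p := \prod_(a <- s) (1 - bump a (d a) p).
have hs0 p : fscale (h s) w p = 0.
  apply/ffunP => S; rewrite !ffunE.
  have [/Ks[a aS pa]|/wK ->] := pselect (K p); last by rewrite ffunE mulr0.
  rewrite /h (big_rem a) //= bump1 ?subrr ?mul0r ?(ltW pa) //.
  by have [X []] := Hd a (sK a aS).
suff [N _ ->] : exists2 N, Bd r N (h s) & chain_int J w = chain_int J (fscale (h s) w).
  exact: chain_int0.
elim: s {Ks hs0} sK => [|a s IH] sK.
  exists `|1|.
    by rewrite (_ : h _ = fun=> 1); [exact: Bd_cst|apply/funext => p; rewrite /h big_nil].
  by congr chain_int; apply/funext => p; apply/ffunP => S; rewrite ffunE /h big_nil mul1r.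
have [|N hN ->] := IH; first by move=> b bs; apply: sK; rewrite inE bs orbT.
have [X [XJ d0 Xd]] := Hd a (sK a (mem_head _ _)).
have [Nb Hb] := bump_Bd r a d0.
have hsE : fscale (fun p => 1 - bump a (d a) p) (fscale (h s) w) = fscale (h (a :: s)) w.
  by apply/funext => p; apply/ffunP => S; rewrite !ffunE /h big_cons mulrA.
exists (2 ^+ r * (`|1| + Nb) * N).
  rewrite (_ : h _ = fun p => (1 - bump a (d a) p) * h s p).
    exact: BdM (BdD (Bd_cst 1) (BdN Hb)) hN.
  by apply/funext => p; rewrite /h big_cons.
rewrite (chain_int_split Hb (fBd_scale hN wM)) hsE.
rewrite (chain_int_ball (fBd_scale Hb (fBd_scale hN wM)) XJ _ Xd) ?add0r //.
- by rewrite mulr_gt0.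
- exact: enorm_unbounded.
- by move=> p pd; apply/ffunP => S; rewrite !ffunE bump0 ?mul0r // ltW.
Qed.

(* The cutoffs psi m have the same difference bounds for all m, so the integrals
   of (1 - psi m) w tend to 0 uniformly in the approximating pointed chains. *)
Lemma chain_int_local M w (W : set V) : fBd M w -> open W ->
  chain_supp J `<=` W -> (forall p, W p -> w p = 0) -> chain_int J w = 0.
Proof.
move=> wM oW JW w0; have [N HN] := bump_Bd r (0 : V) (@ltr01 R).
pose psi (m : nat) (p : V) : R := bump 0 1 (m.+1%:R^-1 *: p).
have psiB m : Bd r N (psi m).
  by apply: Bd_scale HN; rewrite ger0_norm ?invr_ge0 // invf_le1 // ler1n.
have cut m : chain_int J (fscale (psi m) w) = 0.
  apply: (@chain_int_compact _ _ W (2 * m.+1%:R) (fBd_scale (psiB m) wM)) => // [p /w0|p pm].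
    by move=> E; apply/ffunP => S; rewrite ffunE E ffunE mulr0.
  apply/ffunP => S; rewrite !ffunE /psi bump0 ?mul0r // subr0 enormZ.
  by rewrite ger0_norm ?invr_ge0 // mulr1 [leRHS]mulrC ler_pdivlMr // ltW.
pose w' m := fscale (fun p => 1 - psi m p) w.
have [C w'B] : exists C, forall m, Bform_le r C (w' m).
  by eexists => m; exact: fBd_Bform_le (fBd_scale (BdD (Bd_cst 1) (BdN (psiB m))) wM).
have E m : chain_int J w = chain_int J (w' m).
  by rewrite (chain_int_split (psiB m) wM) cut add0r.
apply/eqP; rewrite -normr_le0; apply/ler_addgt0Pr => e e0; rewrite add0r.
have C0 : 0 < `|C| + 1 by rewrite ltr_wpDl.
have [i0 Hi] := chain_int_unif J (divr_gt0 e0 C0).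
(* This pointed chain has finite support, on which psi m = 1 for large m. It therefore gives the
   value 0 to w' m, and only the uniform error remains. *)
have [X uX AX] := pchain_suppP (chain_seq J i0).
have [m Hm] : exists m : nat, forall p, p \in X -> enorm p <= m.+1%:R.
  exists (Num.truncn (\sum_(p <- X) enorm p)) => p pX; apply: le_trans (ltW (truncnS_gt _)).
  by rewrite (big_rem p) //= lerDl sumr_ge0 // => q _; exact: enorm_ge0.
have := Hi i0 (leqnn _) _ _ (w'B m).
rewrite (_ : form_eval _ _ = 0) ?sub0r ?normrN -?E => [H|].
  apply: le_trans H _; rewrite mulrA ler_pdivrMr // mulrC ler_wpM2l ?ltW //.
  by rewrite ltrDl.
rewrite (form_eval_seq _ uX AX) big1_seq // => p /andP[_ pX]; rewrite big1 // => S _.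
rewrite !ffunE /psi bump1 ?subrr ?mul0r // subr0 enormZ ger0_norm ?invr_ge0 //.
by rewrite mulrC ler_pdivrMr // mul1r Hm.
Qed.

End Locality.

Section DwIntegral.
Variables (R : realType) (r : nat).
Local Notation V := 'rV[R]_2.
Local Notation C := R[i].
Implicit Types (g h : V -> C) (p : V) (M e : R) (A : pchain R 2 1) (J : dchain R 2 1 r).

Definition dw_re g : dform R 2 1 := fun p => [ffun S => complex.Re (dw_form g p S)].
Definition dw_im g : dform R 2 1 := fun p => [ffun S => complex.Im (dw_form g p S)].

Definition dw_eval g A : C := (form_eval (dw_re g) A +i* form_eval (dw_im g) A)%C.

Definition dw_int J g : C := chain_cint J (dw_form g).

Lemma Re_dw_int J g : complex.Re (dw_int J g) = chain_int J (dw_re g).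
Proof. by []. Qed.

Lemma Im_dw_int J g : complex.Im (dw_int J g) = chain_int J (dw_im g).
Proof. by []. Qed.

(** The value of dw on the basis vector indexed by S, that is 1 or i. *)
Definition dw_dir (S : kidx 2 1) : C := \sum_(i in val S) toC (ebase R i).

Definition dw_const : R := 2 ^+ r.+1 * \sum_S normc (dw_dir S).

Lemma dw_const_ge0 : 0 <= dw_const.
Proof. by rewrite mulr_ge0 ?exprn_ge0 // sumr_ge0 // => S _; exact: normc_ge0. Qed.

Lemma fBd_dw M g : cBd r M g ->
  fBd r (dw_const * M) (dw_re g) /\ fBd r (dw_const * M) (dw_im g).
Proof.
move=> gM; have M0 := cBd_ge0 gM.
have B S : cBd r (dw_const * M) (fun p => g p * dw_dir S).
  apply: cBd_le (leqnn r) _ (cBdM gM (cBd_cst r (dw_dir S))).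
  rewrite /dw_const -!mulrA ler_wpM2l ?exprn_ge0 // mulrC ler_wpM2r //.
  by rewrite (bigD1 S) //= lerDl sumr_ge0 // => T _; exact: normc_ge0.
by split=> S; [case: (B S) => + _|case: (B S) => _ +]; congr Bd;
  apply/funext => p; rewrite !ffunE.
Qed.

Definition dw_bound : R := #|{: kidx 2 1}|%:R * dw_const.

Lemma dw_bound_ge0 : 0 <= dw_bound.
Proof. by rewrite mulr_ge0 // dw_const_ge0. Qed.

Lemma Bform_le_dw M g : cBd r M g ->
  Bform_le r (dw_bound * M) (dw_re g) /\ Bform_le r (dw_bound * M) (dw_im g).
Proof.
move=> /fBd_dw[B1 B2]; rewrite -mulrA.
by split; apply: fBd_Bform_le => //; exact: simple_kvec1.
Qed.

Lemma dw_eval_lin (c : C) g h A :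
  dw_eval (fun p => g p + c * h p) A = dw_eval g A + c * dw_eval h A.
Proof.
case: c => a b; apply: complexP; rewrite ?(ReD, ImD, ReM, ImM) /=.
  rewrite (_ : dw_re _ = fun p => [ffun S =>
      (fun p => [ffun S => dw_re g p S + a * dw_re h p S] : {ffun _}) p S +
      - b * dw_im h p S]); last first.
    apply/funext => p; apply/ffunP => S; rewrite !ffunE mulrDl ReD -mulrA !(ReM, ImM) /=.
    by ring.
  by rewrite !form_eval_lin; ring.
rewrite (_ : dw_im _ = fun p => [ffun S =>
    (fun p => [ffun S => dw_im g p S + a * dw_im h p S] : {ffun _}) p S +
    b * dw_re h p S]); last first.
  apply/funext => p; apply/ffunP => S; rewrite !ffunE mulrDl ImD -mulrA !(ReM, ImM) /=.
  by ring.
by rewrite !form_eval_lin; ring.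
Qed.

(** Determines the integral without any difference bound on g. Functions defined by a parameter
    integral are handled in this way. *)
Definition dw_cvg J g (v : C) := forall e, 0 < e ->
  exists N, forall i, (N <= i)%N -> normc (dw_eval g (chain_seq J i) - v) < e.

Lemma dw_cvg_int J g v : dw_cvg J g v -> dw_int J g = v.
Proof.
move=> gv; apply: complexP; apply: chain_intE; apply/seq_cvgP => e /gv[N HN];
  exists N => i /HN; apply: le_lt_trans.
  by have := Re_le_normc (dw_eval g (chain_seq J i) - v); rewrite ReD ReN.
by have := Im_le_normc (dw_eval g (chain_seq J i) - v); rewrite ImD ImN.
Qed.

Lemma dw_cvg_lin J g h (c u v : C) : dw_cvg J g u -> dw_cvg J h v ->
  dw_cvg J (fun p => g p + c * h p) (u + c * v).
Proof.
move=> gu hv e e0; have e2 : 0 < e / 2 by rewrite divr_gt0.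
have c0 : 0 < normc c + 1 by rewrite ltr_wpDl ?normc_ge0.
have [N1 H1] := gu _ e2; have [N2 H2] := hv _ (divr_gt0 e2 c0).
exists (maxn N1 N2) => i; rewrite geq_max => /andP[/H1 K1 /H2 K2].
rewrite dw_eval_lin opprD addrACA -mulrBr [e]splitr.
apply: le_lt_trans (normcD _ _) (ltr_leD K1 _).
rewrite normcM; move: K2; rewrite ltr_pdivlMr // => /ltW; apply: le_trans.
by rewrite mulrC ler_wpM2l ?normc_ge0 // lerDl.
Qed.

Lemma dw_cvg0 J : dw_cvg J (fun=> 0) 0.
Proof.
move=> e e0; exists 0%N => i _; rewrite subr0.
suff -> : dw_eval (fun=> 0) (chain_seq J i) = 0 by rewrite normc0.
have E : (fun _ : V => 0 : C) = fun p => (fun=> 0) p + -1 * (fun=> 0) p.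
  by apply/funext => p; rewrite mulr0 addr0.
by rewrite {1}E dw_eval_lin mulN1r subrr.
Qed.

Lemma dw_cvgZ J g (c v : C) : dw_cvg J g v -> dw_cvg J (fun p => c * g p) (c * v).
Proof.
move=> /(dw_cvg_lin c (dw_cvg0 J)); rewrite add0r; congr dw_cvg.
by apply/funext => p; rewrite add0r.
Qed.

Lemma dw_cvg_sum J (I : eqType) (s : seq I) (c v : I -> C) (F : I -> V -> C) :
  {in s, forall i, dw_cvg J (F i) (v i)} ->
  dw_cvg J (fun p => \sum_(i <- s) c i * F i p) (\sum_(i <- s) c i * v i).
Proof.
elim: s => [|i s IH] H.
  by rewrite big_nil; under [X in dw_cvg _ X]eq_fun do rewrite big_nil; exact: dw_cvg0.
rewrite big_cons addrC.
have := dw_cvg_lin (c i) (IH (fun j js => H j (mem_behead (s := i :: s) js)))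
  (H i (mem_head _ _)).
by congr dw_cvg; apply/funext => p; rewrite big_cons addrC.
Qed.

Lemma dw_int_unif J e : 0 < e -> exists N, forall i, (N <= i)%N ->
  forall g M, cBd r M g -> normc (dw_eval g (chain_seq J i) - dw_int J g) <= M * e.
Proof.
move=> e0; have d0 : 0 < 2 * (dw_bound + 1) by rewrite mulr_gt0 // ltr_wpDl ?dw_bound_ge0.
have [N HN] := chain_int_unif J (divr_gt0 e0 d0).
exists N => i Ni g M gM; have [B1 B2] := Bform_le_dw gM; have M0 := cBd_ge0 gM.
apply: le_trans (normc_le _) _; rewrite ReD ReN ImD ImN.
apply: le_trans (lerD (HN i Ni _ _ B1) (HN i Ni _ _ B2)) _.
rewrite ger0_norm ?(mulr_ge0 dw_bound_ge0 M0) //.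
have -> (x y z : R) : x * (y / z) + x * (y / z) = 2 * x * y / z by ring.
rewrite ler_pdivrMr //.
have : 0 <= M * e by rewrite mulr_ge0 // ltW.
by have := dw_bound_ge0; nra.
Qed.

Lemma cBd_dw_cvg J M g : cBd r M g -> dw_cvg J g (dw_int J g).
Proof.
move=> gM e e0; have M0 := cBd_ge0 gM.
have M1 : 0 < M + 1 by rewrite ltr_wpDl.
have [N HN] := dw_int_unif J (divr_gt0 e0 M1); exists N => i Ni.
apply: le_lt_trans (HN i Ni g M gM) _; rewrite mulrA ltr_pdivrMr // mulrC ltr_pM2l //.
by rewrite ltrDl.
Qed.

Lemma dw_int_bound J : exists2 K, 0 <= K & forall g M, cBd r M g ->
  normc (dw_int J g) <= M * K.
Proof.
have [K HK] := chain_int_bound J; exists (2 * (dw_bound * `|K|)).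
  by rewrite mulr_ge0 // mulr_ge0 // dw_bound_ge0.
move=> g M gM; have [B1 B2] := Bform_le_dw gM; have M0 := cBd_ge0 gM.
apply: le_trans (normc_le _) _; apply: le_trans (lerD (HK _ _ B1) (HK _ _ B2)) _.
rewrite ger0_norm ?(mulr_ge0 dw_bound_ge0 M0) //.
have -> : M * (2 * (dw_bound * `|K|)) = dw_bound * M * `|K| + dw_bound * M * `|K| by ring.
by rewrite lerD // ler_wpM2l ?(mulr_ge0 dw_bound_ge0 M0) // ler_norm.
Qed.

Lemma dw_int_lin J M1 M2 g h (c : C) : cBd r M1 g -> cBd r M2 h ->
  dw_int J (fun p => g p + c * h p) = dw_int J g + c * dw_int J h.
Proof.
move=> gM hM; apply/dw_cvg_int/dw_cvg_lin.
  exact: (@cBd_dw_cvg J _ _ gM).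
exact: (@cBd_dw_cvg J _ _ hM).
Qed.

Lemma dw_int_eq J M1 M2 g h (W : set V) : cBd r M1 g -> cBd r M2 h ->
  open W -> chain_supp J `<=` W -> (forall p, W p -> g p = h p) ->
  dw_int J g = dw_int J h.
Proof.
move=> gM hM oW JW gh; apply/eqP; rewrite -subr_eq0 -mulN1r.
rewrite -(dw_int_lin J (-1) gM hM); apply/eqP.
have [B1 B2] := fBd_dw (cBdD gM (cBdZ (-1) hM)).
have z0 p : W p -> g p + -1 * h p = 0 by move=> /gh ->; rewrite mulN1r subrr.
apply: complexP.
  rewrite Re_dw_int; apply: (chain_int_local (@simple_kvec1 R 2) _ B1 oW JW) => // p /z0 E.
  by apply/ffunP => S; rewrite !ffunE E mul0r.
rewrite Im_dw_int; apply: (chain_int_local (@simple_kvec1 R 2) _ B2 oW JW) => // p /z0 E.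
by apply/ffunP => S; rewrite !ffunE E mul0r.
Qed.

(** The equations on W say that dg = h dw there, with real and imaginary parts separated. The
    integral of dg vanishes since J is closed, and by locality only W matters. *)
Lemma dw_int_exact J M N g h (W : set V) : closed_chain J ->
  cBd r.+1 M g -> cBd r N h -> open W -> chain_supp J `<=` W ->
  (forall p i, derivable (@complex.Re R \o g) p (ebase R i)) ->
  (forall p i, derivable (@complex.Im R \o g) p (ebase R i)) ->
  (forall p i, W p ->
    pderive i (@complex.Re R \o g) p = (if i == 0 then complex.Re (h p) else - complex.Im (h p)) /\
    pderive i (@complex.Im R \o g) p = (if i == 0 then complex.Im (h p) else complex.Re (h p))) ->
  dw_int J h = 0.
Proof.
move=> Jc [gR gI] hN oW JW dR dI gh.
have [B1 B2] := fBd_dw hN.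
have key (u : V -> R) M' (w : dform R 2 1) : (forall p i, derivable u p (ebase R i)) ->
    Bd r.+1 M u -> fBd r M' w ->
    (forall p S i, W p -> val S = [set i]%SET -> w p S = pderive i u p) ->
    chain_int J w = 0.
  move=> du uM wM wE; pose G : dform R 2 0 := fun p => [ffun=> u p].
  have GE p S i : val S = [set i]%SET -> ext_d G p S = pderive i u p.
    move=> Si; rewrite ffunE Si big_set1.
    (* No element of the singleton {i} is below i, so the sign in [ext_d] is 1. *)
    rewrite (_ : [set _ | _ & _]%SET = finset.set0) ?cards0 ?expr0 ?mul1r; last first.
      apply/setP => j; rewrite !inE; apply/negP => /andP[/eqP ->].
      by rewrite ltnn.
    congr (pderive i _ p); apply/funext => q; rewrite /form_coef.
    have E : #|([set i] :\ i)%SET| == 0%N.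
      by rewrite cards_eq0; apply/eqP/setP => j; rewrite !inE andNb.
    by rewrite insubT ffunE.
  have GB : Bform r.+1 G.
    have HM S : Bd r.+1 M (fun p => G p S) by under eq_fun do rewrite ffunE.
    exact: Bform_leP (coef_Bform_le (@simple_kvec0 R 2) HM).
  have dB : fBd r M (ext_d G).
    move=> S; have [i Si] := kidx1P S; under eq_fun do rewrite (GE _ _ _ Si).
    by apply: pderive_Bd => // p; exact: du.
  rewrite -[RHS](Jc G GB).
  have B1' := fBd_Bform_le (@simple_kvec1 R 2) wM.
  have B2' := fBd_Bform_le (@simple_kvec1 R 2) dB.
  apply/eqP; rewrite -subr_eq0 -mulN1r -(chain_int_lin J (-1) B1' B2'); apply/eqP.
  have dB' : fBd r (M' + `|-1| * M) (fun p => [ffun S => w p S + -1 * ext_d G p S]).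
    by move=> S; under eq_fun do rewrite ffunE; apply: BdD => //; apply: BdZ.
  apply: (chain_int_local (@simple_kvec1 R 2) _ dB' oW JW) => // p Wp.
  apply/ffunP => S; rewrite !ffunE; have [i Si] := kidx1P S.
  have := GE p S i Si; rewrite ffunE => ->.
  by rewrite (wE p S i Wp Si) mulN1r subrr.
have dir (S : kidx 2 1) i : val S = [set i]%SET ->
    dw_dir S = if i == 0 then 1 else 'i%C.
  move=> Si; rewrite /dw_dir Si big_set1; apply: complexP; rewrite /= !mxE !eqxx /=.
    by case: i {Si} => -[|[|[]]].
  by case: i {Si} => -[|[|[]]].
apply: complexP.
  rewrite Re_dw_int; apply: (key _ _ (dw_re h) dR gR B1) => p S i Wp Si.
  rewrite ffunE /dw_form ffunE -/(dw_dir S) (dir S i Si) ReM.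
  by have [-> _] := gh p i Wp; case: (i == 0); rewrite /=; ring.
rewrite Im_dw_int; apply: (key _ _ (dw_im h) dI gI B2) => p S i Wp Si.
rewrite ffunE /dw_form ffunE -/(dw_dir S) (dir S i Si) ImM.
by have [_ ->] := gh p i Wp; case: (i == 0); rewrite /=; ring.
Qed.

End DwIntegral.

(** * Goursat's theorem and Cauchy's formula *)

Section SegmentIntegral.
Variable R : realType.
Local Notation C := R[i].
Local Notation mu := (@lebesgue_measure R).
Implicit Types (a b x y e M : R) (g h : R -> C) (f F : R -> R).

Definition seg_cont f a b := forall x, a <= x <= b -> {for x, continuous f}.

Lemma seg_cont_integrable f a b : seg_cont f a b ->
  mu.-integrable `[a, b] (EFin \o f).
Proof.
move=> fc; apply: continuous_compact_integrable; first exact: segment_compact.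
apply: continuous_in_subspaceT => x; rewrite inE /= in_itv /= => xab.
exact: fc.
Qed.

Lemma Rintegral_cat f a b c : a <= b -> b <= c -> seg_cont f a c ->
  \int[mu]_(x in `[a, c]) f x =
  \int[mu]_(x in `[a, b]) f x + \int[mu]_(x in `[b, c]) f x.
Proof.
move=> ab bc fc; have fi := seg_cont_integrable fc.
have := @Rintegral_itvB R f (BLeft a) (BRight c) b fi; rewrite !bnd_simp => /(_ ab bc).
rewrite Rintegral_itv_obnd_cbnd; first by move=> <-; rewrite addrC subrK.
apply: integrableS fi => // x /=; rewrite !in_itv /= => /andP[bx ->].
by rewrite (le_trans ab) // ltW.
Qed.

Lemma Rintegral_FTC2 f F a b : a <= b -> seg_cont f a b ->
  (forall x, a <= x <= b -> is_derive x 1 F (f x)) ->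
  \int[mu]_(x in `[a, b]) f x = F b - F a.
Proof.
rewrite le_eqVlt => /predU1P[-> _ _|ab fc Fd].
  by rewrite set_itv1 Rintegral_set1 subrr.
have Fc x : a <= x <= b -> {for x, continuous F}.
  by move=> /Fd[+ _] => /derivable1_diffP/differentiable_continuous.
rewrite /Rintegral (@continuous_FTC2 _ f F) //.
- apply: continuous_in_subspaceT => x; rewrite inE /= in_itv /= => xab.
  exact: fc.
- split.
  + by move=> x /[!in_itv]/= /andP[ax xb]; case: (Fd x) => //; rewrite !ltW.
  + by apply: cvg_at_right_filter; apply: Fc; rewrite lexx ltW.
  + by apply: cvg_at_left_filter; apply: Fc; rewrite lexx ltW.
by move=> x /[!in_itv]/= /andP[ax xb]; rewrite derive1E; case: (Fd x) => //; rewrite !ltW.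
Qed.

Lemma Rintegral_le_norm f a b M : a <= b -> seg_cont f a b ->
  (forall x, a <= x <= b -> `|f x| <= M) ->
  `|\int[mu]_(x in `[a, b]) f x| <= M * (b - a).
Proof.
move=> ab fc fM; have fi := seg_cont_integrable fc.
apply: le_trans (le_normr_Rintegral _ fi) _ => //.
have -> : M * (b - a) = \int[mu]_(x in `[a, b]) (cst M x).
  rewrite Rintegral_cst //; congr (_ * _).
  have /= := @lebesgue_measure_itv R `[a, b]; rewrite lte_fin => E.
  rewrite [X in fine X]E; by move: ab; rewrite le_eqVlt => /predU1P[->|->] //; rewrite ltxx subrr.
apply: le_Rintegral => //.
- by apply: seg_cont_integrable => x xab; apply: continuous_comp; [exact: fc|exact: norm_continuous].
- by apply: seg_cont_integrable => x _; exact: cst_continuous.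
Qed.

Definition cseg_cont g a b := seg_cont (@complex.Re R \o g) a b /\
  seg_cont (@complex.Im R \o g) a b.

Definition cint g a b : C :=
  ((\int[mu]_(x in `[a, b]) complex.Re (g x)) +i*
   (\int[mu]_(x in `[a, b]) complex.Im (g x)))%C.

Lemma cint_eq g h a b : (forall x, a <= x <= b -> g x = h x) -> cint g a b = cint h a b.
Proof.
move=> gh; apply: complexP; apply: eq_Rintegral => x;
  by rewrite inE /= in_itv /= => /gh ->.
Qed.

Lemma cint_cat g a b c : a <= b -> b <= c -> cseg_cont g a c ->
  cint g a c = cint g a b + cint g b c.
Proof.
by move=> ab bc [gr gi]; apply: complexP; exact: Rintegral_cat.
Qed.

Lemma cseg_cont_lin (c : C) g h a b : cseg_cont g a b -> cseg_cont h a b ->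
  cseg_cont (fun x => g x + c * h x) a b.
Proof.
move=> [gr gi] [hr hi]; split=> x xab.
  rewrite (_ : _ \o _ = fun x => complex.Re (g x) +
    (complex.Re c * complex.Re (h x) - complex.Im c * complex.Im (h x))).
    apply: continuousD; first exact: gr.
    by apply: continuousB; (apply: continuousM; first exact: cst_continuous);
      [exact: hr|exact: hi].
  by apply/funext => t; rewrite /= ReD ReM.
rewrite (_ : _ \o _ = fun x => complex.Im (g x) +
  (complex.Re c * complex.Im (h x) + complex.Im c * complex.Re (h x))).
  apply: continuousD; first exact: gi.
  by apply: continuousD; (apply: continuousM; first exact: cst_continuous);
    [exact: hi|exact: hr].
by apply/funext => t; rewrite /= ImD ImM.
Qed.

Lemma cint_lin (c : C) g h a b : cseg_cont g a b -> cseg_cont h a b ->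
  cint (fun x => g x + c * h x) a b = cint g a b + c * cint h a b.
Proof.
move=> [gr gi] [hr hi].
have lin u v (s : R) : seg_cont u a b -> seg_cont v a b ->
    seg_cont (fun x => u x + s * v x) a b /\
    \int[mu]_(x in `[a, b]) (u x + s * v x) =
    \int[mu]_(x in `[a, b]) u x + s * \int[mu]_(x in `[a, b]) v x.
  move=> uc vc; have iu := seg_cont_integrable uc; have iv := seg_cont_integrable vc.
  have sc : seg_cont (fun x => s * v x) a b.
    move=> x xab; apply: continuousM; last exact: vc.
    exact: cst_continuous.
  split; first by move=> x xab; apply: continuousD; [exact: uc|exact: sc].
  by rewrite RintegralD ?RintegralZl //; exact: seg_cont_integrable.
apply: complexP; rewrite ?(ReD, ImD, ReM, ImM) /=.
  have [c1 E1] := lin _ _ (complex.Re c) gr hr.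
  have [_ E2] := lin _ _ (- complex.Im c) c1 hi.
  rewrite addrA -mulNr -E1 -E2; apply: eq_Rintegral => x _.
  by rewrite ReD ReM /= mulNr addrA.
have [c1 E1] := lin _ _ (complex.Re c) gi hi.
have [_ E2] := lin _ _ (complex.Im c) c1 hr.
rewrite addrA -E1 -E2; apply: eq_Rintegral => x _.
by rewrite ImD ImM /= addrA.
Qed.

(** Real and imaginary parts are estimated separately; the resulting factor 2 is harmless. *)
Lemma cint_le g a b M : a <= b -> cseg_cont g a b ->
  (forall x, a <= x <= b -> normc (g x) <= M) ->
  normc (cint g a b) <= 2 * M * (b - a).
Proof.
move=> ab [gr gi] gM; apply: le_trans (normc_le _) _.
rewrite -mulrA mulr_natl mulr2n; apply: lerD.
  apply: Rintegral_le_norm => // x xab.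
  exact: le_trans (Re_le_normc _) (gM x xab).
apply: Rintegral_le_norm => // x xab.
exact: le_trans (Im_le_normc _) (gM x xab).
Qed.

Lemma continuous_affine (s t : R) : continuous (fun x : R => s + t * x).
Proof.
move=> x; apply: continuousD; first exact: cst_continuous.
by apply: continuousM; [exact: cst_continuous|exact: cvg_id].
Qed.

Lemma cint_affine (A B : C) a b : a <= b ->
  cint (fun x => A + B * x%:C%C) a b =
  A * (b - a)%:C%C + B * ((b ^+ 2 - a ^+ 2) / 2)%:C%C.
Proof.
move=> ab.
have prim (s t : R) :
    \int[mu]_(x in `[a, b]) (s + t * x) = s * (b - a) + t * ((b ^+ 2 - a ^+ 2) / 2).
  have fc : seg_cont (fun x => s + t * x) a b.
    by move=> x _; exact: continuous_affine.
  pose F := s \*: (@id R) + (t / 2) \*: (@id R * @id R).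
  have Fd x : a <= x <= b -> is_derive x 1 F (s + t * x).
    by move=> _; apply: is_derive_eq; rewrite /GRing.scale /=; field.
  have FE u : F u = s * u + t / 2 * (u * u) by [].
  by rewrite (Rintegral_FTC2 ab fc Fd) !FE; field.
have ReE x : complex.Re (A + B * x%:C%C) = complex.Re A + complex.Re B * x.
  by rewrite ReD ReM /= mulr0 subr0.
have ImE x : complex.Im (A + B * x%:C%C) = complex.Im A + complex.Im B * x.
  by rewrite ImD ImM /= mulr0 add0r.
have E1 : complex.Re (cint (fun x => A + B * x%:C%C) a b) =
    \int[mu]_(x in `[a, b]) (complex.Re A + complex.Re B * x).
  by apply: eq_Rintegral => x _; exact: ReE.
have E2 : complex.Im (cint (fun x => A + B * x%:C%C) a b) =
    \int[mu]_(x in `[a, b]) (complex.Im A + complex.Im B * x).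
  by apply: eq_Rintegral => x _; exact: ImE.
apply: complexP; rewrite ?E1 ?E2 prim.
  by rewrite ReD !ReM /= !mulr0 !subr0.
by rewrite ImD !ImM /= !mulr0 !add0r.
Qed.

End SegmentIntegral.

Section ComplexDifferentiability.
Variable R : realType.
Local Notation C := R[i].
Implicit Types (phi f : C -> C) (w z : C).

(** Differentiability as a first-order expansion with real-valued error, the form in which Goursat's
    argument consumes it. *)
Definition cdiff_at phi z (D : C) := forall e, 0 < e -> exists2 d, 0 < d &
  forall w, normc (w - z) < d ->
    normc (phi w - phi z - D * (w - z)) <= e * normc (w - z).

Definition ccont_at phi z := forall e, 0 < e -> exists2 d, 0 < d &
  forall w, normc (w - z) < d -> normc (phi w - phi z) < e.

Lemma gtc0_real (e : C) : 0 < e -> e = (complex.Re e)%:C%C /\ 0 < complex.Re e.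
Proof.
by case: e => a b; rewrite ltcE /= => /andP[/eqP -> a0].
Qed.

Lemma derivable_cdiff phi z : derivable (phi : C^o -> C^o) z 1 ->
  exists D, cdiff_at phi z D.
Proof.
move=> /cvg_ex[D /= phiD]; exists D => e e0.
have e0' : (0 : C) < e%:C%C by rewrite ltcR.
have /cvgrPdistC_lt /(_ _ e0') [d /= d0 Hd] := phiD.
(* The radius is given as a positive element of R[i]; in that order such an element is real. *)
have [dE dr0] := gtc0_real d0; exists (complex.Re d) => // w wd.
have [->|wz] := eqVneq w z; first by rewrite !subrr mulr0 subr0 normc0 mulr0.
have h0 : w - z != 0 by rewrite subr_eq0.
have nh : 0 < normc (w - z).
  by rewrite lt_def normc_ge0 andbT; apply: contra h0 => /eqP/eq0_normc/eqP.
have := Hd (w - z) _ h0; rewrite /ball_ /= sub0r normrN => H.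
have {}H : `|(w - z)^-1 *: (phi ((w - z) *: 1 + z) - phi z) - D| < e%:C%C.
  by apply: H; rewrite dE ltcR.
move: H; rewrite [(w - z) *: 1]mulr1 subrK => H.
have {}H : normc ((w - z)^-1 * (phi w - phi z) - D) < e by move: H; rewrite -ltcR.
have -> : phi w - phi z - D * (w - z) =
    ((w - z)^-1 * (phi w - phi z) - D) * (w - z) by field.
by rewrite normcM ler_wpM2r ?normc_ge0 // ltW.
Qed.

Lemma cdiff_ccont phi z D : cdiff_at phi z D -> ccont_at phi z.
Proof.
move=> pD e e0; have [d d0 Hd] := pD _ (@ltr01 R).
have K0 : 0 < 1 + normc D by rewrite ltr_pwDl // normc_ge0.
exists (Num.min d (e / (1 + normc D))); first by rewrite lt_min d0 divr_gt0.
move=> w; rewrite lt_min => /andP[/Hd H]; rewrite ltr_pdivlMr // => wd.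
apply: le_lt_trans wd; rewrite -[phi w - _](subrK (D * (w - z))).
apply: le_trans (normcD _ _) _; rewrite [leRHS]mulrDr mulr1 normcM; apply: lerD.
  by move: H; rewrite mul1r.
by rewrite mulrC.
Qed.

Lemma cseg_cont_comp phi (gam : R -> C) (a b K : R) :
  (forall s t, normc (gam s - gam t) <= K * `|s - t|) ->
  (forall t, a <= t <= b -> ccont_at phi (gam t)) ->
  cseg_cont (phi \o gam) a b.
Proof.
move=> gK pc; have K1 : 0 < `|K| + 1 by rewrite ltr_wpDl.
have near_t t e : a <= t <= b -> 0 < e ->
    \forall s \near t, normc (phi (gam s) - phi (gam t)) < e.
  move=> tab e0; have [d d0 Hd] := pc t tab e e0; near=> s; apply: Hd.
  apply: le_lt_trans (gK s t) _.
  apply: (@le_lt_trans _ _ ((`|K| + 1) * `|s - t|)).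
    by rewrite ler_wpM2r // (le_trans (ler_norm _)) // lerDl.
  rewrite mulrC -ltr_pdivlMr // distrC; near: s.
  by exists (d / (`|K| + 1)) => //=; rewrite divr_gt0.
split=> t tab; apply/cvgrPdistC_lt => e e0; near=> s.
  apply: le_lt_trans (_ : normc (phi (gam s) - phi (gam t)) < e).
    by have := Re_le_normc (phi (gam s) - phi (gam t)); rewrite ReD ReN.
  by near: s; exact: near_t.
apply: le_lt_trans (_ : normc (phi (gam s) - phi (gam t)) < e).
  by have := Im_le_normc (phi (gam s) - phi (gam t)); rewrite ImD ImN.
by near: s; exact: near_t.
Unshelve. all: by end_near. Qed.

End ComplexDifferentiability.

Section Bisection.
Variables (R : realType) (T : R -> R -> R -> R -> R[i]).

(** The dissection part of Goursat's proof, for any function of rectangles that is additive under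
    cuts and small compared with the squared size near every point. Size means half the perimeter,
    which is halved exactly at each stage. *)
Lemma bisection (a0 b0 c0 d0 : R) : a0 <= b0 -> c0 <= d0 ->
  (forall a m b c d, a0 <= a -> a <= m -> m <= b -> b <= b0 ->
    c0 <= c -> c <= d -> d <= d0 -> T a b c d = T a m c d + T m b c d) ->
  (forall a b c m d, a0 <= a -> a <= b -> b <= b0 ->
    c0 <= c -> c <= m -> m <= d -> d <= d0 -> T a b c d = T a b c m + T a b m d) ->
  (forall x y e, a0 <= x <= b0 -> c0 <= y <= d0 -> 0 < e ->
    exists2 s, 0 < s & forall a b c d, a0 <= a -> b <= b0 -> c0 <= c -> d <= d0 ->
      a <= x <= b -> c <= y <= d -> (b - a) + (d - c) < s ->
      normc (T a b c d) <= e * ((b - a) + (d - c)) ^+ 2) ->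
  T a0 b0 c0 d0 = 0.
Proof.
move=> ab0 cd0 Tv Th Tloc.
pose good (q : R * R * R * R) := let: (a, b, c, d) := q in
  [/\ a0 <= a, a <= b, b <= b0 & [/\ c0 <= c, c <= d & d <= d0]].
pose nT (q : R * R * R * R) := let: (a, b, c, d) := q in normc (T a b c d).
pose sz (q : R * R * R * R) := let: (a, b, c, d) := q in (b - a) + (d - c).
pose sub (q' q : R * R * R * R) := let: (a, b, c, d) := q in
  let: (a', b', c', d') := q' in [/\ a <= a', b' <= b, c <= c' & d' <= d].
have /choice[nxt Hnxt] (q : R * R * R * R) : exists q', good q ->
    [/\ good q', sub q' q, sz q' = sz q / 2 & nT q / 4 <= nT q'].
  have [gq|] := pselect (good q); last by exists q.
  move: q gq => [[[a b] c] d] [a0a ab bb0 [c0c cd dd0]].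
  pose m := (a + b) / 2; pose l := (c + d) / 2.
  have am : a <= m by rewrite /m; lra.
  have mb : m <= b by rewrite /m; lra.
  have cl : c <= l by rewrite /l; lra.
  have ld : l <= d by rewrite /l; lra.
  have E : T a b c d = T a m c l + T a m l d + (T m b c l + T m b l d).
    rewrite (Tv a m b c d) // (Th a m c l d) // ?(le_trans mb) //.
    by rewrite (Th m b c l d) // (le_trans a0a).
  have G1 : [/\ good (a, m, c, l), sub (a, m, c, l) (a, b, c, d) &
      sz (a, m, c, l) = sz (a, b, c, d) / 2].
    by do ?split=> //; rewrite /sz /m /l; lra.
  have G2 : [/\ good (a, m, l, d), sub (a, m, l, d) (a, b, c, d) &
      sz (a, m, l, d) = sz (a, b, c, d) / 2].
    by do ?split=> //; rewrite /sz /m /l; lra.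
  have G3 : [/\ good (m, b, c, l), sub (m, b, c, l) (a, b, c, d) &
      sz (m, b, c, l) = sz (a, b, c, d) / 2].
    by do ?split=> //; rewrite /sz /m /l; lra.
  have G4 : [/\ good (m, b, l, d), sub (m, b, l, d) (a, b, c, d) &
      sz (m, b, l, d) = sz (a, b, c, d) / 2].
    by do ?split=> //; rewrite /sz /m /l; lra.
  (* If three quarters fall short of a fourth of the whole, the triangle inequality forces the last
     one to reach it. *)
  have [H1|H1] := leP (normc (T a b c d) / 4) (normc (T a m c l)).
    by exists (a, m, c, l) => _; case: G1.
  have [H2|H2] := leP (normc (T a b c d) / 4) (normc (T a m l d)).
    by exists (a, m, l, d) => _; case: G2.
  have [H3|H3] := leP (normc (T a b c d) / 4) (normc (T m b c l)).
    by exists (m, b, c, l) => _; case: G3.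
  exists (m, b, l, d) => _; case: G4 => ? ? ?; split=> //=.
  have := le_trans (normcD (T a m c l + T a m l d) (T m b c l + T m b l d))
    (lerD (normcD _ _) (normcD _ _)).
  by rewrite -E; lra.
pose Q n := iter n nxt (a0, b0, c0, d0).
have Qgood n : good (Q n).
  elim: n => [|n IH]; first by split; rewrite ?lexx.
  by have [] := Hnxt _ IH.
have Qsub n m : (n <= m)%N -> sub (Q m) (Q n).
  elim: m => [|m IH]; first by rewrite leqn0 => /eqP ->; rewrite /sub /=; split.
  rewrite leq_eqVlt => /predU1P[->|]; first by case: (Q _) => [[[? ?] ?] ?]; split.
  rewrite ltnS => /IH; have [_ + _ _] := Hnxt _ (Qgood m); rewrite -[nxt _]/(Q m.+1).
  case: (Q m.+1) (Q m) (Q n) => [[[a b] c] d] [[[a' b'] c'] d'] [[[a'' b''] c''] d''].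
  by move=> [? ? ? ?] [? ? ? ?]; split; lra.
have Qsz n : sz (Q n) = sz (a0, b0, c0, d0) / 2 ^+ n.
  elim: n => [|n IH]; first by rewrite expr0 divr1.
  have [_ _ + _] := Hnxt _ (Qgood n); rewrite -[nxt _]/(Q n.+1) IH => ->.
  by rewrite exprS invfM mulrCA mulrC.
have QT n : nT (a0, b0, c0, d0) / 4 ^+ n <= nT (Q n).
  elim: n => [|n IH]; first by rewrite expr0 divr1.
  have [_ _ _] := Hnxt _ (Qgood n); rewrite -[nxt _]/(Q n.+1); apply: le_trans.
  by rewrite exprSr invfM mulrA ler_wpM2r ?invr_ge0.
pose qa (q : R * R * R * R) := q.1.1.1; pose qb (q : R * R * R * R) := q.1.1.2.
pose qc (q : R * R * R * R) := q.1.2; pose qd (q : R * R * R * R) := q.2.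
have nested (u v : R * R * R * R -> R) :
    (forall n m, u (Q n) <= v (Q m)) -> exists x, forall n, u (Q n) <= x <= v (Q n).
  move=> uv; exists (sup (range (fun n => u (Q n)))) => n; apply/andP; split.
    by apply: ub_le_sup; [exists (v (Q 0%N)) => _ [m _ <-]|exists n].
  by apply: ge_sup; [exists (u (Q n)); exists n|move=> _ [m _ <-]].
have [x xQ] : exists x, forall n, qa (Q n) <= x <= qb (Q n).
  apply: nested => n m; have := Qsub _ _ (leq_maxl n m); have := Qsub _ _ (leq_maxr n m).
  have := Qgood (maxn n m); rewrite /qa /qb.
  case: (Q (maxn n m)) (Q m) (Q n) => [[[a b] c] d] [[[a' b'] c'] d'] [[[a'' b''] c''] d''] /=.
  by move=> [? ? ? [? ? ?]] [? ? ? ?] [? ? ? ?]; lra.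
have [y yQ] : exists y, forall n, qc (Q n) <= y <= qd (Q n).
  apply: nested => n m; have := Qsub _ _ (leq_maxl n m); have := Qsub _ _ (leq_maxr n m).
  have := Qgood (maxn n m); rewrite /qc /qd.
  case: (Q (maxn n m)) (Q m) (Q n) => [[[a b] c] d] [[[a' b'] c'] d'] [[[a'' b''] c''] d''] /=.
  by move=> [? ? ? [? ? ?]] [? ? ? ?] [? ? ? ?]; lra.
set S := sz (a0, b0, c0, d0) in Qsz.
have S0 : 0 <= S by rewrite /S /sz; lra.
apply: eq0_normc; apply/eqP; rewrite eq_le normc_ge0 andbT; apply/ler_addgt0Pr => e e0.
have S1 : 0 < S ^+ 2 + 1 by rewrite ltr_wpDl ?sqr_ge0.
(* The lower bound for T and the squared size both scale by 4^-n, so n cancels; dividing e by S^2 +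
   1 then leaves a bound by e, also when S = 0. *)
have [s s0 Hs] := Tloc x y _ (xQ 0%N) (yQ 0%N) (divr_gt0 e0 S1).
have [n Hn] : exists n : nat, S < s * 2 ^+ n.
  exists (Num.truncn (S / s)); rewrite mulrC -ltr_pdivrMr //.
  apply: lt_le_trans (truncnS_gt _) _; rewrite -natrX ler_nat.
  exact: ltn_expl.
have P2 : 0 < 2 ^+ n :> R by rewrite exprn_gt0.
have := Hs (qa (Q n)) (qb (Q n)) (qc (Q n)) (qd (Q n)).
have := Qgood n; have := QT n; have := Qsz n; have := xQ n; have := yQ n.
rewrite /qa /qb /qc /qd; case: (Q n) => [[[a b] c] d] /= yab xab szE TE.
move=> [? ? ? [? ? ?]] H; have {}H : normc (T a b c d) <= e / (S ^+ 2 + 1) * (b - a + (d - c)) ^+ 2.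
  by apply: H => //; rewrite szE ltr_pdivrMr.
rewrite add0r; have := le_trans TE H; rewrite szE expr_div_n -exprM mulnC exprM.
have -> : (2 ^+ 2 : R) = 4 by ring.
have P4 : 0 < 4 ^+ n :> R by rewrite exprn_gt0.
rewrite mulrA ler_pM2r ?invr_gt0 // => H'; apply: le_trans H' _.
rewrite mulrAC ler_pdivrMr // ler_wpM2l ?(ltW e0) // lerDl //.
Qed.

End Bisection.

Section RectangleIntegral.
Variable R : realType.
Local Notation C := R[i].
Implicit Types (phi f : C -> C) (w z : C) (a b c d x y e M : R).
Local Open Scope complex_scope.

(** The contour integral of phi dz counterclockwise, where dz = i dy on the vertical sides. *)
Definition rect_int phi a b c d : C :=
  cint (fun x => phi (x +i* c)) a b + 'i%C * cint (fun y => phi (b +i* y)) c d -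
  cint (fun x => phi (x +i* d)) a b - 'i%C * cint (fun y => phi (a +i* y)) c d.

Lemma hseg_cont phi a b c : (forall x, a <= x <= b -> ccont_at phi (x +i* c)) ->
  cseg_cont (fun x => phi (x +i* c)) a b.
Proof.
apply: (@cseg_cont_comp _ phi (fun x => x +i* c) _ _ 1) => s t.
rewrite mul1r (_ : (s +i* c) - (t +i* c) = (s - t) +i* 0).
  by rewrite /= expr0n addr0 sqrtr_sqr.
by apply: complexP; rewrite ?(ReD, ReN, ImD, ImN) //= subrr.
Qed.

Lemma vseg_cont phi a c d : (forall y, c <= y <= d -> ccont_at phi (a +i* y)) ->
  cseg_cont (fun y => phi (a +i* y)) c d.
Proof.
apply: (@cseg_cont_comp _ phi (fun y => a +i* y) _ _ 1) => s t.
rewrite mul1r (_ : (a +i* s) - (a +i* t) = 0 +i* (s - t)).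
  by rewrite /= expr0n add0r sqrtr_sqr.
by apply: complexP; rewrite ?(ReD, ReN, ImD, ImN) //= subrr.
Qed.

Lemma rect_int_vcut phi a m b c d : a <= m -> m <= b ->
  (forall x, a <= x <= b -> ccont_at phi (x +i* c) /\ ccont_at phi (x +i* d)) ->
  rect_int phi a b c d = rect_int phi a m c d + rect_int phi m b c d.
Proof.
move=> am mb pc; rewrite /rect_int.
rewrite (cint_cat am mb (hseg_cont (fun x xab => (pc x xab).1))).
rewrite (cint_cat am mb (hseg_cont (fun x xab => (pc x xab).2))).
by ring.
Qed.

Lemma rect_int_hcut phi a b c m d : c <= m -> m <= d ->
  (forall y, c <= y <= d -> ccont_at phi (a +i* y) /\ ccont_at phi (b +i* y)) ->
  rect_int phi a b c d = rect_int phi a b c m + rect_int phi a b m d.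
Proof.
move=> cm md pc; rewrite /rect_int.
rewrite (cint_cat cm md (vseg_cont (fun x xab => (pc x xab).1))).
rewrite (cint_cat cm md (vseg_cont (fun x xab => (pc x xab).2))).
by ring.
Qed.

Definition rect_bd_cont phi a b c d :=
  (forall x, a <= x <= b -> ccont_at phi (x +i* c) /\ ccont_at phi (x +i* d)) /\
  (forall y, c <= y <= d -> ccont_at phi (a +i* y) /\ ccont_at phi (b +i* y)).

Lemma rect_int_le phi a b c d M : a <= b -> c <= d -> rect_bd_cont phi a b c d ->
  (forall x, a <= x <= b -> normc (phi (x +i* c)) <= M /\ normc (phi (x +i* d)) <= M) ->
  (forall y, c <= y <= d -> normc (phi (a +i* y)) <= M /\ normc (phi (b +i* y)) <= M) ->
  normc (rect_int phi a b c d) <= 4 * M * ((b - a) + (d - c)).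
Proof.
move=> ab cd [hc vc] hM vM.
have i1 (u : C) : normc ('i%C * u) = normc u.
  by rewrite normcM /= expr0n expr1n add0r sqrtr1 mul1r.
have h1 := cint_le ab (hseg_cont (fun x xab => (hc x xab).1)) (fun x xab => (hM x xab).1).
have h2 := cint_le ab (hseg_cont (fun x xab => (hc x xab).2)) (fun x xab => (hM x xab).2).
have v1 := cint_le cd (vseg_cont (fun x xab => (vc x xab).1)) (fun x xab => (vM x xab).1).
have v2 := cint_le cd (vseg_cont (fun x xab => (vc x xab).2)) (fun x xab => (vM x xab).2).
rewrite /rect_int; apply: le_trans (normcD _ _) _; rewrite normcNE i1.
apply: le_trans (lerD (normcD _ _) (lexx _)) _; rewrite normcNE.
apply: le_trans (lerD (lerD (normcD _ _) (lexx _)) (lexx _)) _; rewrite i1.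
by lra.
Qed.

Lemma rect_int_lin (k : C) phi f a b c d :
  rect_bd_cont phi a b c d -> rect_bd_cont f a b c d ->
  rect_int (fun w => phi w + k * f w) a b c d =
  rect_int phi a b c d + k * rect_int f a b c d.
Proof.
move=> [ph pv] [fh fv]; rewrite /rect_int.
rewrite (cint_lin k (hseg_cont (fun x xab => (ph x xab).1)) (hseg_cont (fun x xab => (fh x xab).1))).
rewrite (cint_lin k (hseg_cont (fun x xab => (ph x xab).2)) (hseg_cont (fun x xab => (fh x xab).2))).
rewrite (cint_lin k (vseg_cont (fun x xab => (pv x xab).1)) (vseg_cont (fun x xab => (fv x xab).1))).
rewrite (cint_lin k (vseg_cont (fun x xab => (pv x xab).2)) (vseg_cont (fun x xab => (fv x xab).2))).
by ring.
Qed.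

Lemma rect_int_eq phi f a b c d :
  (forall x, a <= x <= b -> phi (x +i* c) = f (x +i* c) /\ phi (x +i* d) = f (x +i* d)) ->
  (forall y, c <= y <= d -> phi (a +i* y) = f (a +i* y) /\ phi (b +i* y) = f (b +i* y)) ->
  rect_int phi a b c d = rect_int f a b c d.
Proof.
move=> h v; rewrite /rect_int.
by congr (_ + 'i%C * _ - _ - 'i%C * _); apply: cint_eq => t tab;
  [case: (h t tab)|case: (v t tab)|case: (h t tab)|case: (v t tab)].
Qed.

Lemma cdiff_affine (A B : C) z : cdiff_at (fun w => A + B * w) z B.
Proof.
move=> e e0; exists 1 => // w _.
rewrite (_ : _ - _ = 0); last by ring.
by rewrite normc0 mulr_ge0 ?normc_ge0 // ltW.
Qed.

Lemma ccont_affine (A B : C) z : ccont_at (fun w => A + B * w) z.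
Proof. exact: cdiff_ccont (cdiff_affine A B z). Qed.

Lemma ccont_lin (k : C) phi f z : ccont_at phi z -> ccont_at f z ->
  ccont_at (fun w => phi w + k * f w) z.
Proof.
move=> pc fc e e0; have k0 : 0 < normc k + 1 by rewrite ltr_wpDl ?normc_ge0.
have e2 : 0 < e / 2 by rewrite divr_gt0.
have [d1 d10 H1] := pc _ e2; have [d2 d20 H2] := fc _ (divr_gt0 e2 k0).
exists (Num.min d1 d2); first by rewrite lt_min d10.
move=> w; rewrite lt_min => /andP[/H1 K1 /H2 K2].
rewrite opprD addrACA -mulrBr [e]splitr.
apply: le_lt_trans (normcD _ _) (ltr_leD K1 _).
rewrite normcM; move: K2; rewrite ltr_pdivlMr // => /ltW; apply: le_trans.
by rewrite mulrC ler_wpM2l ?normc_ge0 // lerDl.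
Qed.

Lemma rect_int_affine (A B : C) a b c d : a <= b -> c <= d ->
  rect_int (fun w => A + B * w) a b c d = 0.
Proof.
move=> ab cd; rewrite /rect_int.
have hE y : cint (fun x => A + B * (x +i* y)) a b =
    (A + B * ('i%C * y%:C)) * (b - a)%:C + B * ((b ^+ 2 - a ^+ 2) / 2)%:C.
  rewrite -cint_affine //; apply: cint_eq => x _.
  by rewrite (complexE (x +i* y)) /=; ring.
have vE x : cint (fun y => A + B * (x +i* y)) c d =
    (A + B * x%:C) * (d - c)%:C + (B * 'i%C) * ((d ^+ 2 - c ^+ 2) / 2)%:C.
  rewrite -cint_affine //; apply: cint_eq => y _.
  by rewrite (complexE (x +i* y)) /=; ring.
by rewrite !hE !vE !rmorphB /=; ring.
Qed.

(** Affine functions integrate to 0 around rectangles, so near a point only the remainder of the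
    first-order expansion counts. It is at most e/8 times the size, and [rect_int_le] turns this
    into e/2 times the squared size. *)
Lemma Goursat phi a b c d : a <= b -> c <= d ->
  (forall x y, a <= x <= b -> c <= y <= d -> exists D, cdiff_at phi (x +i* y) D) ->
  rect_int phi a b c d = 0.
Proof.
move=> ab cd pd.
have pc x y : a <= x <= b -> c <= y <= d -> ccont_at phi (x +i* y).
  by move=> xab ycd; have [D] := pd x y xab ycd; exact: cdiff_ccont.
apply: (@bisection R (rect_int phi)) => //.
- move=> a' m b' c' d' aa am mb bb cc c'd' dd; apply: rect_int_vcut => // x /andP[ax xb].
  by split; apply: pc; lra.
- move=> a' b' c' m d' aa a'b' bb cc cm md dd; apply: rect_int_hcut => // y /andP[cy yd].
  by split; apply: pc; lra.
move=> x y e xab ycd e0; have e8 : 0 < e / 8 by rewrite divr_gt0.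
have [D pD] := pd x y xab ycd.
have [s s0 Hs] := pD _ e8; exists s => // a' b' c' d' aa bb cc dd xab' ycd' szs.
set z := x +i* y in pD Hs.
pose rho w := phi w + (-1) * ((phi z - D * z) + D * w).
have S0 : 0 <= b' - a' + (d' - c') by lra.
have reg t u : a' <= t <= b' -> c' <= u <= d' ->
    ccont_at rho (t +i* u) /\ normc (rho (t +i* u)) <= e / 8 * (b' - a' + (d' - c')).
  move=> tab ucd; split; first by apply: ccont_lin; [apply: pc; lra|exact: ccont_affine].
  have dist : normc (t +i* u - z) <= b' - a' + (d' - c').
    apply: le_trans (normc_le _) _; rewrite ReD ImD ReN ImN /=.
    by apply: lerD; rewrite ler_norml; apply/andP; split; lra.
  rewrite (_ : rho _ = phi (t +i* u) - phi z - D * (t +i* u - z)); last by rewrite /rho; ring.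
  apply: le_trans (Hs _ (le_lt_trans dist szs)) _.
  by rewrite ler_wpM2l // ltW.
have ab' : a' <= b' by lra.
have cd' : c' <= d' by lra.
have la : a' <= a' <= b' by rewrite lexx.
have lb : a' <= b' <= b' by rewrite lexx ab'.
have lc : c' <= c' <= d' by rewrite lexx.
have ld : c' <= d' <= d' by rewrite lexx cd'.
have -> : rect_int phi a' b' c' d' = rect_int rho a' b' c' d'.
  rewrite rect_int_lin ?rect_int_affine ?mulr0 ?addr0 //; split=> t tab.
  - by split; apply: pc; lra.
  - by split; apply: pc; lra.
  - by split; exact: ccont_affine.
  - by split; exact: ccont_affine.
have := @rect_int_le rho a' b' c' d' (e / 8 * (b' - a' + (d' - c'))) ab' cd'.
move=> H; apply: le_trans (H _ _ _) _.
- split=> t tab; first by have [? _] := reg t c' tab lc; have [? _] := reg t d' tab ld.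
  by have [? _] := reg a' t la tab; have [? _] := reg b' t lb tab.
- by move=> t tab; have [_ ?] := reg t c' tab lc; have [_ ?] := reg t d' tab ld.
- by move=> t tab; have [_ ?] := reg a' t la tab; have [_ ?] := reg b' t lb tab.
rewrite expr2 !mulrA ler_wpM2r // ler_wpM2r //; lra.
Qed.

End RectangleIntegral.

(** * Cauchy's formula on a rectangle *)

Section CauchyRectangle.
Variable R : realType.
Local Notation C := R[i].
Local Notation mu := (@lebesgue_measure R).
Implicit Types (phi f : C -> C) (w z : C) (a b c d x y e u v M : R).
Local Open Scope complex_scope.

(** Four cuts isolate a small square about the exceptional point; Goursat's theorem applies to the
    four rectangles cut off. *)
Lemma rect_int_shrink phi a b c d u v e : 0 < e ->
  a < u - e -> u + e < b -> c < v - e -> v + e < d ->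
  (forall x y, a <= x <= b -> c <= y <= d -> x +i* y != u +i* v ->
     exists D, cdiff_at phi (x +i* y) D) ->
  rect_int phi a b c d = rect_int phi (u - e) (u + e) (v - e) (v + e).
Proof.
move=> e0 au ub cv vd pd.
have neq x y : (x != u) || (y != v) -> x +i* y != u +i* v.
  by rewrite eq_complex negb_and.
have pc x y : a <= x <= b -> c <= y <= d -> (x != u) || (y != v) ->
    ccont_at phi (x +i* y).
  by move=> xab ycd xy; have [D] := pd x y xab ycd (neq _ _ xy); exact: cdiff_ccont.
have G a' b' c' d' : a <= a' -> a' <= b' -> b' <= b -> c <= c' -> c' <= d' -> d' <= d ->
    b' < u \/ u < a' \/ d' < v \/ v < c' -> rect_int phi a' b' c' d' = 0.
  move=> aa ab bb cc cd dd H; apply: Goursat => // x y xab ycd; apply: pd; try lra.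
  apply: neq; case: H => [H|[H|[H|H]]].
  - by rewrite lt_eqF //; lra.
  - by rewrite gt_eqF //; lra.
  - by rewrite [y == v]lt_eqF ?orbT //; lra.
  - by rewrite [y == v]gt_eqF ?orbT //; lra.
have hside a' b' : a <= a' -> b' <= b -> forall x, a' <= x <= b' ->
    ccont_at phi (x +i* c) /\ ccont_at phi (x +i* d).
  by move=> aa bb x xab; split; apply: pc; lra.
have vside c' d' : c <= c' -> d' <= d -> forall y, c' <= y <= d' ->
    ccont_at phi ((u - e) +i* y) /\ ccont_at phi ((u + e) +i* y).
  by move=> cc dd y ycd; split; apply: pc; lra.
have E1 : rect_int phi a b c d = rect_int phi a (u - e) c d + rect_int phi (u - e) b c d.
  by apply: rect_int_vcut; [lra|lra|apply: hside; lra].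
have E2 : rect_int phi (u - e) b c d =
    rect_int phi (u - e) (u + e) c d + rect_int phi (u + e) b c d.
  by apply: rect_int_vcut; [lra|lra|apply: hside; lra].
have E3 : rect_int phi (u - e) (u + e) c d =
    rect_int phi (u - e) (u + e) c (v - e) + rect_int phi (u - e) (u + e) (v - e) d.
  by apply: rect_int_hcut; [lra|lra|apply: vside; lra].
have E4 : rect_int phi (u - e) (u + e) (v - e) d =
    rect_int phi (u - e) (u + e) (v - e) (v + e) + rect_int phi (u - e) (u + e) (v + e) d.
  by apply: rect_int_hcut; [lra|lra|apply: vside; lra].
have Z1 : rect_int phi a (u - e) c d = 0 by apply: G; lra.
have Z2 : rect_int phi (u + e) b c d = 0 by apply: G; lra.
have Z3 : rect_int phi (u - e) (u + e) c (v - e) = 0 by apply: G; lra.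
have Z4 : rect_int phi (u - e) (u + e) (v + e) d = 0 by apply: G; lra.
by rewrite E1 E2 E3 E4 Z1 Z2 Z3 Z4 add0r !addr0 add0r.
Qed.

Lemma seg_cont_poisson e u a b : 0 < e ->
  seg_cont (fun x => 2 * e / ((x - u) ^+ 2 + e ^+ 2)) a b.
Proof.
move=> e0 x _; apply: continuousM; first exact: cst_continuous.
apply: continuousV; first by rewrite gt_eqF // ltr_wpDl ?sqr_ge0 // exprn_gt0.
apply: continuousD; last exact: cst_continuous.
have c1 : {for x, continuous (fun x : R => x - u)}.
  by apply: continuousB; [exact: cvg_id|exact: cst_continuous].
rewrite (_ : (fun x : R => (x - u) ^+ 2) = fun x => (x - u) * (x - u)).
  exact: (continuousM c1 c1).
by apply/funext => t; rewrite expr2.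
Qed.

(** The primitive is 2 atan((x - u)/e), with values pi/2 and -pi/2 at the ends. *)
Lemma Rintegral_atan e u : 0 < e ->
  \int[mu]_(x in `[u - e, u + e]) (2 * e / ((x - u) ^+ 2 + e ^+ 2)) = pi.
Proof.
move=> e0; have en : e != 0 by rewrite gt_eqF.
have dn x : (x - u) ^+ 2 + e ^+ 2 != 0.
  by rewrite gt_eqF // ltr_wpDl ?sqr_ge0 // exprn_gt0.
pose A x : R := e^-1 * (x - u).
have dA x : is_derive x 1 A e^-1.
  rewrite (_ : A = e^-1 \*: (id - cst u)).
    by apply: is_derive_eq; rewrite subr0 [_ *: 1]mulr1.
  by apply/funext.
pose F x : R := 2 * atan (A x).
have dF x : is_derive x 1 F (2 * e / ((x - u) ^+ 2 + e ^+ 2)).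
  rewrite (_ : F = 2 \*: (atan \o A)); last by apply/funext.
  have D := is_derive1_comp (is_derive1_atan (A x)) (dA x).
  apply: (is_derive_eq (@is_deriveZ _ _ _ (atan \o A) 2 x 1 _ D)).
  have dn' : 1 + (A x) ^+ 2 != 0 by rewrite gt_eqF // ltr_pwDl ?sqr_ge0.
  suff E : 2 * ((1 + A x ^+ 2)^-1 * e^-1) = 2 * e / ((x - u) ^+ 2 + e ^+ 2) by [].
  apply: (mulIf (dn x)); rewrite divfK //; apply: (mulfI dn'); apply: (mulfI en).
  rewrite [LHS](_ : _ = 2 * ((x - u) ^+ 2 + e ^+ 2)); last by field; rewrite en dn'.
  by rewrite /A; field.
have cf := @seg_cont_poisson e u (u - e) (u + e) e0.
rewrite (Rintegral_FTC2 _ cf (fun x _ => dF x)); last by lra.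
have -> : F (u + e) = pi / 2.
  by rewrite /F /A addrAC subrr add0r mulVf // atan1; field.
have -> : F (u - e) = - (pi / 2).
  by rewrite /F /A addrAC subrr add0r mulrN mulVf // atanN atan1; field.
by field.
Qed.

Lemma derivable_inv w z : z != w ->
  derivable ((fun s => (s - w)^-1) : C^o -> C^o) z 1.
Proof.
move=> zw; apply: (@derivableV _ _ (fun s : C^o => s - w : C)); first by rewrite subr_eq0.
by apply: derivableB; [exact: derivable_id|exact: derivable_cst].
Qed.

(** On a square centred at the pole, subtracting opposite sides cancels the odd part of the
    integrand and leaves the even kernel of [Rintegral_atan]. Each of the two pairs contributes i
    pi. *)
Lemma rect_int_inv u v e : 0 < e ->
  rect_int (fun z => (z - (u +i* v))^-1) (u - e) (u + e) (v - e) (v + e) = twopii R.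
Proof.
move=> e0; have en : e != 0 by rewrite gt_eqF.
have dn (t : R) : t ^+ 2 + e ^+ 2 != 0.
  by rewrite gt_eqF // ltr_wpDl ?sqr_ge0 // exprn_gt0.
set phi := fun _ => _.
have pc x y : (x != u) || (y != v) -> ccont_at phi (x +i* y).
  move=> xy; have [|D] := derivable_cdiff (@derivable_inv (u +i* v) (x +i* y) _).
    by rewrite eq_complex negb_and.
  exact: cdiff_ccont.
have comb (g h : R -> C) a b : cseg_cont g a b -> cseg_cont h a b ->
    cint g a b - cint h a b = cint (fun t => g t - h t) a b.
  move=> gc hc; rewrite -mulN1r -cint_lin //; apply: cint_eq => x _.
  by rewrite mulN1r.
pose k x0 x := 2 * e / ((x - x0) ^+ 2 + e ^+ 2).
have kc x0 : cseg_cont (fun x => (k x0 x)%:C) (x0 - e) (x0 + e).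
  by split; [exact: seg_cont_poisson|move=> x _; exact: cst_continuous].
have zk (x0 : R) (A : C) : cint (fun x => A * (k x0 x)%:C) (x0 - e) (x0 + e) = A * pi%:C.
  have x0e : x0 - e <= x0 + e by lra.
  have c0 : cseg_cont (fun=> 0 : C) (x0 - e) (x0 + e).
    by split=> x _; exact: cst_continuous.
  have := cint_lin A c0 (kc x0); under eq_fun do rewrite add0r.
  have -> : cint (fun=> 0 : C) (x0 - e) (x0 + e) = 0.
    rewrite -[RHS](mul0r ((x0 + e - (x0 - e))%:C)) -[RHS]addr0.
    rewrite -[X in _ = _ + X](mul0r (((x0 + e) ^+ 2 - (x0 - e) ^+ 2) / 2)%:C).
    by rewrite -cint_affine //; apply: cint_eq => x _; rewrite mul0r addr0.
  rewrite add0r => ->; congr (_ * _); apply: complexP; first exact: Rintegral_atan.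
  by rewrite [LHS](_ : _ = \int[mu]_(x in `[x0 - e, x0 + e]) 0) // Rintegral_cst // mul0r.
have invE (p q : R) : q != 0 -> (p +i* q)^-1 = (p / (p ^+ 2 + q ^+ 2)) +i* (- q / (p ^+ 2 + q ^+ 2)).
  by move=> q0; apply: complexP => //=; rewrite mulNr.
have d0 x y : (x +i* y) - (u +i* v) = (x - u) +i* (y - v).
  by apply: complexP; rewrite ?(ReD, ReN, ImD, ImN).
have hc y : y != v -> cseg_cont (fun x => phi (x +i* y)) (u - e) (u + e).
  by move=> yv; apply: hseg_cont => x _; apply: pc; rewrite yv orbT.
have vc x : x != u -> cseg_cont (fun y => phi (x +i* y)) (v - e) (v + e).
  by move=> xu; apply: vseg_cont => y _; apply: pc; rewrite xu.
have Hd : cint (fun x => phi (x +i* (v - e))) (u - e) (u + e) -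
    cint (fun x => phi (x +i* (v + e))) (u - e) (u + e) = 'i%C * pi%:C.
  rewrite comb; [|by apply: hc; lra|by apply: hc; lra].
  rewrite -(zk u); apply: cint_eq => x _; rewrite /phi !d0.
  have -> : v - e - v = - e by ring.
  have -> : v + e - v = e by ring.
  apply: complexP; rewrite ?(ReD, ReN, ImD, ImN, ReM, ImM) /= /k ?sqrrN.
    by ring.
  by field; exact: dn.
have Vd : cint (fun y => phi ((u + e) +i* y)) (v - e) (v + e) -
    cint (fun y => phi ((u - e) +i* y)) (v - e) (v + e) = 1 * pi%:C.
  rewrite comb; [|by apply: vc; lra|by apply: vc; lra].
  rewrite -(zk v); apply: cint_eq => y _; rewrite /phi !d0.
  have -> : u - e - u = - e by ring.
  have -> : u + e - u = e by ring.
  apply: complexP; rewrite ?(ReD, ReN, ImD, ImN, ReM, ImM) /= /k ?sqrrN.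
    by field; exact: dn.
  by ring.
rewrite /rect_int.
have -> (A B D E : C) : A + 'i%C * B - D - 'i%C * E = (A - D) + 'i%C * (B - E) by ring.
rewrite Hd Vd /twopii; apply: complexP; rewrite ?(ReD, ImD, ReM, ImM) /=; ring.
Qed.

(** f(z)/(z - w) is split into (f(z) - f(w))/(z - w) and f(w)/(z - w). The first quotient is bounded
    near w, and its integral does not change when the rectangle shrinks to w, so it is 0. *)
Lemma Cauchy_rect f a b c d u v : a < u < b -> c < v < d ->
  (forall x y, a <= x <= b -> c <= y <= d ->
     derivable (f : C^o -> C^o) (x +i* y) 1) ->
  rect_int (fun z => f z / (z - (u +i* v))) a b c d = f (u +i* v) * twopii R.
Proof.
move=> /andP[au ub] /andP[cv vd] fd; set w := u +i* v.
pose e0 := Num.min (Num.min (u - a) (b - u)) (Num.min (v - c) (d - v)).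
have e00 : 0 < e0 by rewrite !lt_min; lra.
have shrink phi e : 0 < e -> e < e0 ->
    (forall x y, a <= x <= b -> c <= y <= d -> x +i* y != u +i* v ->
     derivable (phi : C^o -> C^o) (x +i* y) 1) ->
    rect_int phi a b c d = rect_int phi (u - e) (u + e) (v - e) (v + e).
  move=> ep; rewrite !lt_min => /andP[/andP[? ?] /andP[? ?]] pd.
  apply: rect_int_shrink => //; try lra.
  by move=> x y xab ycd xy; apply: derivable_cdiff; exact: pd.
have neq x y : (x != u) || (y != v) -> x +i* y != w by rewrite eq_complex negb_and.
have e20 : 0 < e0 / 2 by rewrite divr_gt0.
have e2e : e0 / 2 < e0 by lra.
have bdc phi : (forall x y, a <= x <= b -> c <= y <= d -> x +i* y != u +i* v ->
     derivable (phi : C^o -> C^o) (x +i* y) 1) -> forall a' b' c' d',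
     a <= a' -> a' < u -> u < b' -> b' <= b -> c <= c' -> c' < v -> v < d' -> d' <= d ->
     rect_bd_cont phi a' b' c' d'.
  move=> pd a' b' c' d' ? ? ? ? ? ? ? ?.
  have pc x y : a <= x <= b -> c <= y <= d -> (x != u) || (y != v) -> ccont_at phi (x +i* y).
    move=> xab ycd /neq xy; have [D] := derivable_cdiff (pd x y xab ycd xy).
    exact: cdiff_ccont.
  by split=> t tab; split; apply: pc; lra.
have invd x y : a <= x <= b -> c <= y <= d -> x +i* y != u +i* v ->
    derivable ((fun z => (z - w)^-1) : C^o -> C^o) (x +i* y) 1.
  by move=> _ _; exact: derivable_inv.
pose phi z := (f z - f w) * (z - w)^-1.
have phid x y : a <= x <= b -> c <= y <= d -> x +i* y != u +i* v ->
    derivable (phi : C^o -> C^o) (x +i* y) 1.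
  move=> xab ycd xy; apply: (@derivableM _ _ (fun z : C^o => f z - f w : C^o)).
    by apply: derivableB; [exact: fd|exact: derivable_cst].
  exact: invd.
have -> : rect_int (fun z => f z / (z - w)) a b c d =
    rect_int phi a b c d + f w * rect_int (fun z => (z - w)^-1) a b c d.
  rewrite -rect_int_lin; [|by apply: bdc => //; lra|by apply: bdc => //; lra].
  by apply: rect_int_eq => t tab; split; rewrite /phi; ring.
rewrite (shrink _ _ e20 e2e invd) rect_int_inv // (_ : rect_int phi a b c d = 0) ?add0r //.
have [D fD] : exists D, cdiff_at f w D by apply: derivable_cdiff; apply: fd; lra.
have [s s0 Hs] := fD _ (@ltr01 R).
have phiM z : z != w -> normc (z - w) < s -> normc (phi z) <= 1 + normc D.
  move=> zw /Hs; rewrite mul1r => H.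
  have z0 : 0 < normc (z - w).
    rewrite lt_def normc_ge0 andbT; apply: contra zw => /eqP/eq0_normc/eqP.
    by rewrite subr_eq0.
  rewrite /phi normcM normcV ler_pdivrMr // -[f z - f w](subrK (D * (z - w))).
  apply: le_trans (normcD _ _) _; rewrite normcM mulrDl mul1r.
  by rewrite lerD2r.
set M := 1 + normc D in phiM; have M0 : 0 < M by rewrite ltr_pwDl // normc_ge0.
apply: eq0_normc; apply/eqP; rewrite eq_le normc_ge0 andbT.
apply/ler_addgt0Pr => t t0; rewrite add0r.
(* e <= s/4 keeps the square within distance s of w. The square has half-perimeter 4e, so
   [rect_int_le] gives 16 M e, which is at most t. *)
pose e := Num.min (e0 / 2) (Num.min (s / 4) (t / (16 * M))).
have ep : 0 < e by rewrite !lt_min e20 !divr_gt0 ?mulr_gt0.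
have [ee0 es et] : [/\ e < e0, e <= s / 4 & e <= t / (16 * M)].
  split; first by rewrite (le_lt_trans _ e2e) // ge_min lexx.
    by rewrite !ge_min lexx orbT.
  by rewrite !ge_min lexx !orbT.
rewrite (shrink _ _ ep ee0 phid).
move: ee0; rewrite !lt_min => /andP[/andP[? ?] /andP[? ?]].
have dist x y : u - e <= x <= u + e -> v - e <= y <= v + e -> normc ((x +i* y) - w) < s.
  move=> xu yv; apply: le_lt_trans (normc_le _) _; rewrite ReD ImD ReN ImN /=.
  have [? ?] : `|x - u| <= e /\ `|y - v| <= e by rewrite !ler_norml; split; lra.
  lra.
apply: le_trans (@rect_int_le _ phi (u - e) (u + e) (v - e) (v + e) M _ _ _ _ _) _.
- lra.
- lra.
- by apply: bdc => //; lra.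
- by move=> x xab; split; apply: phiM; [apply: neq; lra|apply: dist; lra|apply: neq; lra|apply: dist; lra].
- by move=> x xab; split; apply: phiM; [apply: neq; lra|apply: dist; lra|apply: neq; lra|apply: dist; lra].
move: et; rewrite ler_pdivlMr ?mulr_gt0 //; lra.
Qed.

End CauchyRectangle.

(** * A Cauchy cycle on a grid *)

Section GridHelpers.
Variable R : realType.
Local Notation C := R[i].
Local Notation V := 'rV[R]_2.
Implicit Types (p q : V) (f phi : C -> C).

Lemma seq_uniform_pos (I : eqType) (s : seq I) (Q : I -> R -> Prop) :
  (forall i d d', Q i d -> d' <= d -> Q i d') ->
  (forall i, i \in s -> exists2 d, 0 < d & Q i d) ->
  exists2 d, 0 < d & forall i, i \in s -> Q i d.
Proof.
move=> Qle; elim: s => [|i s IH] H; first by exists 1.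
have [|d d0 Hd] := IH; first by move=> j js; apply: H; rewrite inE js orbT.
have [e e0 He] := H i (mem_head _ _).
exists (Num.min d e); first by rewrite lt_min d0.
move=> j; rewrite inE => /predU1P[->|/Hd Hj].
  by apply: Qle He _; rewrite ge_min lexx orbT.
by apply: Qle Hj _; rewrite ge_min lexx.
Qed.

(** A Lebesgue number: balls of half the admissible radius cover K, and the smallest half radius is
    the margin. *)
Lemma compact_in_open_margin (K U : set V) : compact K -> open U -> K `<=` U ->
  exists2 d, 0 < d & forall p q, K p -> enorm (q - p) < d -> U q.
Proof.
move=> cK oU KU.
have /choice[r Hr] a : exists r, K a -> 0 < r /\ forall q, enorm (q - a) < 2 * r -> U q.
  have [Ka|] := pselect (K a); last by exists 0.
  have /nbhs_enormP[e e0 He] : nbhs a U by apply: open_nbhs_nbhs; split=> //; exact: KU.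
  by exists (e / 2) => _; split; [rewrite divr_gt0|rewrite mulrC divfK].
have [s [sK Ks]] := enorm_cover cK (fun a Ka => (Hr a Ka).1).
have [|a as_|d d0 Hd] := @seq_uniform_pos _ s (fun a d => d <= r a).
- by move=> a d d' dr d'd; exact: le_trans dr.
- by exists (r a) => //; have [] := Hr a (sK a as_).
exists d => // p q Kp qp; have [a as_ pa] := Ks p Kp.
have [_] := Hr a (sK a as_); apply.
apply: le_lt_trans (enorm_triangle q p a) _; rewrite mulr_natl mulr2n.
by rewrite ltrD // (lt_le_trans qp) // Hd.
Qed.

Lemma cseg_bounded (g : R -> C) a b : cseg_cont g a b ->
  exists M, forall t, a <= t <= b -> normc (g t) <= M.
Proof.
have bound (f : R -> R) : seg_cont f a b -> exists M, forall t, a <= t <= b -> `|f t| <= M.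
  move=> fc; have cf : {within `[a, b], continuous f}.
    by apply: continuous_in_subspaceT => x; rewrite inE /= in_itv /=; exact: fc.
  have [M [_ HM]] := compact_bounded (continuous_compact cf (@segment_compact _ a b)).
  exists (M + 1) => t tab; apply: HM; first by rewrite ltrDl.
  by exists t => //=; rewrite in_itv.
move=> [/bound[M1 H1] /bound[M2 H2]]; exists (M1 + M2) => t tab.
by apply: le_trans (normc_le _) (lerD _ _); [exact: H1|exact: H2].
Qed.

Definition plane_pt (x y : R) : V := \row_j (if j == 0 then x else y).

Lemma toC_plane_pt x y : toC (plane_pt x y) = (x +i* y)%C.
Proof. by rewrite /toC !mxE. Qed.

Definition edge_pt (h : bool) (x t : R) := if h then plane_pt t x else plane_pt x t.

Lemma edge_pt_lip h x s t : normc (toC (edge_pt h x s) - toC (edge_pt h x t)) <= 1 * `|s - t|.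
Proof.
rewrite mul1r; apply: le_trans (normc_le _) _; rewrite ReD ImD ReN ImN.
by case: h; rewrite !toC_plane_pt /= subrr normr0 ?addr0 ?add0r.
Qed.

(* An edge (c, h, x, a, b) is a segment parametrized by [a, b], horizontal at
   height x if h holds and vertical at abscissa x otherwise, with weight c. *)
Definition edge_int (phi : C -> C) (e : C * bool * R * R * R) : C :=
  let: (c, h, x, a, b) := e in c * cint (fun t => phi (toC (edge_pt h x t))) a b.

Definition on_edge (e : C * bool * R * R * R) p : Prop :=
  let: (c, h, x, a, b) := e in exists2 t, a <= t <= b & p = edge_pt h x t.

Lemma edge_cseg (phi : C -> C) c h x a b :
  (forall p, on_edge (c, h, x, a, b) p -> ccont_at phi (toC p)) ->
  cseg_cont (fun t => phi (toC (edge_pt h x t))) a b.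
Proof.
move=> pc; apply: (@cseg_cont_comp _ phi (fun t => toC (edge_pt h x t)) a b 1).
  exact: edge_pt_lip.
by move=> t tab; apply: pc; exists t.
Qed.

Lemma ccont_bounded_edge (phi : C -> C) e :
  (forall p, on_edge e p -> ccont_at phi (toC p)) ->
  exists M, forall p, on_edge e p -> normc (phi (toC p)) <= M.
Proof.
move: e => [[[[c h] x] a] b] pc; have [M HM] := cseg_bounded (edge_cseg pc).
by exists M => p [t tab ->]; exact: HM.
Qed.

Lemma ccont_inv (w z : C) : z != w -> ccont_at (fun s => (s - w)^-1) z.
Proof.
by move=> zw; have [D] := derivable_cdiff (derivable_inv zw); exact: cdiff_ccont.
Qed.

(** The function 1/(s - w) is continuous along the edge, hence bounded there; the reciprocal of a
    bound is a distance. *)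
Lemma edge_dist e (w : V) : (forall p, on_edge e p -> p != w) ->
  exists2 d, 0 < d & forall p, on_edge e p -> d <= enorm (p - w).
Proof.
move=> ew; have [p ep|M HM] := @ccont_bounded_edge (fun s => (s - toC w)^-1) e.
  by apply: ccont_inv; rewrite (inj_eq (@toC_inj R)) ew.
exists (`|M| + 1)^-1; first by rewrite invr_gt0 ltr_wpDl.
move=> p ep; rewrite enorm_toC -[leRHS]invrK lef_pV2 ?posrE ?ltr_wpDl //.
  by rewrite -normcV (le_trans (HM p ep)) // (le_trans (ler_norm M)) // lerDl.
rewrite invr_gt0 -enorm_toC lt_def enorm_ge0 andbT.
by apply: contra (ew p ep) => /eqP/enorm_eq0/eqP; rewrite subr_eq0.
Qed.

Lemma cdiff_quot f (w z : C) : derivable (f : C^o -> C^o) z 1 -> z != w ->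
  exists D, cdiff_at (fun s => f s / (s - w)) z D.
Proof.
move=> fd zw; apply: derivable_cdiff.
exact: (@derivableM _ _ (f : C^o -> C) (fun s => (s - w)^-1) z 1 fd (derivable_inv zw)).
Qed.

(** Needed to extend Cauchy's formula for the cycle to points on the grid lines, where no square has
    the point in its interior. *)
Lemma edge_int_cont f e (w : V) : (forall p, on_edge e p -> derivable (f : C^o -> C^o) (toC p) 1) ->
  (forall p, on_edge e p -> p != w) ->
  forall eps, 0 < eps -> exists2 d, 0 < d & forall w', enorm (w' - w) < d ->
    normc (edge_int (fun s => f s / (s - toC w')) e -
           edge_int (fun s => f s / (s - toC w)) e) < eps.
Proof.
move=> fd ew eps eps0; have [d d0 Hd] := edge_dist ew.
have [p ep|M HM] := @ccont_bounded_edge f e.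
  by have [D] := derivable_cdiff (fd p ep); exact: cdiff_ccont.
move: e fd ew Hd HM => [[[[c h] x] a] b] fd ew Hd HM.
have [ab|ba] := leP a b; last first.
  exists 1 => // w' _; rewrite /edge_int.
  have -> : cint (fun t => f (toC (edge_pt h x t)) / (toC (edge_pt h x t) - toC w')) a b =
      cint (fun t => f (toC (edge_pt h x t)) / (toC (edge_pt h x t) - toC w)) a b.
    by apply: cint_eq => t /andP[ta tb]; have := le_trans ta tb; rewrite leNgt ba.
  by rewrite subrr normc0.
(* A Lipschitz constant: the kernels differ by (w' - w)/((p - w')(p - w)), whose denominators are at
   least d/2 and d. The leading 2 comes from [cint_le]. *)
pose L := normc c * (2 * (`|M| * (2 / d ^+ 2)) * (b - a)).
have L0 : 0 <= L.
  apply: mulr_ge0; first exact: normc_ge0.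
  apply: mulr_ge0; last by rewrite subr_ge0.
  by do 2![apply: mulr_ge0 => //]; rewrite divr_ge0 // sqr_ge0.
exists (Num.min (d / 2) (eps / (L + 1))).
  by rewrite lt_min !divr_gt0 // ltr_wpDl.
move=> w'; rewrite lt_min => /andP[w'd w'e].
have far p : on_edge (c, h, x, a, b) p -> d / 2 <= enorm (p - w').
  move=> ep; have := Hd p ep; have := enorm_triangle p w' w; lra.
have ew' p : on_edge (c, h, x, a, b) p -> p != w'.
  move=> /far; apply: contraTN => /eqP ->; rewrite subrr enorm0 -ltNge.
  by rewrite divr_gt0.
have tne u p : p != u -> toC p != toC u :> C by rewrite (inj_eq (@toC_inj R)).
have c1 u : (forall p, on_edge (c, h, x, a, b) p -> p != u) ->
    cseg_cont (fun t => f (toC (edge_pt h x t)) / (toC (edge_pt h x t) - toC u)) a b.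
  move=> eu; apply: (@edge_cseg (fun s => f s / (s - toC u)) c) => p ep.
  by have [D] := cdiff_quot (fd p ep) (tne _ _ (eu p ep)); exact: cdiff_ccont.
have sub (u v : C) : c * u - c * v = c * (u + -1 * v) by ring.
rewrite /edge_int sub -cint_lin; [|exact: c1|exact: c1].
set I := cint _ _ _; have : normc I <= 2 * (`|M| * (2 / d ^+ 2) * enorm (w' - w)) * (b - a).
  apply: cint_le => //; first by apply: cseg_cont_lin; exact: c1.
  move=> t tab; set p := edge_pt h x t.
  have ep : on_edge (c, h, x, a, b) p by exists t.
  have n1 : toC p - toC w' != 0 by rewrite subr_eq0 tne // ew'.
  have n2 : toC p - toC w != 0 by rewrite subr_eq0 tne // ew.
  have -> : f (toC p) / (toC p - toC w') + -1 * (f (toC p) / (toC p - toC w)) =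
      f (toC p) * ((toC w' - toC w) / ((toC p - toC w') * (toC p - toC w))).
    by field; rewrite n1 n2.
  rewrite !normcM normcV normcM -!enorm_toC -mulrA ler_pM //.
  - exact: normc_ge0.
  - by rewrite mulr_ge0 ?enorm_ge0 // invr_ge0 mulr_ge0 ?enorm_ge0.
  - by rewrite (le_trans (HM p ep)) // ler_norm.
  rewrite mulrC ler_wpM2r ?enorm_ge0 //.
  have -> : 2 / d ^+ 2 = (d / 2 * d)^-1 by field; rewrite gt_eqF.
  have P1 : 0 < d / 2 by rewrite divr_gt0.
  have P2 := far p ep; have P3 := Hd p ep.
  rewrite lef_pV2 ?posrE ?mulr_gt0 ?(lt_le_trans P1 P2) ?(lt_le_trans d0 P3) //.
  by rewrite ler_pM // ltW.
move=> IM; rewrite normcM; apply: (@le_lt_trans _ _ (L * enorm (w' - w))).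
  apply: le_trans (ler_wpM2l (normc_ge0 c) IM) _; rewrite /L.
  by rewrite le_eqVlt; apply/orP; left; apply/eqP; ring.
move: w'e; rewrite ltr_pdivlMr ?ltr_wpDl // => H; apply: le_lt_trans H.
by rewrite mulrC ler_wpM2l ?enorm_ge0 // lerDl.
Qed.

End GridHelpers.

Section CauchyCycle.
Variable R : realType.
Local Notation C := R[i].
Local Notation V := 'rV[R]_2.
Implicit Types (p q w : V) (phi : C -> C) (x y : R) (i j : nat).

Lemma compact_coord_bound (K : set V) : compact K ->
  exists2 B : R, 0 < B & forall p k, K p -> `|p 0 k| < B.
Proof.
move=> cK; have [s [sK Ks]] := @enorm_cover R 2 K (fun=> 1) cK (fun _ _ => ltr01).
have S0 : 0 <= \sum_(a <- s) enorm a by apply: sumr_ge0 => a _; exact: enorm_ge0.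
exists (1 + \sum_(a <- s) enorm a); first by rewrite ltr_pwDl.
move=> p k Kp; have [a as_ pa] := Ks p Kp.
apply: le_lt_trans (coord_le_enorm p k) _.
have := enorm_triangle p a 0; rewrite !subr0 => H; apply: le_lt_trans H _.
apply: ltr_leD pa _; rewrite (big_rem a) //= lerDl.
by apply: sumr_ge0 => b _; exact: enorm_ge0.
Qed.

Section Grid.
Variables (K U : set V) (f : C -> C) (B h d : R) (N : nat).
Hypotheses (KB : forall p k, K p -> `|p 0 k| < B) (h0 : 0 < h)
  (hd : 4 * h <= d) (Kd : forall p q, K p -> enorm (q - p) < d -> U q)
  (fU : forall p, U p -> derivable (f : C^o -> C^o) (toC p) 1).

Let X i : R := - B + i%:R * h.
Hypothesis XN : B <= X N.

Let XS i : X i.+1 = X i + h.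
Proof. by rewrite /X -natr1 mulrDl mul1r addrA. Qed.

Let X_le i j : (i <= j)%N -> X i <= X j.
Proof. by move=> ij; rewrite lerD2l ler_wpM2r ?ler_nat // ltW. Qed.

Let in_sq i j p : Prop := X i <= p 0 0 <= X i.+1 /\ X j <= p 0 1 <= X j.+1.

(** Closed squares and closed edges are tested against K: an edge that meets K then has all the
    squares next to it selected. *)
Let sq i j := `[< exists2 p, K p & in_sq i j p >].
Let vm i j := `[< exists2 p, K p & p 0 0 = X i /\ X j <= p 0 1 <= X j.+1 >].
Let hm i j := `[< exists2 p, K p & p 0 1 = X j /\ X i <= p 0 0 <= X i.+1 >].

Let hm_sq i j : (hm i j -> sq i j) /\ (hm i j.+1 -> sq i j).
Proof.
split=> /asboolP[p Kp [pE pi]]; apply/asboolP; exists p => //; split=> //.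
  by rewrite pE lexx X_le.
by rewrite pE lexx X_le.
Qed.

Let vm_sq i j : (vm i j -> sq i j) /\ (vm i.+1 j -> sq i j).
Proof.
split=> /asboolP[p Kp [pE pi]]; apply/asboolP; exists p => //; split=> //.
  by rewrite pE lexx X_le.
by rewrite pE lexx X_le.
Qed.

(** K lies strictly inside the grid, so the telescoping sums over dropped edges have zero end
    terms. *)
Let hm_bd i : hm i 0 = false /\ hm i N = false.
Proof.
split; apply/negbTE/negP => /asboolP[p Kp [pE _]]; have := KB 1 Kp;
  rewrite ltr_norml pE; have := XN; rewrite /X; lra.
Qed.

Let vm_bd j : vm 0 j = false /\ vm N j = false.
Proof.
split; apply/negbTE/negP => /asboolP[p Kp [pE _]]; have := KB 0 Kp;
  rewrite ltr_norml pE; have := XN; rewrite /X; lra.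
Qed.

Let edge_t := (C * bool * R * R * R)%type.
Let he i j (c : C) : edge_t := (c, true, X j, X i, X i.+1).
Let ve i j (c : C) : edge_t := (c, false, X i, X j, X j.+1).
Let opt (b : bool) (e : edge_t) : seq edge_t := if b then [::] else [:: e].

Let cell i j : seq edge_t := if sq i j then
  opt (hm i j) (he i j 1) ++ opt (vm i.+1 j) (ve i.+1 j 'i%C) ++
  opt (hm i j.+1) (he i j.+1 (-1)) ++ opt (vm i j) (ve i j (- 'i%C)) else [::].

(* The boundaries of the squares meeting K, without the edges meeting K: such an
   edge lies on two selected squares, with opposite orientations. *)
Definition grid_cycle : seq edge_t :=
  flatten [seq cell i j | i <- index_iota 0 N, j <- index_iota 0 N].

Let rect phi i j := rect_int phi (X i) (X i.+1) (X j) (X j.+1).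

(** Dropping the edges that meet K changes the integral around a square by corrections with opposite
    signs on opposite sides, written as differences ready to telescope. An unselected square has no
    edge meeting K, so the formula also holds there. *)
Let cell_sum phi i j :
  let hmH i j := if hm i j then cint (fun x => phi (x +i* X j)%C) (X i) (X i.+1) else 0 in
  let vmV i j := if vm i j then cint (fun y => phi (X i +i* y)%C) (X j) (X j.+1) else 0 in
  \sum_(e <- cell i j) edge_int phi e =
  (if sq i j then rect phi i j else 0) + (hmH i j.+1 - hmH i j) -
  'i%C * (vmV i.+1 j - vmV i j).
Proof.
move=> hmH vmV.
have optE b e : \sum_(e <- opt b e) edge_int phi e = if b then 0 else edge_int phi e.
  by case: b; rewrite ?big_nil ?big_seq1.
have heE k l c : edge_int phi (he k l c) = c * cint (fun x => phi (x +i* X l)%C) (X k) (X k.+1).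
  by congr (_ * _); apply: cint_eq => t _; rewrite toC_plane_pt.
have veE k l c : edge_int phi (ve k l c) = c * cint (fun y => phi (X k +i* y)%C) (X l) (X l.+1).
  by congr (_ * _); apply: cint_eq => t _; rewrite toC_plane_pt.
have [[h1 h2] [v1 v2]] := (hm_sq i j, vm_sq i j).
rewrite /cell /hmH /vmV; case E : (sq i j); last first.
  have -> : hm i j = false by apply/negP => /h1; rewrite E.
  have -> : hm i j.+1 = false by apply/negP => /h2; rewrite E.
  have -> : vm i j = false by apply/negP => /v1; rewrite E.
  have -> : vm i.+1 j = false by apply/negP => /v2; rewrite E.
  by rewrite big_nil !subrr mulr0 subr0 addr0.
rewrite !big_cat /= !optE !heE !veE /rect /rect_int.
by case: (hm i j); case: (hm i j.+1); case: (vm i j); case: (vm i.+1 j); ring.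
Qed.

Lemma grid_cycle_sum phi : \sum_(e <- grid_cycle) edge_int phi e =
  \sum_(i <- index_iota 0 N) \sum_(j <- index_iota 0 N)
    if sq i j then rect phi i j else 0.
Proof.
rewrite big_flatten big_allpairs_dep /=.
pose hmH i j := if hm i j then cint (fun x => phi (x +i* X j)%C) (X i) (X i.+1) else 0.
pose vmV i j := if vm i j then cint (fun y => phi (X i +i* y)%C) (X j) (X j.+1) else 0.
have E : \sum_(i <- index_iota 0 N) \sum_(j <- index_iota 0 N) \sum_(e <- cell i j) edge_int phi e =
    \sum_(i <- index_iota 0 N) \sum_(j <- index_iota 0 N) (if sq i j then rect phi i j else 0)
    + \sum_(i <- index_iota 0 N) \sum_(j <- index_iota 0 N) (hmH i j.+1 - hmH i j)
    - 'i%C * \sum_(i <- index_iota 0 N) \sum_(j <- index_iota 0 N) (vmV i.+1 j - vmV i j).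
  rewrite mulr_sumr -big_split -sumrB; apply: eq_bigr => i _ /=.
  rewrite mulr_sumr -big_split -sumrB; apply: eq_bigr => j _ /=.
  exact: cell_sum.
rewrite E [X in _ + X - _]big1 => [|i _]; last first.
  rewrite (@telescope_sumr _ 0 N (hmH i)) // /hmH; have [-> ->] := hm_bd i; exact: subrr.
rewrite [X in _ * X]exchange_big /= [X in _ * X]big1 => [|j _]; last first.
  apply: etrans (@telescope_sumr _ 0 N (vmV^~ j) (leq0n N)) _.
  by rewrite /= /vmV; have [-> ->] := vm_bd j; exact: subrr.
by rewrite mulr0 subr0 addr0.
Qed.

(** Two points of a square differ by at most h in each coordinate, so their distance is at most 2h,
    which is below d. *)
Lemma sq_sub i j x y : sq i j -> X i <= x <= X i.+1 -> X j <= y <= X j.+1 ->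
  U (plane_pt x y).
Proof.
move=> /asboolP[p Kp [pi pj]] xi yj; apply: Kd Kp _.
rewrite enorm_toC; apply: le_lt_trans (normc_le _) _.
rewrite toC_plane_pt ReD ImD ReN ImN /=.
apply: (@le_lt_trans _ _ (h + h)); last by have := h0; have := hd; lra.
by move: pi pj xi yj; rewrite !XS => pi pj xi yj; rewrite lerD // ler_norml; lra.
Qed.

Lemma grid_cycle_off e p : e \in grid_cycle -> on_edge e p -> U p /\ ~ K p.
Proof.
move=> /flattenP[_ /allpairsP[[i j] [/= _ _ ->]]].
rewrite /cell; case E : (sq i j) => //; rewrite !mem_cat.
have mo b e' : e \in opt b e' -> ~~ b /\ e = e' by case: b => //; rewrite inE => /eqP ->.
have Xi : X i <= X i.+1 by exact: X_le.
have Xj : X j <= X j.+1 by exact: X_le.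
case/or4P => /mo[nb ->] [t tab ->]; split.
- by apply: (sq_sub E) => //; rewrite lexx.
- by move=> Kp; move/asboolPn: nb; apply; exists (plane_pt t (X j)); rewrite // !mxE.
- by apply: (sq_sub E) => //; rewrite lexx andbT.
- by move=> Kp; move/asboolPn: nb; apply; exists (plane_pt (X i.+1) t); rewrite // !mxE.
- by apply: (sq_sub E) => //; rewrite lexx andbT.
- by move=> Kp; move/asboolPn: nb; apply; exists (plane_pt t (X j.+1)); rewrite // !mxE.
- by apply: (sq_sub E) => //; rewrite lexx.
- by move=> Kp; move/asboolPn: nb; apply; exists (plane_pt (X i) t); rewrite // !mxE.
Qed.

Lemma grid_cell x : - B < x < B -> exists2 i, (i < N)%N & X i <= x < X i.+1.
Proof.
move=> /andP[Bx xB]; have t0 : 0 <= (x + B) / h by rewrite divr_ge0 ?(ltW h0) //; lra.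
have /andP[t1 t2] := truncn_itv t0.
exists (Num.truncn ((x + B) / h)).
  rewrite -(ltr_nat R); apply: le_lt_trans t1 _; rewrite ltr_pdivrMr //.
  by have := XN; rewrite /X; lra.
by move: t1 t2; rewrite ler_pdivlMr // ltr_pdivrMr // /X; lra.
Qed.

(** Only the square containing the point contributes, by [Cauchy_rect]; on every other selected
    square the quotient is holomorphic and Goursat's theorem applies. *)
Lemma grid_cycle_open i0 j0 x y : (i0 < N)%N -> (j0 < N)%N -> sq i0 j0 ->
  X i0 < x < X i0.+1 -> X j0 < y < X j0.+1 ->
  \sum_(e <- grid_cycle) edge_int (fun z => f z / (z - (x +i* y)%C)) e =
  f (x +i* y)%C * twopii R.
Proof.
move=> i0N j0N sq0 xi yj; rewrite grid_cycle_sum.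
have reg i j x' y' : sq i j -> X i <= x' <= X i.+1 -> X j <= y' <= X j.+1 ->
    derivable (f : C^o -> C^o) (x' +i* y')%C 1.
  by move=> s xi' yj'; rewrite -toC_plane_pt; apply: fU; exact: (sq_sub s).
have other i j : (i != i0) || (j != j0) -> sq i j ->
    rect (fun z => f z / (z - (x +i* y)%C)) i j = 0.
  move=> ij s; apply: Goursat; [exact: X_le|exact: X_le|].
  move=> x' y' xi' yj'; apply: cdiff_quot; first exact: (reg i j).
  rewrite eq_complex negb_and /=; move: ij => /orP[|].
    rewrite neq_ltn => /orP[/X_le H|/X_le H]; apply/orP; left.
      by rewrite lt_eqF //; lra.
    by rewrite gt_eqF //; lra.
  rewrite neq_ltn => /orP[/X_le H|/X_le H]; apply/orP; right.
    by rewrite lt_eqF //; lra.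
  by rewrite gt_eqF //; lra.
rewrite (bigD1_seq i0) ?iota_uniq ?mem_index_iota //= [X in _ + X]big1 ?addr0; last first.
  by move=> i ii0; rewrite big1 // => j _; case: ifP => // s; rewrite other // ii0.
rewrite (bigD1_seq j0) ?iota_uniq ?mem_index_iota //= [X in _ + X]big1 ?addr0; last first.
  by move=> j jj0; case: ifP => // s; rewrite other // jj0 orbT.
by rewrite sq0; apply: Cauchy_rect => // x' y'; exact: reg.
Qed.

(** A point of K may lie on a grid line. It is approached from the interior of a selected square,
    and both sides are continuous at w because the edges of the cycle avoid K. *)
Lemma grid_cycle_Cauchy w : K w ->
  f (toC w) * twopii R = \sum_(e <- grid_cycle) edge_int (fun z => f z / (z - toC w)) e.
Proof.
move=> Kw; have Uw : U w by apply: Kd Kw _; rewrite subrr enorm0; have := h0; have := hd; lra.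
have [i iN wi] : exists2 i, (i < N)%N & X i <= w 0 0 < X i.+1.
  by apply: grid_cell; have := KB 0 Kw; rewrite ltr_norml.
have [j jN wj] : exists2 j, (j < N)%N & X j <= w 0 1 < X j.+1.
  by apply: grid_cell; have := KB 1 Kw; rewrite ltr_norml.
have sq0 : sq i j by apply/asboolP; exists w => //; split; lra.
apply/eqP; rewrite -subr_eq0; apply/eqP/eq0_normc/eqP.
rewrite eq_le normc_ge0 andbT; apply/ler_addgt0Pr => e e0; rewrite add0r.
have e2 : 0 < e / 2 by rewrite divr_gt0.
have T0 : 0 < normc (twopii R) + 1 by rewrite ltr_wpDl ?normc_ge0.
have S0 : 0 < (size grid_cycle)%:R + 1 :> R by rewrite ltr_wpDl.
have [D /cdiff_ccont /(_ _ (divr_gt0 e2 T0))[d1 d10 Hd1]] := derivable_cdiff (fU Uw).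
have [|e' e's|d2 d20 Hd2] := @seq_uniform_pos R _ grid_cycle (fun e' d => forall w', enorm (w' - w) < d ->
    normc (edge_int (fun z => f z / (z - toC w')) e' -
           edge_int (fun z => f z / (z - toC w)) e') < e / 2 / ((size grid_cycle)%:R + 1)).
- by move=> e' d3 d4 H d43 w' w'd; apply: H; exact: lt_le_trans d43.
- apply: edge_int_cont; last by rewrite divr_gt0.
    by move=> p ep; apply: fU; case: (grid_cycle_off e's ep).
  by move=> p ep; have [_] := grid_cycle_off e's ep; apply: contra_not_neq => ->.
(* w is moved by t in both coordinates, which brings it strictly inside the square since the cell is
   half-open. The displacement is at most 2t, less than d1 and d2. *)
pose t := Num.min (Num.min d1 d2 / 4) (Num.min (X i.+1 - w 0 0) (X j.+1 - w 0 1) / 2).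
have t0 : 0 < t by rewrite !(lt_min, divr_gt0) //; rewrite ?lt_min ?d10 ?d20; lra.
have t1 : t <= Num.min d1 d2 / 4 by rewrite ge_min lexx.
have t2 : t <= Num.min (X i.+1 - w 0 0) (X j.+1 - w 0 1) / 2 by rewrite ge_min lexx orbT.
have : Num.min d1 d2 <= d1 by rewrite ge_min lexx.
have : Num.min d1 d2 <= d2 by rewrite ge_min lexx orbT.
have : Num.min (X i.+1 - w 0 0) (X j.+1 - w 0 1) <= X i.+1 - w 0 0 by rewrite ge_min lexx.
have : Num.min (X i.+1 - w 0 0) (X j.+1 - w 0 1) <= X j.+1 - w 0 1 by rewrite ge_min lexx orbT.
move: t1 t2; set m1 := Num.min d1 d2; set m2 := Num.min _ _ => t1 t2 m2j m2i m12 m11.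
pose w' := plane_pt (w 0 0 + t) (w 0 1 + t).
have w'w : enorm (w' - w) <= t + t.
  rewrite enorm_toC; apply: le_trans (normc_le _) _.
  rewrite toC_plane_pt ReD ImD ReN ImN /= !(addrAC _ t) !subrr !add0r.
  by rewrite ger0_norm // ltW.
have G' := @grid_cycle_open i j (w 0 0 + t) (w 0 1 + t) iN jN sq0.
rewrite -toC_plane_pt -/w' in G'.
have {}G' := G' ltac:(lra) ltac:(lra).
set G := \sum_(e <- _) _; set F' := f (toC w') * _ in G'.
have -> : f (toC w) * twopii R - G = (f (toC w) - f (toC w')) * twopii R + (F' - G).
  by rewrite /F'; ring.
apply: le_trans (normcD _ _) _; rewrite [e]splitr; apply: lerD.
  rewrite normcM -normcNE opprB.
  have /Hd1 : normc (toC w' - toC w) < d1 by rewrite -enorm_toC; lra.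
  rewrite ltr_pdivlMr // => /ltW; apply: le_trans.
  by rewrite ler_wpM2l ?normc_ge0 // lerDl.
rewrite -G' /G -sumrB.
have bound (s : seq edge_t) : {subset s <= grid_cycle} ->
    normc (\sum_(e <- s) (edge_int (fun z => f z / (z - toC w')) e -
      edge_int (fun z => f z / (z - toC w)) e)) <=
    (size s)%:R * (e / 2 / ((size grid_cycle)%:R + 1)).
  elim: s => [|a s IH] ss; first by rewrite big_nil normc0 mul0r.
  rewrite big_cons; apply: le_trans (normcD _ _) _.
  rewrite /= -add1n natrD mulrDl mul1r; apply: lerD.
    by apply/ltW/Hd2; [apply: ss; rewrite inE eqxx|lra].
  by apply: IH => b bs; apply: ss; rewrite inE bs orbT.
apply: le_trans (bound _ (fun _ => id)) _.
by rewrite mulrCA ler_piMr ?(ltW e2) // ler_pdivrMr // mul1r lerDl.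
Qed.

End Grid.

Lemma Cauchy_cycle (K U : set V) (f : C -> C) : compact K -> open U -> K `<=` U ->
  (forall p, U p -> derivable (f : C^o -> C^o) (toC p) 1) ->
  exists s : seq (C * bool * R * R * R),
    (forall e p, e \in s -> on_edge e p -> U p /\ ~ K p) /\
    forall w, K w -> f (toC w) * twopii R =
      \sum_(e <- s) edge_int (fun z => f z / (z - toC w)) e.
Proof.
move=> cK oU KU fU; have [B B0 KB] := compact_coord_bound cK.
have [d d0 Kd] := compact_in_open_margin cK oU KU.
have h0 : 0 < d / 4 by rewrite divr_gt0.
have hd : 4 * (d / 4) <= d by rewrite mulrC divfK.
pose N := (Num.truncn (2 * B / (d / 4))).+1.
have XN : B <= - B + N%:R * (d / 4).
  have := truncnS_gt (2 * B / (d / 4)); rewrite ltr_pdivrMr // -/N; lra.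
exists (grid_cycle K B (d / 4) N); split.
  by move=> e p; exact: (@grid_cycle_off K U B (d / 4) d N).
by move=> w; exact: (@grid_cycle_Cauchy K U f B (d / 4) d N).
Qed.

End CauchyCycle.

(** * Winding numbers *)

Lemma twopii_neq0 (R : realType) : twopii R != 0.
Proof. by rewrite eq_complex negb_and /= orbC mulf_neq0 ?pnatr_eq0 // gt_eqF // pi_gt0. Qed.

Section Winding.
Variables (R : realType) (r : nat) (J : dchain R 2 1 r).
Local Notation V := 'rV[R]_2.
Local Notation C := R[i].
Local Notation supp := (chain_supp J).
Implicit Types (p q z w a b : V) (rho : R).

Lemma chain_supp_closed : closed supp.
Proof. by apply: closed_bigI => X [cX _]. Qed.

(** Equal to 1/(p - z) from distance 2 rho on. All these functions are translates of the one at 0,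
    hence the bounds in [std_kern_cBd] do not depend on z. *)
Definition std_kern rho z : V -> C := kern (fun p => 1 - bump z rho p) z.

Section StdKern.
Variable rho : R.
Hypothesis rho0 : 0 < rho.

Lemma std_eta_smooth z : smooth (fun p => 1 - bump z rho p).
Proof. by move=> m; apply: of_class_CB; [exact: of_class_C_cst|exact: bump_smooth]. Qed.

Lemma std_eta0 z p : enorm (p - z) < rho -> 1 - bump z rho p = 0.
Proof. by move=> pz; rewrite bump1 ?subrr // ltW. Qed.

Lemma std_eta1 z p : 2 * rho <= enorm (p - z) -> 1 - bump z rho p = 1.
Proof. by move=> pz; rewrite bump0 ?subr0. Qed.

Lemma std_kernE z p : 2 * rho <= enorm (p - z) -> std_kern rho z p = (toC p - toC z)^-1.
Proof. by move=> pz; rewrite /std_kern /kern std_eta1 // mul1r. Qed.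

Lemma std_kern_shift z p : std_kern rho z p = std_kern rho 0 (p - z).
Proof.
have t0 : toC (0 : V) = 0 by apply: complexP; rewrite /= mxE.
by rewrite /std_kern /kern /bump !subr0 t0 subr0 toCB.
Qed.

Lemma std_kern_cBd m : exists M, forall z, cBd m M (std_kern rho z).
Proof.
have [M HM] := kern_cBd rho0 (std_eta_smooth 0) (std_eta0 (z := 0)) (std_eta1 (z := 0)) m.
exists M => z; have := cBd_shift (- z) HM; congr cBd; apply/funext => p.
by rewrite std_kern_shift.
Qed.

Lemma std_kern_smooth z : smooth (@complex.Re R \o std_kern rho z) /\
  smooth (@complex.Im R \o std_kern rho z).
Proof. exact: (kern_smooth rho0 (std_eta_smooth z) (std_eta0 (z := z))). Qed.

Lemma pole_cutoff_std z : (forall p, supp p -> 2 * rho < enorm (p - z)) ->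
  pole_cutoff supp z (fun p => 1 - bump z rho p).
Proof.
move=> zs; split; first exact: std_eta_smooth.
  apply: filterS (@std_eta0 z) _; apply: open_nbhs_nbhs; split; first exact: enorm_lt_open.
  by rewrite /= subrr enorm0.
exists (2 * rho); split; first by rewrite mulr_gt0.
  by apply/seteqP; split=> p // [/= pz /zs]; rewrite ltNge pz.
exact: std_eta1.
Qed.

Lemma dw_int_pole_cutoff eta z : (forall p, supp p -> 2 * rho < enorm (p - z)) ->
  pole_cutoff supp z eta -> dw_int J (kern eta z) = dw_int J (std_kern rho z).
Proof.
move=> zs [eta_s /nbhs_enormP[c c0 eta0] [e [e0 ez eta1]]].
have [M HM] := kern_cBd c0 eta_s eta0 eta1 r.
have [N HN] := std_kern_cBd r.
apply: (@dw_int_eq _ _ _ _ _ _ _ ([set p | e < enorm (p - z)] `&` [set p | 2 * rho < enorm (p - z)]) HM (HN z)).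
- by apply: openI; exact: enorm_gt_open.
- move=> p ps; split; last exact: zs.
  rewrite /= ltNge; apply/negP => pe.
  by have : ([set p | enorm (p - z) <= e] `&` supp) p by []; rewrite ez.
by move=> p [/= pe /ltW pr]; rewrite std_kernE // /kern eta1 ?mul1r // ltW.
Qed.

(** [Ind] uses an arbitrarily chosen cutoff. Any choice gives this integral by locality, and a
    choice exists because the cutoff of [std_kern] is admissible, so the default value 0 is never
    taken. *)
Lemma dw_int_std_kern z : (forall p, supp p -> 2 * rho < enorm (p - z)) ->
  dw_int J (std_kern rho z) = twopii R * Ind J z.
Proof.
move=> zs; have T0 := twopii_neq0 R.
rewrite /Ind mulVKf //; case: xgetP => [I _ [eta eta_c ->]|H].
  by rewrite -(dw_int_pole_cutoff zs eta_c).
by have := H (dw_int J (std_kern rho z)); case; exists (fun p => 1 - bump z rho p) => //; exact: pole_cutoff_std.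
Qed.

(** Near the support the form -K^2 dw is the differential of the kernel K, and J is closed. *)
Lemma dw_int_kern_sqr z : closed_chain J -> (forall p, supp p -> 2 * rho < enorm (p - z)) ->
  dw_int J (fun p => std_kern rho z p * std_kern rho z p) = 0.
Proof.
move=> Jc zs; have [M HM] := std_kern_cBd r.+1; have [N HN] := std_kern_cBd r.
have kk := cBdM (HN z) (HN z); have [kR kI] := std_kern_smooth z.
have E : dw_int J (fun p => -1 * (std_kern rho z p * std_kern rho z p)) = 0.
  apply: (@dw_int_exact _ _ _ _ _ _ _ [set p | 2 * rho < enorm (p - z)] Jc (HM z)
    (cBdZ (-1) kk) (@enorm_gt_open _ _ _ _) zs).
  - by move=> p i; have [_ /(_ i)[]] := kR 1.
  - by move=> p i; have [_ /(_ i)[]] := kI 1.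
  move=> p i pz; have pz' : p != z.
    apply: contraTN pz => /eqP ->; rewrite /= subrr enorm0 -leNgt.
    by rewrite mulr_ge0 // ltW.
  have [-> ->] := kern_pderive (std_eta1 (z := z)) i pz pz'.
  by rewrite -/(std_kern rho z p) !mulN1r ReN ImN opprK.
have := dw_int_lin J (-1) (cBd_cst r 0) kk.
have -> : (fun p => 0 + -1 * (std_kern rho z p * std_kern rho z p)) =
    fun p => -1 * (std_kern rho z p * std_kern rho z p).
  by apply/funext => p; rewrite add0r.
rewrite E (dw_cvg_int (@dw_cvg0 _ _ J)) add0r mulN1r => /eqP.
by rewrite eq_sym oppr_eq0 => /eqP.
Qed.

End StdKern.

Hypothesis Jc : closed_chain J.

Section LocallyConstant.
Variables (w0 : V) (rho : R).
Hypotheses (rho0 : 0 < rho) (far : forall p, supp p -> 4 * rho < enorm (p - w0)).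

Let F a := dw_int J (std_kern rho a).

Let away a p : enorm (a - w0) < rho -> 4 * rho < enorm (p - w0) -> 2 * rho < enorm (p - a).
Proof. by move=> aw pw; have := enorm_triangle p a w0; have := rho0; lra. Qed.

(* 1/(p-a) - 1/(p-b) = c/(p-b)^2 + c^2/((p-a)(p-b)^2) with c = a - b, and the
   first term is the derivative of a function. *)
Let quadratic : exists K, forall a b, enorm (a - w0) < rho -> enorm (b - w0) < rho ->
  normc (F a - F b) <= K * enorm (a - b) ^+ 2.
Proof.
have [N HN] := std_kern_cBd rho0 r; have [K K0 HK] := @dw_int_bound _ r J.
eexists => a b aw bw; set c := toC a - toC b.
have kk := cBdM (HN b) (HN b); have kkk := cBdM (HN a) kk.
have E : F a - F b = c * c * dw_int J (fun p => std_kern rho a p * (std_kern rho b p * std_kern rho b p)).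
  rewrite -mulN1r /F -(dw_int_lin J (-1) (HN a) (HN b)).
  have z : dw_int J (fun p => c * (std_kern rho b p * std_kern rho b p)) = 0.
    apply: dw_cvg_int; rewrite -(mulr0 c); apply: dw_cvgZ.
    rewrite -(dw_int_kern_sqr rho0 (z := b) Jc); first exact: cBd_dw_cvg kk.
    by move=> p /far; exact: away.
  rewrite -[RHS]add0r -z -(dw_int_lin J (c * c) (cBdZ c kk) kkk).
  apply: (@dw_int_eq _ _ _ _ _ _ _ [set p | 4 * rho < enorm (p - w0)]
    (cBdD (HN a) (cBdZ (-1) (HN b))) (cBdD (cBdZ c kk) (cBdZ (c * c) kkk))).
  - exact: enorm_gt_open.
  - exact: far.
  move=> p /= pw; have [pa pb] := (away aw pw, away bw pw).
  rewrite !std_kernE ?(ltW pa) ?(ltW pb) // /c.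
  have ne u : 2 * rho < enorm (p - u) -> toC p - toC u != 0.
    rewrite subr_eq0 (inj_eq (@toC_inj R)); apply: contraTneq => ->.
    by rewrite subrr enorm0 -leNgt mulr_ge0 // ltW.
  by field; rewrite !ne.
rewrite E normcM normcM -enorm_toC -expr2 mulrC ler_wpM2r ?sqr_ge0 //.
exact: HK kkk.
Qed.

(** A function with quadratically small increments is constant: n + 1 equal steps along the segment
    give a total variation of at most K |a - w0|^2 / (n + 1). *)
Lemma dw_int_kern_const a : enorm (a - w0) < rho -> F a = F w0.
Proof.
move=> aw; have [K HK] := quadratic.
pose u (n j : nat) := w0 + (j%:R / n.+1%:R) *: (a - w0).
have uw n j : (j <= n.+1)%N -> enorm (u n j - w0) < rho.
  move=> jn; rewrite /u addrAC subrr add0r enormZ ger0_norm ?divr_ge0 //.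
  apply: le_lt_trans aw; rewrite ler_piMl ?enorm_ge0 // ler_pdivrMr //.
  by rewrite mul1r ler_nat.
have step n j : (j < n.+1)%N -> normc (F (u n j.+1) - F (u n j)) <=
    K * (enorm (a - w0) / n.+1%:R) ^+ 2.
  move=> jn; apply: le_trans (HK _ _ (uw n j.+1 jn) (uw n j (ltnW jn))) _.
  rewrite (_ : u n j.+1 - u n j = n.+1%:R^-1 *: (a - w0)).
    by rewrite enormZ ger0_norm ?invr_ge0 // [n.+1%:R^-1 * _]mulrC.
  rewrite /u opprD addrACA subrr add0r -scalerBl -mulrBl -natrB //.
  by rewrite subSnn mul1r.
have tot n j : (j <= n.+1)%N -> normc (F (u n j) - F w0) <=
    j%:R * (K * (enorm (a - w0) / n.+1%:R) ^+ 2).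
  elim: j => [|j IH] jn; first by rewrite /u !mul0r scale0r addr0 subrr normc0.
  rewrite -(subrKA (F (u n j))); apply: le_trans (normcD _ _) _.
  rewrite -add1n natrD mulrDl mul1r; apply: lerD; first exact: step.
  exact: IH (ltnW jn).
apply/eqP; rewrite -subr_eq0; apply/eqP/eq0_normc/eqP.
rewrite eq_le normc_ge0 andbT; apply/ler_addgt0Pr => e e0; rewrite add0r.
pose n := Num.truncn (`|K| * enorm (a - w0) ^+ 2 / e).
have := tot n n.+1 (leqnn _).
have -> : u n n.+1 = a by rewrite /u divff ?pnatr_eq0 // scale1r addrC subrK.
move=> H; apply: le_trans H _.
have n0 : (0 : R) < n.+1%:R by rewrite ltr0n.
have -> : n.+1%:R * (K * (enorm (a - w0) / n.+1%:R) ^+ 2) =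
    K * enorm (a - w0) ^+ 2 / n.+1%:R by field; rewrite nat1r gt_eqF.
rewrite ler_pdivrMr //; have := truncnS_gt (`|K| * enorm (a - w0) ^+ 2 / e).
rewrite -/n ltr_pdivrMr // => /ltW H2; rewrite [e * _]mulrC; apply: le_trans H2.
by rewrite ler_wpM2r ?sqr_ge0 // ler_norm.
Qed.

End LocallyConstant.

Lemma supp_far z : ~ supp z -> exists2 e, 0 < e & forall p, supp p -> e < enorm (p - z).
Proof.
move=> zs; have : nbhs z (~` supp).
  by apply: open_nbhs_nbhs; split=> //; exact: closed_openC chain_supp_closed.
move=> /nbhs_enormP[e e0 He]; exists (e / 2); first by rewrite divr_gt0.
move=> p ps; rewrite ltNge; apply/negP => pz; apply: (He p) => //.
by apply: le_lt_trans pz _; rewrite ltr_pdivrMr // mulr_natr mulr2n ltrDl.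
Qed.

Definition winding_hull : set V := [set w | supp w \/ Ind J w != 0].

(** Near a point off the support, winding numbers are integrals of kernels with one common radius,
    which are constant there. *)
Lemma winding_hull_closed : closed winding_hull.
Proof.
rewrite -openC; rewrite openE => w0 /not_orP[w0s /negP]; rewrite negbK => /eqP I0.
have [e e0 He] := supp_far w0s; pose rho := e / 4.
have rho0 : 0 < rho by rewrite divr_gt0.
have far p : supp p -> 4 * rho < enorm (p - w0) by move=> /He; rewrite mulrC divfK.
apply/nbhs_enormP; exists rho => // a aw [/far|/eqP]; first by lra.
have T0 := twopii_neq0 R.
have far2 b : enorm (b - w0) < rho -> forall p, supp p -> 2 * rho < enorm (p - b).
  by move=> bw p /far; have := enorm_triangle p b w0; lra.
apply; apply: (mulfI T0); rewrite -(dw_int_std_kern rho0 (far2 a aw)) mulr0.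
rewrite (dw_int_kern_const rho0 far aw) dw_int_std_kern ?I0 ?mulr0 //.
by apply: far2; rewrite subrr enorm0.
Qed.

End Winding.

Lemma cutoff_exists (R : realType) (X U : set 'rV[R]_2) : compact X -> open U ->
  X `<=` U -> exists chi, cutoff X U chi.
Proof.
move=> cX oU XU; have [d d0 Hd] := compact_in_open_margin cX oU XU.
have d4 : 0 < d / 4 by rewrite divr_gt0.
have [s [sX Xs]] := enorm_cover cX (fun _ _ => d4).
(* The product vanishes as soon as one bump is 1, which happens near X. The bumps of radius d/4
   vanish from distance d/2 on, and so chi is supported inside the margin d. *)
pose chi p := 1 - \prod_(a <- s) (1 - bump a (d / 4) p).
pose F := [set p | exists2 a, a \in s & enorm (p - a) <= d / 2].
have chi_s : smooth chi.
  move=> m; apply: of_class_CB; first exact: of_class_C_cst.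
  elim: (s) => [|a l IH].
    by rewrite (_ : (fun _ => _) = fun=> 1); [exact: of_class_C_cst|apply/funext => p; rewrite big_nil].
  rewrite (_ : (fun _ => _) = fun p => (1 - bump a (d / 4) p) * \prod_(a <- l) (1 - bump a (d / 4) p)).
    apply: of_class_CM IH; apply: of_class_CB; first exact: of_class_C_cst.
    exact: bump_smooth.
  by apply/funext => p; rewrite big_cons.
have chiF : [set p | chi p != 0] `<=` F.
  move=> p /= cp; apply: contrapT => nF; move/eqP: cp; apply.
  rewrite /chi big1_seq ?subrr // => a /andP[_ as_]; rewrite bump0 ?subr0 //.
  rewrite leNgt; apply/negP => pa; apply: nF; exists a => //.
  by apply: le_trans (ltW pa) _; lra.
have cF : closed F.
  rewrite /F; elim: (s) => [|a l IH].
    by rewrite (_ : [set _ | _] = set0); [exact: closed0|apply/seteqP; split=> p // [? ]].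
  rewrite (_ : [set _ | _] = [set p | enorm (p - a) <= d / 2] `|`
      [set p | exists2 a, a \in l & enorm (p - a) <= d / 2]).
    apply: closedU => //; rewrite -openC (_ : ~` _ = [set p | d / 2 < enorm (p - a)]).
      exact: enorm_gt_open.
    by apply/seteqP; split=> p /=; rewrite ltNge => /negP.
  apply/seteqP; split=> p /=.
    by move=> [b]; rewrite inE => /predU1P[-> ?|? ?]; [left|right; exists b].
  by move=> [?|[b bl ?]]; [exists a|exists b] => //; rewrite inE ?eqxx // bl orbT.
have FU : F `<=` U.
  by move=> p [a as_ pa]; apply: Hd (sX a as_) _; apply: le_lt_trans pa _; lra.
have clF : closure [set p | chi p != 0] `<=` F.
  by rewrite [X in _ `<=` X](closure_id F).1 //; exact: closure_subset.
have coF : compact F.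
  have S0 : 0 <= \sum_(a <- s) enorm a by apply: sumr_ge0 => a _; exact: enorm_ge0.
  apply: (subclosed_compact cF (@enorm_le_compact R 2 (d / 2 + \sum_(a <- s) enorm a))).
  move=> p [a as_ pa]; have := enorm_triangle p a 0; rewrite !subr0 => H.
  apply: le_trans H _; apply: lerD => //; rewrite (big_rem a) //= lerDl.
  by apply: sumr_ge0 => b _; exact: enorm_ge0.
exists chi; split=> //.
- by apply: (subclosed_compact _ coF clF); exact: closed_closure.
- exact: subset_trans clF FU.
exists [set p | exists2 a, a \in s & enorm (p - a) < d / 4]; split.
- rewrite openE => p [a as_ pa]; apply: filterS (_ : nbhs p [set q | enorm (q - a) < d / 4]).
    by move=> q /= qa; exists a.
  by apply: open_nbhs_nbhs; split=> //; exact: enorm_lt_open.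
- by move=> p /Xs.
move=> p [a as_ pa]; rewrite /chi (big_rem a) //= bump1 ?subrr ?mul0r ?subr0 //.
exact: ltW.
Qed.

(** * The Cauchy integral formula *)

Section IntegralExchange.
Variables (R : realType) (r : nat) (J : dchain R 2 1 r).
Local Notation V := 'rV[R]_2.
Local Notation C := R[i].
Local Notation supp := (chain_supp J).
Implicit Types (p q : V) (a b : R).

(** Points and weights depend on the chain alone, so for a pointed chain the exchange is linearity
    of [cint]. *)
Lemma dw_eval_seq (A : pchain R 2 1) :
  exists (X : seq V) (k : V -> C), forall g, dw_eval g A = \sum_(p <- X) k p * g p.
Proof.
have [X uX AX] := pchain_suppP A.
exists X, (fun p => \sum_S dw_dir R S * (A p S)%:C%C) => g.
have ReS (I : Type) (s : seq I) (F : I -> C) :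
    complex.Re (\sum_(i <- s) F i) = \sum_(i <- s) complex.Re (F i).
  by elim: s => [|i s IH]; rewrite ?big_nil // !big_cons ReD IH.
have ImS (I : Type) (s : seq I) (F : I -> C) :
    complex.Im (\sum_(i <- s) F i) = \sum_(i <- s) complex.Im (F i).
  by elim: s => [|i s IH]; rewrite ?big_nil // !big_cons ImD IH.
apply: complexP.
  rewrite ReS [LHS](form_eval_seq _ uX AX); apply: eq_bigr => p _.
  rewrite mulr_suml ReS; apply: eq_bigr => S _.
  by rewrite !ffunE -/(dw_dir R S) !(ReM, ImM) /=; ring.
rewrite ImS [LHS](form_eval_seq _ uX AX); apply: eq_bigr => p _.
rewrite mulr_suml ImS; apply: eq_bigr => S _.
by rewrite !ffunE -/(dw_dir R S) !(ReM, ImM) /=; ring.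
Qed.

Lemma cseg_cont0 a b : cseg_cont (fun=> 0 : C) a b.
Proof. by split=> x _; exact: cst_continuous. Qed.

Lemma cint0 a b : cint (fun=> 0 : C) a b = 0.
Proof. by apply: complexP; rewrite /= Rintegral_cst // mul0r. Qed.

Lemma cint_sum (I : eqType) (s : seq I) (k : I -> C) (g : I -> R -> C) a b :
  (forall i, cseg_cont (g i) a b) ->
  cseg_cont (fun t => \sum_(i <- s) k i * g i t) a b /\
  cint (fun t => \sum_(i <- s) k i * g i t) a b = \sum_(i <- s) k i * cint (g i) a b.
Proof.
move=> gc; elim: s => [|i s [IHc IHi]].
  rewrite big_nil (_ : (fun t => _) = fun=> 0); last by apply/funext => t; rewrite big_nil.
  by split; [exact: cseg_cont0|exact: cint0].
rewrite big_cons (_ : (fun t => _) = fun t => (\sum_(j <- s) k j * g j t) + k i * g i t).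
  split; first exact: cseg_cont_lin.
  by rewrite cint_lin // IHi addrC.
by apply/funext => t; rewrite big_cons addrC.
Qed.

Lemma cintZ (c : C) (g : R -> C) a b : cseg_cont g a b ->
  cseg_cont (fun t => c * g t) a b /\ cint (fun t => c * g t) a b = c * cint g a b.
Proof.
move=> gc; have [H1 H2] := cint_sum [:: tt] (fun=> c) (fun=> gc).
rewrite big_seq1 in H2; rewrite -H2.
rewrite (_ : (fun t => c * g t) = fun t => \sum_(i <- [:: tt]) c * g t) //.
by apply/funext => t; rewrite big_seq1.
Qed.

Lemma cseg_contM (g h : R -> C) a b : cseg_cont g a b -> cseg_cont h a b ->
  cseg_cont (fun t => g t * h t) a b.
Proof.
move=> [gr gi] [hr hi]; split=> x xab.
  rewrite (_ : _ \o _ = fun t => complex.Re (g t) * complex.Re (h t) -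
    complex.Im (g t) * complex.Im (h t)); last by apply/funext => t; rewrite /= ReM.
  exact: continuousB (continuousM (gr x xab) (hr x xab)) (continuousM (gi x xab) (hi x xab)).
rewrite (_ : _ \o _ = fun t => complex.Re (g t) * complex.Im (h t) +
  complex.Im (g t) * complex.Re (h t)); last by apply/funext => t; rewrite /= ImM.
exact: continuousD (continuousM (gr x xab) (hi x xab)) (continuousM (gi x xab) (hr x xab)).
Qed.

Lemma edge_pt_continuous h (x : R) : continuous (edge_pt h x).
Proof.
move=> t A /nbhs_enormP[e e0 eA]; exists e => // s /= ts; apply: eA.
rewrite enorm_toC; apply: le_lt_trans (edge_pt_lip h x s t) _.
by rewrite mul1r distrC.
Qed.

Lemma std_kern_edge_cont rho h (x : R) p a b : 0 < rho ->
  cseg_cont (fun t => std_kern rho (edge_pt h x t) p) a b.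
Proof.
move=> rho0; have [kR kI] := std_kern_smooth rho0 (0 : V).
have c1 (t : R) : {for t, continuous (fun t => p - edge_pt h x t)}.
  by apply: continuousB; [exact: cst_continuous|exact: edge_pt_continuous].
split=> t _.
  rewrite (_ : _ \o _ = (@complex.Re R \o std_kern rho 0) \o (fun t => p - edge_pt h x t)).
    by apply: continuous_comp (c1 t) _; exact: (of_class_C_continuous (kR 0)).
  by apply/funext => u; exact: (congr1 (@complex.Re R) (std_kern_shift _ _ _)).
rewrite (_ : _ \o _ = (@complex.Im R \o std_kern rho 0) \o (fun t => p - edge_pt h x t)).
  by apply: continuous_comp (c1 t) _; exact: (of_class_C_continuous (kI 0)).
by apply/funext => u; exact: (congr1 (@complex.Im R) (std_kern_shift _ _ _)).
Qed.

Lemma cint_gt (g : R -> C) a b : b < a -> cint g a b = 0.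
Proof.
move=> ba; apply: complexP; rewrite /= set_itv_ge ?Rintegral_set0 //.
  by rewrite bnd_simp -ltNge.
by rewrite bnd_simp -ltNge.
Qed.

(** For an approximating pointed chain the two integrals commute. The common bound M makes its error
    uniform in t by [dw_int_unif], so the error survives integration over [a, b]. *)
Lemma dw_cvg_cint (G : R -> V -> C) (phi : R -> C) a b M :
  (forall t, a <= t <= b -> cBd r M (G t)) ->
  (forall t, a <= t <= b -> dw_int J (G t) = phi t) ->
  (forall p, cseg_cont (fun t => G t p) a b) -> cseg_cont phi a b ->
  dw_cvg J (fun p => cint (fun t => G t p) a b) (cint phi a b).
Proof.
move=> GM GJ Gc pc; have [ab|ba] := leP a b; last first.
  rewrite cint_gt // (_ : (fun p => _) = fun=> 0); first exact: dw_cvg0.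
  by apply/funext => p; rewrite cint_gt.
move=> e e0; have M0 : 0 <= M by apply: (cBd_ge0 (GM a _)); rewrite lexx.
pose D := 2 * M * (b - a) + 1.
have D0 : 0 < D by rewrite ltr_wpDl // !mulr_ge0 ?subr_ge0.
have [N HN] := dw_int_unif J (divr_gt0 e0 D0); exists N => i Ni.
have [X [k Xk]] := dw_eval_seq (chain_seq J i).
have [Sc SE] := cint_sum X k Gc.
rewrite Xk -SE -[cint phi a b]mul1r -mulNr -cint_lin //.
apply: (@le_lt_trans _ _ (2 * (M * (e / D)) * (b - a))).
  apply: cint_le => //; first exact: cseg_cont_lin.
  by move=> t tab; rewrite mulN1r -Xk -GJ //; apply: HN => //; exact: GM.
rewrite (_ : 2 * (M * (e / D)) * (b - a) = 2 * M * (b - a) * e / D); last by ring.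
by rewrite ltr_pdivrMr // mulrC ltr_pM2l // ltrDl.
Qed.

End IntegralExchange.

Section EdgeMargins.
Variable R : realType.
Local Notation V := 'rV[R]_2.

(** [edge_dist] gives a positive distance at each point of K; half of it, over a finite cover, is
    uniform. *)
Lemma edge_compact_margin e (K : set V) : compact K ->
  (forall q, on_edge e q -> ~ K q) ->
  exists2 d, 0 < d & forall q p, on_edge e q -> K p -> d <= enorm (q - p).
Proof.
move=> cK eK.
have /choice[d Hd] p : exists d, K p -> 0 < d /\ forall q, on_edge e q -> 2 * d <= enorm (q - p).
  have [Kp|] := pselect (K p); last by exists 0.
  have [q eq|d d0 Hd] := @edge_dist R e p.
    by apply: contra_notN (eK q eq) => /eqP ->.
  exists (d / 2) => _; split; first by rewrite divr_gt0.
  by move=> q /Hd; rewrite mulrC divfK.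
have [s [sK Ks]] := enorm_cover cK (fun p Kp => (Hd p Kp).1).
have [|a as_|m m0 Hm] := @seq_uniform_pos R _ s (fun a m => m <= d a).
- by move=> a x y xd yx; exact: le_trans xd.
- by exists (d a) => //; have [] := Hd a (sK a as_).
exists m => // q p eq Kp; have [a as_ pa] := Ks p Kp.
have [_ /(_ q eq) qa] := Hd a (sK a as_); have ma := Hm a as_.
have := enorm_triangle q p a; lra.
Qed.

Lemma edges_margin (s : seq (R[i] * bool * R * R * R)) (K : set V) : compact K ->
  (forall e q, e \in s -> on_edge e q -> ~ K q) ->
  exists2 d, 0 < d & forall e q p, e \in s -> on_edge e q -> K p -> d <= enorm (q - p).
Proof.
move=> cK sK; have [|e es|d d0 Hd] := @seq_uniform_pos R _ s
    (fun e d => forall q p, on_edge e q -> K p -> d <= enorm (q - p)).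
- by move=> e d d' H dd q p eq Kp; apply: le_trans dd (H q p eq Kp).
- by apply: edge_compact_margin => // q; exact: sK.
by exists d => // e q p es; exact: Hd.
Qed.

End EdgeMargins.

Section CauchyFormula.
Variables (R : realType) (r : nat) (J : dchain R 2 1 r).
Local Notation V := 'rV[R]_2.
Local Notation C := R[i].
Local Notation supp := (chain_supp J).
Variables (U : set V) (f : C -> C) (z : V).
Hypotheses (Jc : closed_chain J) (oU : open U) (bU : bounded_set U) (JU : supp `<=` U)
  (J0 : forall w, ~ U w -> Ind J w = 0)
  (fU : forall p, U p -> derivable (f : C^o -> C^o) (toC p) 1)
  (Uz : U z) (zJ : ~ supp z).

Lemma winding_hull_sub : winding_hull J `<=` U.
Proof.
move=> w [/JU //|Iw]; apply: contrapT => /J0 I0.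
by rewrite I0 eqxx in Iw.
Qed.

Lemma winding_hull_compact : compact (winding_hull J).
Proof.
apply: bounded_closed_compact; last exact: winding_hull_closed.
by have [M [Mr HM]] := bU; exists M; split=> // x Mx p /winding_hull_sub; exact: HM.
Qed.

Lemma cutoff_integral chi : cutoff supp (U `\ z) chi ->
  dw_int J (fun p => (chi p)%:C%C * (f (toC p) / (toC p - toC z))) =
  f (toC z) * (twopii R * Ind J z).
Proof.
move=> [chi_s cS SU [W [oW JW chi1]]].
set S := closure [set p | chi p != 0] in cS SU.
pose K := winding_hull J `|` [set z] `|` S.
have cK : compact K.
  apply: compactU cS; apply: compactU; first exact: winding_hull_compact.
  exact: compact_set1.
have KU : K `<=` U by move=> p [[/winding_hull_sub|->]|/SU []].
have [s [sU sC]] := Cauchy_cycle cK oU KU fU.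
have sK e q : e \in s -> on_edge e q -> ~ K q by move=> es eq; have [] := sU e q es eq.
have [d d0 Hd] := edges_margin cK sK.
have [d' d'0 Hd'] : exists2 d', 0 < d' & forall p, supp p \/ S p -> d' <= enorm (p - z).
  have : nbhs z (~` (supp `|` S)).
    apply: open_nbhs_nbhs; split.
      by apply: closed_openC; apply: closedU; [exact: chain_supp_closed|exact: closed_closure].
    by move=> [//|/SU[_]]; apply.
  move=> /nbhs_enormP[e e0 He]; exists e => // p pS; rewrite leNgt; apply/negP => /He.
  exact.
(* With 2 rho below both margins, [std_kern] is the true Cauchy kernel at all pairs of points that
   occur. *)
pose rho := Num.min d d' / 3.
have rho0 : 0 < rho by rewrite divr_gt0 // lt_min d0.
have rhod : 2 * rho < d.
  have : Num.min d d' <= d by rewrite ge_min lexx.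
  by rewrite /rho; lra.
have rhod' : 2 * rho < d'.
  have : Num.min d d' <= d' by rewrite ge_min lexx orbT.
  by rewrite /rho; lra.
have Jz p : supp p -> 2 * rho < enorm (p - z).
  by move=> ps; apply: lt_le_trans rhod' (Hd' p _); left.
have Kfar e q p : e \in s -> on_edge e q -> K p -> 2 * rho < enorm (p - q).
  by move=> es eq Kp; rewrite enorm_distC; apply: lt_le_trans rhod (Hd e q p es eq Kp).
have KJ p : supp p -> K p by move=> ps; left; left; left.
have [N HN] := std_kern_cBd rho0 r.
have [Nc HNc] : exists Nc, Bd r Nc chi.
  apply: smooth_bounded_support_Bd; first exact: chi_s.
  have [B B0 HB] := compact_coord_bound cS.
  exists (2 * B) => p Bp; apply/eqP; apply: contraTT Bp => cp.
  have Sp : S p by exact: subset_closure.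
  rewrite -leNgt -normc_toC; apply: le_trans (normc_le _) _.
  by have := HB p 0 Sp; have := HB p 1 Sp; rewrite /=; lra.
pose k q := std_kern rho q.
(* [k q p] stands for 1/(p - q), whereas Cauchy's formula at p has 1/(q - p); hence the minus
   sign. *)
pose G q p : C := f (toC q) * ((chi p)%:C%C * (k z p * - k q p)).
pose NN := 2 ^+ r.+1 * Nc * (2 ^+ r.+1 * N * N).
have GE q : cBd r (2 ^+ r.+1 * normc (f (toC q)) * NN) (G q) :=
  cBdZ (f (toC q)) (cBdM (cBd_real HNc) (cBdM (HN z) (cBdN (HN q)))).
have NN0 : 0 <= NN := cBd_ge0 (cBdM (cBd_real HNc) (cBdM (HN z) (cBdN (HN z)))).
have dcont e q : e \in s -> on_edge e q -> derivable (f : C^o -> C^o) (toC q) 1.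
  by move=> es eq; apply: fU; have [] := sU e q es eq.
have cne (p q : V) : p != q -> toC p - toC q != 0.
  by move=> pq; rewrite subr_eq0; apply: contra pq => /eqP/toC_inj ->.
have fne (p q : V) : 2 * rho < enorm (p - q) -> p != q.
  by apply: contraTneq => ->; rewrite subrr enorm0 -leNgt mulr_ge0 // ltW.
have zK : K z by left; right.
(* Near supp J the factor chi is 1 and partial fractions separate the poles z and q. The term with
   pole q integrates to 0 because q lies off the winding hull. *)
have GJ e q : e \in s -> on_edge e q ->
    dw_int J (G q) = twopii R * Ind J z * (f (toC q) / (toC q - toC z)).
  move=> es eq; pose c := f (toC q) / (toC q - toC z).
  have qJ p : supp p -> 2 * rho < enorm (p - q) by move=> /KJ; exact: (Kfar e).
  have Iq : Ind J q = 0.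
    apply: contrapT => /eqP Iq; apply: (sK e q es eq); left; left; right.
    exact: Iq.
  have B2 := cBdD (cBdZ c (HN z)) (cBdZ (- c) (HN q)).
  rewrite (@dw_int_eq _ _ _ _ _ _ (fun p => c * k z p + (- c) * k q p)
      (W `&` [set p | 2 * rho < enorm (p - z)] `&` [set p | 2 * rho < enorm (p - q)]) (GE q) B2).
  - rewrite (dw_int_lin J (- c) (cBdZ c (HN z)) (HN q)).
    rewrite (dw_int_std_kern rho0 qJ) Iq !mulr0 addr0.
    rewrite (dw_cvg_int (dw_cvgZ c (cBd_dw_cvg J (HN z)))) (dw_int_std_kern rho0 Jz).
    by rewrite mulrC.
  - by apply: openI; [apply: openI => //; exact: enorm_gt_open|exact: enorm_gt_open].
  - by move=> p ps; split; [split; [exact: JW|exact: Jz]|exact: qJ].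
  move=> p [[Wp pz] pq]; rewrite /G chi1 // mul1r /k !std_kernE ?ltW // /c.
  have n1 := cne _ _ (fne _ _ pz); have n2 := cne _ _ (fne _ _ pq).
  have n3 : toC q - toC z != 0.
    by apply: cne; apply: contra_not_neq (sK e q es eq) => ->.
  by field; rewrite n1 n2 n3.
pose tm (e : C * bool * R * R * R) p : C := let: (c, h, x, a, b) := e in
  cint (fun t => G (edge_pt h x t) p) a b.
pose co (e : C * bool * R * R * R) : C := e.1.1.1.1.
have qcont e w : e \in s -> (forall q, on_edge e q -> q != w) ->
    let: (c, h, x, a, b) := e in
    cseg_cont (fun t => f (toC (edge_pt h x t)) / (toC (edge_pt h x t) - toC w)) a b.
  case: e => [[[[c h] x] a] b] es ew.
  apply: (@edge_cseg R (fun u => f u / (u - toC w)) c) => q eq.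
  have [|D] := @cdiff_quot R f (toC w) (toC q) (dcont _ _ es eq).
    by rewrite (inj_eq (@toC_inj R)) ew.
  exact: cdiff_ccont.
have tm_cvg e : e \in s -> dw_cvg J (tm e)
    (twopii R * Ind J z * (let: (c, h, x, a, b) := e in
      cint (fun t => f (toC (edge_pt h x t)) / (toC (edge_pt h x t) - toC z)) a b)).
  move=> es; have fc q : on_edge e q -> ccont_at f (toC q).
    by move=> /(dcont e q es) /derivable_cdiff[D]; exact: cdiff_ccont.
  have [Mf HMf] := ccont_bounded_edge fc.
  have ez q : on_edge e q -> q != z.
    by move=> eq; apply: contra_not_neq (sK e q es eq) => ->.
  move: (qcont e z es ez); case: e es fc HMf ez => [[[[c h] x] a] b] es fc HMf ez qc.
  have [qc' <-] := cintZ (twopii R * Ind J z) qc.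
  apply: (@dw_cvg_cint _ _ _ _ _ _ _ (2 ^+ r.+1 * Mf * NN)) => //.
  - move=> t tab; apply: cBd_le (leqnn r) _ (GE _).
    rewrite ler_wpM2r // ler_wpM2l ?exprn_ge0 //; apply: HMf.
    by exists t.
  - by move=> t tab; apply: GJ es _; exists t.
  move=> p; rewrite /G; apply: cseg_contM; first exact: edge_cseg fc.
  have [+ _] := cintZ (- ((chi p)%:C%C * k z p)) (std_kern_edge_cont h x p a b rho0).
  by congr cseg_cont; apply/funext => t; rewrite /k; ring.
(* Both sides vanish where chi does; any other p lies in K, so the formula for the cycle applies at
   p. *)
have main p : twopii R * ((chi p)%:C%C * (f (toC p) / (toC p - toC z))) =
    \sum_(e <- s) co e * tm e p.
  have [c0|cp] := eqVneq (chi p) 0.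
    rewrite c0 mul0r mulr0 big1 // => -[[[[c h] x] a] b] _.
    rewrite /tm (_ : (fun t => _) = fun=> 0) ?cint0 ?mulr0 //.
    by apply/funext => t; rewrite /G c0 mul0r mulr0.
  have Sp : S p by exact: subset_closure.
  have Kp : K p by right.
  have pz : 2 * rho < enorm (p - z) by apply: lt_le_trans rhod' (Hd' p _); right.
  transitivity ((chi p)%:C%C / (toC p - toC z) * (f (toC p) * twopii R)); first by ring.
  rewrite (sC p Kp) mulr_sumr big_seq [RHS]big_seq; apply: eq_bigr => e es.
  have ep q : on_edge e q -> q != p.
    by move=> eq; apply: contra_not_neq (sK e q es eq) => ->.
  move: (qcont e p es ep); case: e es ep => [[[[c h] x] a] b] es ep qc.
  rewrite /= mulrCA; congr (_ * _); have [_ <-] := cintZ ((chi p)%:C%C / (toC p - toC z)) qc.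
  apply: cint_eq => t tab; set q := edge_pt h x t.
  have eq : on_edge (c, h, x, a, b) q by exists t.
  have pq := Kfar _ _ _ es eq Kp.
  rewrite /G /k !std_kernE ?ltW //.
  have n1 := cne _ _ (fne _ _ pz); have n2 := cne _ _ (fne _ _ pq).
  have n3 := cne _ _ (ep q eq).
  by field; rewrite n1 n2 n3.
apply: dw_cvg_int.
have := dw_cvgZ (twopii R)^-1 (dw_cvg_sum co tm_cvg).
have -> : (twopii R)^-1 * \sum_(e <- s) co e * (twopii R * Ind J z * (let: (c, h, x, a, b) := e in
      cint (fun t => f (toC (edge_pt h x t)) / (toC (edge_pt h x t) - toC z)) a b)) =
    f (toC z) * (twopii R * Ind J z).
  rewrite (_ : \sum_(e <- s) _ = twopii R * Ind J z * (f (toC z) * twopii R)).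
    by field; exact: twopii_neq0.
  rewrite (sC z zK) mulr_sumr; apply: eq_bigr => -[[[[c h] x] a] b] _ /=.
  by rewrite mulrCA.
congr dw_cvg; apply/funext => p; rewrite -main mulKf //; exact: twopii_neq0.
Qed.

End CauchyFormula.

Theorem theorem3p6p1 (R : realType) (r : nat) (J : dchain R 2 1 r)
    (U : set 'rV[R]_2) (f : R[i] -> R[i]) (z : 'rV[R]_2) :
  (1 <= r)%N ->
  closed_chain J ->
  open U -> bounded_set U -> chain_supp J `<=` U ->
  (forall w : 'rV[R]_2, ~ U w -> Ind J w = 0) ->
  (exists K : dchain R 2 2 r.-1, (chain_mass K < +oo)%E /\ is_boundary K J) ->
  holomorphic f (@toC R @` U) ->
  U z -> ~ chain_supp J z ->
  f (toC z) * Ind J z =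
    (twopii R)^-1 *
    local_integral J (U `\ z) (fun p => f (toC p) / (toC p - toC z)).
Proof.
move=> _ Jc oU bU JU J0 _ fU Uz zJ.
have fU' p : U p -> derivable (f : R[i]^o -> R[i]^o) (toC p) 1.
  by move=> Up; apply: fU; exists p.
have E chi := @cutoff_integral R r J U f z Jc oU bU JU J0 fU' Uz zJ chi.
have cJ : compact (chain_supp J).
  apply: bounded_closed_compact; last exact: chain_supp_closed.
  by have [M [Mr HM]] := bU; exists M; split=> // x Mx p /JU; exact: HM.
(* Either some cutoff was chosen, and the formula holds for it, or there is none and the default 0
   was returned; [cutoff_exists] rules this out. *)
rewrite /local_integral; case: xgetP => [I _ [chi chi_c ->]|H].
  by rewrite [chain_cint J _](E chi chi_c); field; exact: twopii_neq0.
have [||chi chi_c] := @cutoff_exists R (chain_supp J) (U `\ z) cJ.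
- rewrite setDE; apply: openI => //; apply: closed_openC.
  by apply: compact_closed; [exact: norm_hausdorff|exact: compact_set1].
- by move=> p pJ; split; [exact: JU|move=> /= pz; apply: zJ; rewrite -pz].
by case: (H (dw_int J (fun p => (chi p)%:C%C * (f (toC p) / (toC p - toC z))))); exists chi.
Qed.
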